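(* Let $U$ be a finite-dimensional Hopf algebra containing $A=\mathrm{Map}(\mathbb T,k)$ as a Hopf subalgebra, $\mathbb T$ a finite Abelian group, and let $J(\lambda)$ be a dynamical twist for $U$. Then, with the comultiplication, counit, multiplication, unit and antipode described in the context, $D_J$ (on the vector space $\mathrm{Map}(\mathbb T\times\mathbb T,k)\otimes U^*$) becomes a weak Hopf algebra opposite to $H_J^*$, i.e. $D_J=(H_J^* )^{op}$, where $D_J$ is identified with the dual space of $H_J$ via the pairing $\langle\cdot,\cdot\rangle$.
   Context: $k$ is an algebraically closed field. A weak bialgebra is a $k$-vector space $H$ with an algebra structure $(m,1)$ and a coalgebra structure $(\Delta,\varepsilon)$ such that $\Delta(hg)=\Delta(h)\Delta(g)$; $\varepsilon(hgf)=\varepsilon(hg_{(1)})\varepsilon(g_{(2)}f)=\varepsilon(hg_{(2)})\varepsilon(g_{(1)}f)$; $(\Delta\otimes\mathrm{id})\Delta(1)=(\Delta(1)\otimes1)(1\otimes\Delta(1))=(1\otimes\Delta(1))(\Delta(1)\otimes1)$. A weak Hopf algebra is a weak bialgebra with a linear map $S$ (antipode) such that $m(\mathrm{id}\otimes S)\Delta(h)=(\varepsilon\otimes\mathrm{id})(\Delta(1)(h\otimes1))$, $m(S\otimes\mathrm{id})\Delta(h)=(\mathrm{id}\otimes\varepsilon)((1\otimes h)\Delta(1))$, $S(h_{(1)})h_{(2)}S(h_{(3)})=S(h)$. For finite-dimensional $H$ the antipode is bijective, the dual $H^*$ is a weak Hopf algebra with transposed operations, and $H^{op}$ (opposite multiplication,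 same coalgebra, antipode $S^{-1}$) is a weak Hopf algebra. $\mathbb T$ is written additively; $P_\mu$ ($\mu\in\mathbb T$) are the minimal idempotents of $A$. An element of $U^{\otimes n}$ has zero weight if it commutes with the iterated coproduct $\Delta^n(a)\in A^{\otimes n}$ for all $a\in A$. A dynamical twist is an invertible, zero weight $U^{\otimes 2}$-valued function $J(\lambda)$ on $\mathbb T$ such that $(\Delta\otimes\mathrm{id})J(\lambda)\,(J(\lambda+h^{(3)})\otimes1)=(\mathrm{id}\otimes\Delta)J(\lambda)\,(1\otimes J(\lambda))$ and $(\varepsilon\otimes\mathrm{id})J(\lambda)=(\mathrm{id}\otimes\varepsilon)J(\lambda)=1$, where $J(\lambda+h^{(3)})\otimes 1$ means $\sum_\mu J(\lambda+\mu)\otimes P_\mu$. Write $J(\lambda)=J^{(1)}(\lambda)\otimes J^{(2)}(\lambda)$ and $J^{-1}(\lambda)=\bar J^{(1)}(\lambda)\otimes\bar J^{(2)}(\lambda)$. The weak Hopf algebra $H_J$: $\mathrm{End}_k(A)$ has matrix units $E_{\lambda\mu}$ ($\lambda,\mu\in\mathbb T$, $E_{\lambda\mu}E_{\mu'\nu}=\delta_{\mu\mu'}E_{\lambda\nu}$) and is a weak Hopf algebra with $\Delta(E_{\lambda\mu})=E_{\lambda\mu}\otimes E_{\lambda\mu}$, $\varepsilon(E_{\lambda\mu})=1$, $S(E_{\lambda\mu})=E_{\mu\lambda}$. Let $H=\mathrm{End}_k(A)\otimes U$ (tensor product weak Hopf algebra, $E_{\lambda\mu}u:=E_{\lambda\mu}\otimes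 u$), and in $H\otimes H$ put $F=\sum_{\lambda,\mu}E_{\lambda,\lambda+\mu}J^{(1)}(\lambda)\otimes E_{\lambda\lambda}J^{(2)}(\lambda)P_\mu$ and $\bar F=\sum_{\lambda,\mu}E_{\lambda+\mu,\lambda}\bar J^{(1)}(\lambda)\otimes E_{\lambda\lambda}P_\mu\bar J^{(2)}(\lambda)$. $H_J$ is the weak Hopf algebra with the multiplication, unit and counit of $H$, comultiplication $\Delta_J(h)=\bar F\Delta(h)F$ and antipode $S_J(h)=v^{-1}S(h)v$, $v=m(S\otimes\mathrm{id})F$ (invertible). Pairing: for $\mathbb I_{\lambda^1\lambda^2}$ the delta function at $(\lambda^1,\lambda^2)$ on $\mathbb T\times\mathbb T$, $x\in U^*$, $u\in U$, let $\langle\mathbb I_{\lambda^1\lambda^2}x,E_{\alpha^1\alpha^2}u\rangle=\delta_{\lambda^1\alpha^1}\delta_{\lambda^2\alpha^2}\langle x,u\rangle$; this identifies $D=\mathrm{Map}(\mathbb T\times\mathbb T,k)\otimes U^*$ with the dual space of $H$. Here $fx=f\otimes x$, and $f\in\mathrm{Map}(\mathbb T\times\mathbb T,k)$, $x\in U^*$ are identified with $f\otimes\varepsilon_U$, $1\otimes x$ ($\varepsilon_U$ the counit of $U$). $U^*$ is bigraded: $U^*=\bigoplus U^*[\alpha^1,\alpha^2]$, $U^*[\alpha^1,\alpha^2]=\mathrm{Hom}_k(P_{\alpha^1}UP_{\alpha^2},k)$. Structure of $D_J$ (on the space $D$): (1) the coalgebra structure is dual to the algebra structure of $H$: it is the tensor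 product of the coalgebra $U^*$ (dual to the algebra $U$) and of $\mathrm{Map}(\mathbb T\times\mathbb T,k)$ with $(\Delta f)((\lambda^1,\lambda^2),(\mu^1,\mu^2))=\delta_{\lambda^2\mu^1}f(\lambda^1,\mu^2)$, $\varepsilon(f)=\sum_\lambda f(\lambda,\lambda)$; (2) multiplication: functions in $\mathrm{Map}(\mathbb T\times\mathbb T,k)$ multiply pointwise; the product of a function $f$ on the left with $x\in U^*$ is $f\otimes x$; $L\,f(\lambda^1,\lambda^2)=f(\lambda^1+\alpha^1,\lambda^2+\alpha^2)\,L$ for $L\in U^*[\alpha^1,\alpha^2]$; and for $x,y\in U^*$ the product $xy\in D_J$ is determined by $\langle xy,E_{\nu^1\nu^2}u\rangle=\langle y\otimes x,\ J^{-1}(\nu^1)\Delta(u)J(\nu^2)\rangle$ for all $\nu^1,\nu^2\in\mathbb T$, $u\in U$; (3) the unit is $1\otimes\varepsilon_U$; (4) the antipode $S$ of $D_J$ is the algebra anti-homomorphism with $(Sf)(\lambda^1,\lambda^2)=f(\lambda^2,\lambda^1)$ and $\langle S(x),E_{\nu^1\nu^2}u\rangle=\langle x,\ \bar K(\nu^2)\,S^{-1}(u)\,K(\nu^1)\rangle$ for $x\in U^*$, $u\in U$, $\nu^1,\nu^2\in\mathbb T$, where on the right $S$ is the antipode of $U$ and $\bar K$, $K$ are the $U$-valued functions on $\mathbb T$ given by $\bar K(\lambda)=m(\mathrm{id}\otimes S)J^{-1}(\lambda)=\bar J^{(1)}(\lambda)S(\bar J^{(2)}(\lambda))$ and $K(\lambda)=(m(S\otimes\mathrm{id})J)(\lambda-h)$,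 i.e. $K(\lambda)=\sum_\mu S(J^{(1)}(\lambda-\mu))J^{(2)}(\lambda-\mu)P_\mu$.
   Formalization: The antipode formula in (4) fails (Sweedler's algebra, trivial T, J=Δ(y⁻¹)(y⊗y), y=1+x); it is replaced by ⟨S⁻¹(x),E_{ν1ν2}u⟩=⟨x,K̄(ν2)S(u)K(ν1)⟩ with S bijective, in place of ⟨S(x),E_{ν1ν2}u⟩=⟨x,K̄(ν2)S⁻¹(u)K(ν1)⟩. *)

(* Defs.v *)
From HB Require Import structures.
From mathcomp Require Import all_boot all_algebra.

Set Implicit Arguments.
Unset Strict Implicit.
Unset Printing Implicit Defensive.

Import GRing.Theory VectorInternalTheory.
Local Open Scope ring_scope.

(* V ⊗ W is modelled by the matrices of coordinates of tensors in the library
   bases of V and W. [tsum t f] is the value on t of the linear map induced by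
   a bilinear f, that is, the Sweedler sum of f (t_(1), t_(2)); this does not
   depend on the bases when f is bilinear, which holds at every use below. *)
Section Tensor.
Variable k : fieldType.

Definition bvec (V : vectType k) (i : 'I_(dim V)) : V := r2v (delta_mx 0 i).
Definition bcovec (V : vectType k) (i : 'I_(dim V)) : 'Hom(V, k^o) :=
  linfun (fun v : V => v2r v 0 i : k^o).

Definition tens (V W : vectType k) : vectType k := 'M[k]_(dim V, dim W).

Definition tensv (V W : vectType k) (v : V) (w : W) : tens V W :=
  (v2r v)^T *m v2r w.

Definition tsum (V W : vectType k) (X : lmodType k) (t : tens V W)
    (f : V -> W -> X) : X :=
  \sum_i \sum_j (t : 'M[k]_(dim V, dim W)) i j *: f (bvec i) (bvec j).

End Tensor.

Notation "v ⊗ w" := (tensv v w) (at level 40, left associativity).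
Notation "\tsum_ ( a , b <- t ) E" := (tsum t (fun a b => E))
  (at level 41, a name, b name, t at level 200, E at level 41,
   format "\tsum_ ( a , b  <-  t )  E").

Section Structures.
Variable k : fieldType.
Implicit Types V W X : vectType k.

Definition tlin V W X (f : V -> W -> X) : 'Hom(tens V W, X) :=
  linfun (fun t : tens V W => \tsum_(a, b <- t) f a b).

Definition tmap V W V' W' (f : V -> V') (g : W -> W') : 'Hom(tens V W, tens V' W') :=
  tlin (fun v w => f v ⊗ g w).

Definition tassoc V W X : 'Hom(tens V (tens W X), tens (tens V W) X) :=
  tlin (fun v s => \tsum_(w, x <- s) (v ⊗ w) ⊗ x).

(* Structures on a fixed vector space are kept as plain data, separate from
   their axioms, because one space carries several of them (H and H_J). *)
Record algebra V := Algebra { amul : 'Hom(tens V V, V); aone : V }.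

Record coalgebra V :=
  Coalgebra { comul : 'Hom(V, tens V V); counit : 'Hom(V, k^o) }.

Record whopf_data V := WHopfData
  { walg :> algebra V; wcoalg :> coalgebra V; antipode : 'End(V) }.

Definition mul V (A : algebra V) (x y : V) : V := amul A (x ⊗ y).

End Structures.

Notation "x *[ A ] y" := (mul A x y)
  (at level 40, left associativity, format "x  *[ A ]  y").

Section WeakHopf.
Variable k : fieldType.
Implicit Types V W : vectType k.

Record is_algebra V (A : algebra V) : Prop := IsAlgebra
  { amulA : forall x y z, x *[A] (y *[A] z) = (x *[A] y) *[A] z;
    amul1l : forall x, aone A *[A] x = x;
    amul1r : forall x, x *[A] aone A = x }.

Record is_coalgebra V (C : coalgebra V) : Prop := IsCoalgebra
  { comulA : forall x,
      tmap (comul C) id (comul C x) = tassoc V V V (tmap id (comul C) (comul C x));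
    counitl : forall x, \tsum_(a, b <- comul C x) (counit C a *: b) = x;
    counitr : forall x, \tsum_(a, b <- comul C x) (counit C b *: a) = x }.

Definition tens_alg V W (A : algebra V) (B : algebra W) : algebra (tens V W) :=
  Algebra
    (tlin (fun s t : tens V W =>
       \tsum_(a, b <- s) \tsum_(c, d <- t) (a *[A] c) ⊗ (b *[B] d)))
    (aone A ⊗ aone B).

Definition tens_coalg V W (C : coalgebra V) (D : coalgebra W) :
    coalgebra (tens V W) :=
  Coalgebra
    (tlin (fun v w =>
       \tsum_(v1, v2 <- comul C v) \tsum_(w1, w2 <- comul D w)
         (v1 ⊗ w1) ⊗ (v2 ⊗ w2)))
    (tlin (fun v w => counit C v * counit D w : k^o)).

Definition tens_whopf V W (G : whopf_data V) (H : whopf_data W) :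
    whopf_data (tens V W) :=
  WHopfData (tens_alg G H) (tens_coalg G H) (tmap (antipode G) (antipode H)).

Record weak_bialgebra V (H : whopf_data V) : Prop := WeakBialgebra
  { wb_alg : is_algebra H;
    wb_coalg : is_coalgebra H;
    wb_comulM : forall h g,
      comul H (h *[H] g) = comul H h *[tens_alg H H] comul H g;
    wb_counitMl : forall h g f,
      counit H (h *[H] g *[H] f) =
      \tsum_(g1, g2 <- comul H g) (counit H (h *[H] g1) * counit H (g2 *[H] f) : k^o);
    wb_counitMr : forall h g f,
      counit H (h *[H] g *[H] f) =
      \tsum_(g1, g2 <- comul H g) (counit H (h *[H] g2) * counit H (g1 *[H] f) : k^o);
    wb_comul1l :
      tmap (comul H) id (comul H (aone H)) =
      (comul H (aone H) ⊗ aone H) *[tens_alg (tens_alg H H) H]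
        tassoc V V V (aone H ⊗ comul H (aone H));
    wb_comul1r :
      tmap (comul H) id (comul H (aone H)) =
      tassoc V V V (aone H ⊗ comul H (aone H)) *[tens_alg (tens_alg H H) H]
        (comul H (aone H) ⊗ aone H) }.

Record weak_hopf V (H : whopf_data V) : Prop := WeakHopf
  { wh_wb : weak_bialgebra H;
    wh_antipoder : forall h,
      \tsum_(h1, h2 <- comul H h) (h1 *[H] antipode H h2) =
      \tsum_(a, b <- comul H (aone H) *[tens_alg H H] (h ⊗ aone H))
        (counit H a *: b);
    wh_antipodel : forall h,
      \tsum_(h1, h2 <- comul H h) (antipode H h1 *[H] h2) =
      \tsum_(a, b <- (aone H ⊗ h) *[tens_alg H H] comul H (aone H))
        (counit H b *: a);
    wh_antipode : forall h,
      \tsum_(h12, h3 <- comul H h) \tsum_(h1, h2 <- comul H h12)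
        (antipode H h1 *[H] h2 *[H] antipode H h3) = antipode H h }.

Record hopf V (H : whopf_data V) : Prop := Hopf
  { hopf_alg : is_algebra H;
    hopf_coalg : is_coalgebra H;
    hopf_comulM : forall h g,
      comul H (h *[H] g) = comul H h *[tens_alg H H] comul H g;
    hopf_comul1 : comul H (aone H) = aone H ⊗ aone H;
    hopf_counitM : forall h g, counit H (h *[H] g) = counit H h * counit H g;
    hopf_counit1 : counit H (aone H) = 1;
    hopf_antipoder : forall h,
      \tsum_(h1, h2 <- comul H h) (h1 *[H] antipode H h2) = counit H h *: aone H;
    hopf_antipodel : forall h,
      \tsum_(h1, h2 <- comul H h) (antipode H h1 *[H] h2) = counit H h *: aone H }.

Record is_morphism V W (G : whopf_data V) (H : whopf_data W) (f : 'Hom(V, W)) :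
    Prop := IsMorphism
  { morM : forall x y, f (x *[G] y) = f x *[H] f y;
    mor1 : f (aone G) = aone H;
    mor_comul : forall x, comul H (f x) = tmap f f (comul G x);
    mor_counit : forall x, counit H (f x) = counit G x;
    mor_antipode : forall x, f (antipode G x) = antipode H (f x) }.

Definition invertible V (A : algebra V) (x : V) : Prop :=
  exists y, x *[A] y = aone A /\ y *[A] x = aone A.

(* The inverse of x when x is invertible: the preimage of 1 under left
   multiplication by x. *)
Definition ainv V (A : algebra V) (x : V) : V :=
  ((linfun (fun y : V => x *[A] y))^-1)%VF (aone A).

Definition dual_alg V (C : coalgebra V) : algebra 'Hom(V, k^o) :=
  Algebra
    (tlin (fun x y : 'Hom(V, k^o) =>
       linfun (fun v : V => \tsum_(a, b <- comul C v) (x a * y b : k^o))))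
    (counit C).

(* comul x is the element of the tensor square of the dual that represents the
   functional v ⊗ w |-> x (v w). *)
Definition dual_coalg V (A : algebra V) : coalgebra 'Hom(V, k^o) :=
  Coalgebra
    (linfun (fun x : 'Hom(V, k^o) =>
       \sum_i \sum_j x (bvec i *[A] bvec j) *: (bcovec i ⊗ bcovec j)))
    (linfun (fun x : 'Hom(V, k^o) => x (aone A))).

Definition dual_whopf V (H : whopf_data V) : whopf_data 'Hom(V, k^o) :=
  WHopfData (dual_alg H) (dual_coalg H)
    (linfun (fun x : 'Hom(V, k^o) => (x \o antipode H)%VF)).

Definition op_whopf V (H : whopf_data V) : whopf_data V :=
  WHopfData (Algebra (tlin (fun x y => y *[H] x)) (aone H)) H
    (antipode H)^-1%VF.

End WeakHopf.

Section Maps.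
Variable k : fieldType.

Definition delta (I : finType) (i : I) : {ffun I -> k^o} :=
  [ffun j => (j == i)%:R].

Definition map_alg (I : finType) : algebra {ffun I -> k^o} :=
  Algebra (tlin (fun f g : {ffun I -> k^o} => [ffun i => f i * g i]))
    [ffun => 1].

Variable T : finZmodType.

Definition map_whopf : whopf_data {ffun T -> k^o} :=
  WHopfData (map_alg T)
    (Coalgebra
       (linfun (fun f : {ffun T -> k^o} =>
          \sum_l \sum_m f (l + m) *: (delta l ⊗ delta m)))
       (linfun (fun f : {ffun T -> k^o} => f 0)))
    (linfun (fun f : {ffun T -> k^o} => [ffun l => f (- l)])).

Definition map2_coalg : coalgebra {ffun T * T -> k^o} :=
  Coalgebra
    (linfun (fun f : {ffun T * T -> k^o} =>
       \sum_l \sum_m ((l.2 == m.1)%:R * f (l.1, m.2)) *: (delta l ⊗ delta m)))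
    (linfun (fun f : {ffun T * T -> k^o} => \sum_l f (l, l))).

Definition munit (l m : T) : 'End({ffun T -> k^o}) :=
  linfun (fun f : {ffun T -> k^o} => f m *: delta l).

Definition mcoef (M : 'End({ffun T -> k^o})) (l m : T) : k^o := M (delta m) l.

Definition end_whopf : whopf_data 'End({ffun T -> k^o}) :=
  WHopfData
    (Algebra (tlin (fun M N : 'End({ffun T -> k^o}) => (M \o N)%VF)) \1%VF)
    (Coalgebra
       (linfun (fun M : 'End({ffun T -> k^o}) =>
          \sum_l \sum_m mcoef M l m *: (munit l m ⊗ munit l m)))
       (linfun (fun M : 'End({ffun T -> k^o}) => \sum_l \sum_m mcoef M l m)))
    (linfun (fun M : 'End({ffun T -> k^o}) =>
       \sum_l \sum_m mcoef M l m *: munit m l)).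

End Maps.

Section Dynamical.
Variables (k : fieldType) (T : finZmodType) (U : vectType k).
Variables (HU : whopf_data U) (iota : 'Hom({ffun T -> k^o}, U)).
Variable J : T -> tens U U.

Definition hopf_embedding : Prop :=
  injective iota /\ is_morphism (map_whopf k T) HU iota.

Definition minid (m : T) : U := iota (delta k m).

Record dynamical_twist : Prop := DynamicalTwist
  { twist_inv : forall l, invertible (tens_alg HU HU) (J l);
    twist_weight : forall l (a : {ffun T -> k^o}),
      J l *[tens_alg HU HU] comul HU (iota a) =
      comul HU (iota a) *[tens_alg HU HU] J l;
    twist_cocycle : forall l,
      tmap (comul HU) id (J l) *[tens_alg (tens_alg HU HU) HU]
        (\sum_m J (l + m) ⊗ minid m) =
      tassoc U U U (tmap id (comul HU) (J l)) *[tens_alg (tens_alg HU HU) HU]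
        tassoc U U U (aone HU ⊗ J l);
    twist_counitl : forall l, \tsum_(a, b <- J l) (counit HU a *: b) = aone HU;
    twist_counitr : forall l, \tsum_(a, b <- J l) (counit HU b *: a) = aone HU }.

Definition Jinv (l : T) : tens U U := ainv (tens_alg HU HU) (J l).

Definition Hsp : vectType k := tens 'End({ffun T -> k^o}) U.
Definition H0 : whopf_data Hsp := tens_whopf (end_whopf k T) HU.

Definition FJ : tens Hsp Hsp :=
  \sum_l \sum_m \tsum_(a, b <- J l)
    ((munit k l (l + m) ⊗ a : Hsp)
       ⊗ (munit k l l ⊗ (b *[HU] minid m) : Hsp)).

Definition FbarJ : tens Hsp Hsp :=
  \sum_l \sum_m \tsum_(a, b <- Jinv l)
    ((munit k (l + m) l ⊗ a : Hsp)
       ⊗ (munit k l l ⊗ (minid m *[HU] b) : Hsp)).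

Definition vJ : Hsp := \tsum_(a, b <- FJ) (antipode H0 a *[H0] b).

Definition HJ : whopf_data Hsp :=
  WHopfData H0
    (Coalgebra
       (linfun (fun h : Hsp =>
          FbarJ *[tens_alg H0 H0] comul H0 h *[tens_alg H0 H0] FJ))
       (counit H0))
    (linfun (fun h : Hsp => ainv H0 vJ *[H0] antipode H0 h *[H0] vJ)).

Definition Dsp : vectType k := tens {ffun T * T -> k^o} 'Hom(U, k^o).

Definition pairing (d : Dsp) (h : Hsp) : k^o :=
  \tsum_(f, x <- d) \tsum_(M, u <- h)
    ((\sum_l f l * mcoef M l.1 l.2) * x u : k^o).

Definition pairing_map : 'Hom(Dsp, 'Hom(Hsp, k^o)) :=
  linfun (fun d : Dsp => linfun (fun h : Hsp => pairing d h)).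

Definition of_fun (f : {ffun T * T -> k^o}) : Dsp := f ⊗ counit HU.
Definition of_dual (x : 'Hom(U, k^o)) : Dsp :=
  ([ffun => 1] : {ffun T * T -> k^o}) ⊗ x.

Definition bidegree (a1 a2 : T) (x : 'Hom(U, k^o)) : Prop :=
  forall u, x u = x (minid a1 *[HU] u *[HU] minid a2).

Definition KbarJ (l : T) : U := \tsum_(a, b <- Jinv l) (a *[HU] antipode HU b).

Definition KJ (l : T) : U :=
  \sum_m (\tsum_(a, b <- J (l - m)) (antipode HU a *[HU] b)) *[HU] minid m.

(* The relations that prescribe the operations of D_J; associativity is what
   makes the listed products determine the whole multiplication, and the
   antipode S is prescribed through S^-1, with
     <S^-1(x), E_(n1,n2) u> = <x, KbarJ(n2) S_U(u) KJ(n1)>.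
   With S and S_U^-1 in place of S^-1 and S_U this formula does not define an
   antipode unless extra conditions on S_U^2 and J hold. *)
Record is_DJ (D : whopf_data Dsp) : Prop := IsDJ
  { DJ_coalg : wcoalg D = tens_coalg (map2_coalg k T) (dual_coalg HU);
    DJ_mulA : forall a b c : Dsp, a *[D] (b *[D] c) = (a *[D] b) *[D] c;
    DJ_mul_fun : forall f g : {ffun T * T -> k^o},
      of_fun f *[D] of_fun g = of_fun [ffun l => f l * g l];
    DJ_mul_fun_dual : forall f x, of_fun f *[D] of_dual x = f ⊗ x;
    DJ_mul_dual_fun : forall a1 a2 x (f : {ffun T * T -> k^o}), bidegree a1 a2 x ->
      of_dual x *[D] of_fun f =
      of_fun [ffun l => f (l.1 + a1, l.2 + a2)] *[D] of_dual x;
    DJ_mul_dual : forall (x y : 'Hom(U, k^o)) n1 n2 u,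
      pairing (of_dual x *[D] of_dual y) (munit k n1 n2 ⊗ u) =
      \tsum_(a, b <- Jinv n1 *[tens_alg HU HU] comul HU u *[tens_alg HU HU] J n2)
        (y a * x b : k^o);
    DJ_one : aone D = ([ffun => 1] : {ffun T * T -> k^o}) ⊗ counit HU;
    DJ_antipode_bij : bijective (antipode D);
    DJ_antipodeM : forall a b : Dsp,
      antipode D (a *[D] b) = antipode D b *[D] antipode D a;
    DJ_antipode_fun : forall f : {ffun T * T -> k^o},
      antipode D (of_fun f) = of_fun [ffun l => f (l.2, l.1)];
    DJ_antipode_dual : forall (x : 'Hom(U, k^o)) n1 n2 u,
      pairing ((antipode D)^-1%VF (of_dual x)) (munit k n1 n2 ⊗ u) =
      x (KbarJ n2 *[HU] antipode HU u *[HU] KJ n1) }.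

End Dynamical.

(* Main.v *)
Require Import Defs.
From HB Require Import structures.
From mathcomp Require Import all_boot all_algebra ring.

Set Implicit Arguments.
Unset Strict Implicit.
Unset Printing Implicit Defensive.

Import GRing.Theory VectorInternalTheory.
Local Open Scope ring_scope.

(** The theorem is true because the relations that prescribe D_J are the
    transposes of closed formulas for the operations of H_J on matrix units, and
    because these formulas make H_J a weak Hopf algebra with bijective antipode.

    The space H is spanned by the E_(n1,n2) u. There the twisted coproduct is
      Δ_J(E_(n1,n2) u) = sum over m, m' of
          E_(n1+m,n2+m') a ⊗ E_(n1,n2) P_m b P_m',
    where a ⊗ b = J(n1)^-1 Δ(u) J(n2) is [dcomul n1 n2 u]. Each weak bialgebra
    axiom of H_J becomes a property of the family [dcomul]: the maps compose like
    matrix units ([dcomulM], [dcomul1]), the counit conditions on J make them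
    counital, and the dynamical cocycle equation is exactly their coassociativity
    with shifted arguments ([dcomul_coassoc]); zero weight keeps track of the
    shifts.

    The antipode of H_J is conjugation of S by v = m(S ⊗ id)F. Writing κ(l) for
    m(S ⊗ id)J(l) and Kbar(l) for m(id ⊗ S)J(l)^-1, the map x ⊗ y ⊗ z |-> x S(y) z
    applied to the cocycle equation gives Kbar(l + m) κ(l) P_m = P_m
    ([Kbar_mulSJ]). This identity inverts v, and it turns both antipode axioms
    into telescoping sums ([HJ_target], [HJ_source]).

    The antipode of the opposite dual is adjoint to the inverse of the antipode of
    H_J, so the antipode of U has to be bijective. This is the theorem of Larson
    and Sweedler, obtained here from integrals in the dual of U
    ([hopf_antipode_inj]).

    A nondegenerate pairing carries the structure of H_J over to its opposite dual
    ([skew_dual_weak_hopf]), which gives a weak Hopf structure [dualJ] on the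
    space of D_J. Evaluating it on matrix units yields the relations of D_J
    ([dualJ_is_DJ]); that its antipode reverses products is a general fact about
    weak Hopf algebras ([antipodeM]). Conversely the relations determine all
    operations ([DJ_uniq]), because every element is a sum of products f x with f
    a function and x in the dual of U. Hence every D_J is [dualJ]. *)

(** * Linear maps and Sweedler sums *)

(** Unbundled, so that linearity of an explicit Sweedler sum in one of its
    variables is a goal that [lin_tac] solves by following the term. *)
Definition lin (k : fieldType) (V W : lmodType k) (f : V -> W) : Prop :=
  forall a x y, f (a *: x + y) = a *: f x + f y.

Definition bilin (k : fieldType) (V W X : lmodType k) (f : V -> W -> X) : Prop :=
  (forall w, lin (fun v => f v w)) /\ (forall v, lin (fun w => f v w)).

Section Lin.
Variable k : fieldType.
Implicit Types V W X Y : lmodType k.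

Section LinTheory.
Variables (V W : lmodType k) (f : V -> W).
Hypothesis f_lin : lin f.

Lemma lin0 : f 0 = 0.
Proof. by have := f_lin (-1) 0 0; rewrite scaler0 addr0 scaleN1r addNr. Qed.

Lemma linZ a x : f (a *: x) = a *: f x.
Proof. by have := f_lin a x 0; rewrite !addr0 lin0 addr0. Qed.

Lemma linD x y : f (x + y) = f x + f y.
Proof. by have := f_lin 1 x y; rewrite !scale1r. Qed.

Lemma lin_bigsum I (r : seq I) (P : pred I) (F : I -> V) :
  f (\sum_(i <- r | P i) F i) = \sum_(i <- r | P i) f (F i).
Proof. exact: (big_morph f linD lin0). Qed.
End LinTheory.

Lemma lin_id V : lin (fun x : V => x). Proof. by []. Qed.

Lemma lin_comp V W X (g : W -> X) (f : V -> W) :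
  lin g -> lin f -> lin (fun x => g (f x)).
Proof. by move=> gl fl a x y; rewrite fl gl. Qed.

Lemma lin_scaler V W (f : V -> W) c : lin f -> lin (fun x => c *: f x).
Proof. by move=> fl a x y; rewrite fl scalerDr !scalerA mulrC. Qed.

Lemma lin_scalel V W (f : V -> k^o) (w : W) :
  lin f -> lin (fun x => (f x : k) *: w).
Proof. by move=> fl a x y; rewrite fl scalerDl -scalerA. Qed.

Lemma lin_mull V (f : V -> k^o) (c : k) :
  lin f -> lin (fun x => (f x : k) * c : k^o).
Proof. by move=> fl a x y; rewrite fl /= mulrDl -mulrA. Qed.

Lemma lin_mulr V (f : V -> k^o) (c : k) :
  lin f -> lin (fun x => c * (f x : k) : k^o).
Proof. by move=> fl a x y; rewrite fl /= mulrDr /GRing.scale /= mulrCA. Qed.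

Lemma lin_sum V W I (r : seq I) (P : pred I) (F : I -> V -> W) :
  (forall i, lin (F i)) -> lin (fun x => \sum_(i <- r | P i) F i x).
Proof.
move=> Fl a x y; rewrite scaler_sumr -big_split /=.
by apply: eq_bigr => i _; rewrite Fl.
Qed.

End Lin.

Section LinVect.
Variable k : fieldType.
Implicit Types V W X Y : vectType k.

(** All structure maps are defined by [linfun], which has the expected values
    only on maps that are linear. *)
Lemma linfunE V W (f : V -> W) x : lin f -> linfun f x = f x.
Proof.
move=> fl.
pose L : {linear V -> W} := HB.pack f (GRing.isLinear.Build k V W _ f fl).
exact: (lfunE L x).
Qed.

Lemma lin_lfun (V0 : lmodType k) V W (g : 'Hom(V, W)) (f : V0 -> V) :
  lin f -> lin (fun x => g (f x)).
Proof. by move=> fl a x y; rewrite fl linearP. Qed.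

Lemma lin_lfunl (V0 : lmodType k) V W (v : V) (f : V0 -> 'Hom(V, W)) :
  lin f -> lin (fun x => f x v).
Proof. by move=> fl a x y; rewrite fl lfunE /= lfunE. Qed.

Lemma bvecE V (v : V) : v = \sum_i v2r v 0 i *: bvec i.
Proof.
by rewrite -[LHS]v2rK {1}(row_sum_delta (v2r v)) linear_sum; apply: eq_bigr => i _;
  rewrite linearZ.
Qed.

Lemma bcovecE V (i : 'I_(dim V)) v : bcovec i v = v2r v 0 i.
Proof. by rewrite linfunE // => a x y; rewrite linearP !mxE. Qed.

Lemma sum_bcovec V (v : V) : v = \sum_i bcovec i v *: bvec i.
Proof. by rewrite {1}[v]bvecE; apply: eq_bigr => i _; rewrite bcovecE. Qed.

Lemma sum_bvec V W (f : 'Hom(V, W)) v : f v = \sum_i bcovec i v *: f (bvec i).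
Proof.
by rewrite {1}[v]sum_bcovec linear_sum; apply: eq_bigr => i _; rewrite linearZ.
Qed.

Lemma tensvE V W (v : V) (w : W) i j :
  (v ⊗ w : 'M_(_, _)) i j = v2r v 0 i * v2r w 0 j.
Proof. by rewrite mxE big_ord1 mxE. Qed.

Lemma tens_coordE V W (t : tens V W) :
  t = \sum_i \sum_j (t : 'M[k]_(dim V, dim W)) i j *: (bvec i ⊗ bvec j).
Proof.
apply/matrixP => a b; rewrite summxE (bigD1 a) //= summxE (bigD1 b) //= !mxE.
rewrite big_ord1 !mxE !r2vK !mxE !eqxx mulr1 mulr1 big1 ?addr0; last first.
  by move=> j /negbTE jb; rewrite mxE tensvE !r2vK !mxE (eq_sym b) jb !andbF mulr0 mulr0.
rewrite big1 ?addr0 // => i /negbTE ia; rewrite summxE big1 // => j _.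
by rewrite mxE tensvE !r2vK !mxE (eq_sym a) ia !andbF mul0r mulr0.
Qed.

Lemma lin_tensl (V0 : lmodType k) V W (f : V0 -> V) (w : W) :
  lin f -> lin (fun x => f x ⊗ w).
Proof.
move=> fl a x y; apply/matrixP=> i j.
by rewrite fl !(tensvE, mxE) linearP !mxE mulrDl mulrA.
Qed.

Lemma lin_tensr (V0 : lmodType k) V W (f : V0 -> W) (v : V) :
  lin f -> lin (fun x => v ⊗ f x).
Proof.
move=> fl a x y; apply/matrixP=> i j.
by rewrite fl !(tensvE, mxE) linearP !mxE mulrDr mulrCA.
Qed.

Lemma lin_tsum (V0 : lmodType k) V W (X : lmodType k) (g : V0 -> tens V W) (f : V -> W -> X) :
  lin g -> lin (fun x => tsum (g x) f).
Proof.
move=> gl a x y; rewrite /tsum scaler_sumr -big_split; apply: eq_bigr => i _ /=.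
rewrite scaler_sumr -big_split; apply: eq_bigr => j _ /=.
by rewrite gl !mxE scalerDl scalerA.
Qed.

Lemma lin_tsumr (V0 : lmodType k) V W (X : lmodType k) (t : tens V W) (f : V0 -> V -> W -> X) :
  (forall v w, lin (fun x => f x v w)) -> lin (fun x => tsum t (f x)).
Proof.
move=> gl; rewrite /tsum; apply: lin_sum => i; apply: lin_sum => j.
exact/lin_scaler/gl.
Qed.

(** This is where bilinearity makes a Sweedler sum independent of the bases. *)
Lemma tsum_pure V W (X : lmodType k) (f : V -> W -> X) v w :
  bilin f -> tsum (v ⊗ w) f = f v w.
Proof.
move=> [fl fr]; rewrite [in RHS](sum_bcovec v) (lin_bigsum (fl w)).
apply: eq_bigr => i _; rewrite (linZ (fl w)) [w in RHS]sum_bcovec.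
rewrite (lin_bigsum (fr _)) scaler_sumr; apply: eq_bigr => j _.
by rewrite (linZ (fr _)) scalerA tensvE !bcovecE.
Qed.

Lemma tsum_tens V W (t : tens V W) : tsum t (fun v w => v ⊗ w) = t.
Proof. by rewrite [RHS]tens_coordE. Qed.

Lemma eq_tsum V W (X : lmodType k) (t : tens V W) (f g : V -> W -> X) :
  (forall v w, f v w = g v w) -> tsum t f = tsum t g.
Proof.
by move=> fg; apply: eq_bigr => i _; apply: eq_bigr => j _; rewrite fg.
Qed.

Lemma tsum_lin V W (X Y : lmodType k) (t : tens V W) (f : V -> W -> X) (g : X -> Y) :
  lin g -> g (tsum t f) = tsum t (fun v w => g (f v w)).
Proof.
move=> gl; rewrite /tsum (lin_bigsum gl); apply: eq_bigr => i _.
by rewrite (lin_bigsum gl); apply: eq_bigr => j _; rewrite (linZ gl).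
Qed.

Lemma tsum_sum V W (X : lmodType k) (t : tens V W) I (r : seq I) (P : pred I)
    (F : I -> V -> W -> X) :
  tsum t (fun a b => \sum_(i <- r | P i) F i a b) = \sum_(i <- r | P i) tsum t (F i).
Proof.
rewrite /tsum [RHS]exchange_big; apply: eq_bigr => i _ /=.
by rewrite [RHS]exchange_big; apply: eq_bigr => j _ /=; rewrite scaler_sumr.
Qed.

Lemma tsumZ V W (X : lmodType k) (t : tens V W) c (F : V -> W -> X) :
  tsum t (fun a b => c *: F a b) = c *: tsum t F.
Proof.
rewrite -(tsum_lin t F (g := fun x => c *: x)) //.
by apply: lin_scaler; apply: lin_id.
Qed.

Lemma tsum_exch V W V' W' (X : lmodType k) (t : tens V W) (t' : tens V' W')
    (f : V -> W -> V' -> W' -> X) :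
  tsum t (fun a b => tsum t' (f a b)) =
  tsum t' (fun c d => tsum t (fun a b => f a b c d)).
Proof.
rewrite {2}/tsum tsum_sum; apply: eq_bigr => i _.
by rewrite tsum_sum; apply: eq_bigr => j _; rewrite tsumZ.
Qed.

End LinVect.

Definition trilin (k : fieldType) (V W X Y : lmodType k) (f : V -> W -> X -> Y) : Prop :=
  (forall x, bilin (fun v w => f v w x)) /\ (forall v w, lin (f v w)).

Section MulLin.
Variables (k : fieldType) (X : lmodType k).
Implicit Types V W Y Z : vectType k.

Lemma lin_mulal V (A : algebra V) (f : X -> V) c :
  lin f -> lin (fun x => f x *[A] c).
Proof. by move=> fl; apply: lin_lfun; apply: lin_tensl. Qed.

Lemma lin_mular V (A : algebra V) (f : X -> V) c :
  lin f -> lin (fun x => c *[A] f x).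
Proof. by move=> fl; apply: lin_lfun; apply: lin_tensr. Qed.

Lemma bilin_l (V W Y : lmodType k) (F : V -> W -> Y) (f : X -> V) w :
  bilin F -> lin f -> lin (fun x => F (f x) w).
Proof. by case=> Fl _ fl; apply: lin_comp (Fl w) fl. Qed.

Lemma bilin_r (V W Y : lmodType k) (F : V -> W -> Y) (f : X -> W) v :
  bilin F -> lin f -> lin (fun x => F v (f x)).
Proof. by case=> _ Fl fl; apply: lin_comp (Fl v) fl. Qed.

Lemma trilin_1 (V W Y Z : lmodType k) (F : V -> W -> Y -> Z) (f : X -> V) w y :
  trilin F -> lin f -> lin (fun x => F (f x) w y).
Proof. by case=> Fl _ fl; apply: lin_comp ((Fl y).1 w) fl. Qed.

Lemma trilin_2 (V W Y Z : lmodType k) (F : V -> W -> Y -> Z) (f : X -> W) v y :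
  trilin F -> lin f -> lin (fun x => F v (f x) y).
Proof. by case=> Fl _ fl; apply: lin_comp ((Fl y).2 v) fl. Qed.

Lemma trilin_3 (V W Y Z : lmodType k) (F : V -> W -> Y -> Z) (f : X -> Y) v w :
  trilin F -> lin f -> lin (fun x => F v w (f x)).
Proof. by case=> _ Fl fl; apply: lin_comp (Fl v w) fl. Qed.

End MulLin.

(** In a product or tensor only one factor may contain the variable; the first
    rule that leaves the other factor constant is the one that applies.
    Hypotheses [lin], [bilin] and [trilin] serve as rules too. *)
Ltac lin_step :=
  lazymatch goal with
  | |- trilin _ => split; intros
  | |- bilin _ => split; intros
  | |- lin (fun x => x) => exact (@lin_id _ _)
  | |- lin (@id _) => exact (@lin_id _ _)
  | |- lin (fun_of_lfun _) => apply: lin_lfun; exact (@lin_id _ _)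
  | |- lin (fun x => tensv _ _) => first [apply: lin_tensl; lin_tac | apply: lin_tensr; lin_tac]
  | |- lin (fun x => Defs.mul _ _ _) => first [apply: lin_mulal; lin_tac | apply: lin_mular;
    lin_tac]
  | |- lin (fun x => fun_of_lfun _ _) => first [apply: lin_lfun; lin_tac | apply: lin_lfunl;
    lin_tac]
  | |- lin (fun x => tsum _ _) => first [apply: lin_tsum; lin_tac | apply: lin_tsumr => ? ?;
    lin_tac]
  | |- lin (fun x => GRing.scale _ _) => first [apply: lin_scaler; lin_tac | apply: lin_scalel;
    lin_tac]
  | |- lin (fun x => GRing.mul _ _) => first [apply: lin_mull; lin_tac | apply: lin_mulr; lin_tac]
  | |- lin (fun x => _) => first
      [ match goal with
        | H : trilin ?G |- lin (fun x => ?G _ _ _) =>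
          first [ apply: (trilin_1 _ _ H); lin_tac | apply: (trilin_2 _ _ H); lin_tac
                | apply: (trilin_3 _ _ H); lin_tac ]
        | H : bilin ?G |- lin (fun x => ?G _ _) =>
          first [apply: (bilin_l _ H); lin_tac | apply: (bilin_r _ H); lin_tac]
        | H : lin ?G |- lin (fun x => ?G _) => apply: (lin_comp H); lin_tac
        | H : forall _ _, lin _ |- _ => apply: (lin_comp (H _ _)); lin_tac
        | H : forall _, lin _ |- _ => apply: (lin_comp (H _)); lin_tac
        end
      | apply: lin_sum => ?; lin_tac ]
  | |- lin ?G => first [assumption
       | match goal with H : bilin _ |- _ => exact: H.1 | H : bilin _ |- _ => exact: H.2 end
       | match goal with H : trilin _ |- _ => exact: H.2 end
       | lazymatch G with fun x => _ => fail | _ => change (lin (fun x => G x)) end]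
  end
with lin_tac := cbv beta; solve [repeat (lin_step; cbv beta)].

Section TensorMaps.
Variable k : fieldType.
Implicit Types V W X Y : vectType k.

(** The justification of Sweedler notation: in a linear identity a tensor may
    be replaced by a pure one. *)
Lemma tens_ext V W (X : lmodType k) (L R : tens V W -> X) :
  lin L -> lin R -> (forall v w, L (v ⊗ w) = R (v ⊗ w)) -> forall t, L t = R t.
Proof.
move=> Ll Rl LR t; rewrite -[t]tsum_tens (tsum_lin _ _ Ll) (tsum_lin _ _ Rl); exact: eq_tsum.
Qed.

Lemma tlinE V W X (f : V -> W -> X) t : tlin f t = tsum t f.
Proof. by rewrite linfunE //; lin_tac. Qed.

Lemma tlin_pure V W X (f : V -> W -> X) v w : bilin f -> tlin f (v ⊗ w) = f v w.
Proof. by move=> fl; rewrite tlinE tsum_pure. Qed.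

Lemma tmapE V W V' W' (f : V -> V') (g : W -> W') v w :
  lin f -> lin g -> tmap f g (v ⊗ w) = f v ⊗ g w.
Proof. by move=> fl gl; rewrite tlin_pure //; lin_tac. Qed.

Lemma tsum_tmap V W V' W' (X : lmodType k) (f : V -> V') (g : W -> W') t (F : V' -> W' -> X) :
  lin f -> lin g -> bilin F -> tsum (tmap f g t) F = tsum t (fun a b => F (f a) (g b)).
Proof.
move=> fl gl Fl; move: t; apply: tens_ext; [lin_tac|lin_tac|].
by move=> v w; rewrite tmapE // !tsum_pure //; lin_tac.
Qed.

Lemma tsum_tsum V W V' W' (X : lmodType k) (t : tens V W) (f : V -> W -> tens V' W') (F :
    V' -> W' -> X) :
  tsum (tsum t f) F = tsum t (fun a b => tsum (f a b) F).
Proof. by rewrite (tsum_lin t f (g := fun s => tsum s F)) //; lin_tac. Qed.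

Lemma lfun_tsum V W X Y (t : tens V W) (f : V -> W -> X) (g : 'Hom(X, Y)) :
  g (tsum t f) = tsum t (fun a b => g (f a b)).
Proof. by rewrite (tsum_lin t f (g := fun s => g s)) //; lin_tac. Qed.

Lemma tassocE V W X (v : V) (w : W) (x : X) :
  tassoc V W X (v ⊗ (w ⊗ x)) = v ⊗ w ⊗ x.
Proof. by rewrite tlin_pure ?tsum_pure //; lin_tac. Qed.

Lemma tsum_tassoc V W X (Y : lmodType k) t (F : tens V W -> X -> Y) :
  bilin F ->
  tsum (tassoc V W X t) F = tsum t (fun a s => tsum s (fun b c => F (a ⊗ b) c)).
Proof.
move=> Fl; move: t; apply: tens_ext; [lin_tac|lin_tac|] => v s.
rewrite tsum_pure; last by lin_tac.
move: s; apply: tens_ext; [lin_tac|lin_tac|] => w x.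
by rewrite tassocE !tsum_pure //; lin_tac.
Qed.

Lemma mul_tens V W (A : algebra V) (B : algebra W) a b c d :
  (a ⊗ b) *[tens_alg A B] (c ⊗ d) = (a *[A] c) ⊗ (b *[B] d).
Proof. by rewrite /Defs.mul /= tlin_pure ?tsum_pure //; lin_tac. Qed.

Lemma tsum_mul V W (A : algebra V) (B : algebra W) (X : lmodType k) s t (F : V -> W -> X) :
  bilin F ->
  tsum (s *[tens_alg A B] t) F =
  tsum s (fun a b => tsum t (fun c d => F (a *[A] c) (b *[B] d))).
Proof.
move=> Fl; move: s; apply: tens_ext; [lin_tac|lin_tac|] => a b.
rewrite tsum_pure; last by lin_tac.
move: t; apply: tens_ext; [lin_tac|lin_tac|] => c d.
by rewrite mul_tens !tsum_pure //; lin_tac.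
Qed.

Lemma tens_is_algebra V W (A : algebra V) (B : algebra W) :
  is_algebra A -> is_algebra B -> is_algebra (tens_alg A B).
Proof.
move=> hA hB; split.
- move=> x y z; move: x; apply: tens_ext; [lin_tac|lin_tac|] => a a'.
  move: y; apply: tens_ext; [lin_tac|lin_tac|] => b b'.
  move: z; apply: tens_ext; [lin_tac|lin_tac|] => c c'.
  by rewrite !mul_tens !amulA.
- apply: tens_ext; [lin_tac|lin_tac|] => a b.
  by rewrite mul_tens !amul1l.
- apply: tens_ext; [lin_tac|lin_tac|] => a b.
  by rewrite mul_tens !amul1r.
Qed.

End TensorMaps.

Section Sweedler.
Variables (k : fieldType) (V : vectType k) (C : coalgebra V).
Hypothesis hC : is_coalgebra C.

Lemma sw_coassoc (X : lmodType k) x (F : V -> V -> V -> X) : trilin F ->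
  \tsum_(a, b <- comul C x) \tsum_(c, d <- comul C a) F c d b =
  \tsum_(a, b <- comul C x) \tsum_(c, d <- comul C b) F a c d.
Proof.
move=> Fl.
pose G (s : tens V V) c := \tsum_(a, b <- s) F a b c.
have Gl : bilin G by rewrite /G; lin_tac.
transitivity (tsum (tmap (comul C) id (comul C x)) G).
  by rewrite tsum_tmap //; lin_tac.
rewrite comulA // tsum_tassoc // tsum_tmap; try lin_tac.
apply: eq_tsum => a b; apply: eq_tsum => c d.
by rewrite /G tsum_pure //; lin_tac.
Qed.

Lemma sw_counitl (X : lmodType k) x (f : V -> X) : lin f ->
  \tsum_(a, b <- comul C x) (counit C a *: f b) = f x.
Proof.
move=> fl; rewrite -[in RHS](counitl hC x) (tsum_lin _ _ fl).
by apply: eq_tsum => a b; rewrite (linZ fl).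
Qed.

Lemma sw_counitr (X : lmodType k) x (f : V -> X) : lin f ->
  \tsum_(a, b <- comul C x) (counit C b *: f a) = f x.
Proof.
move=> fl; rewrite -[in RHS](counitr hC x) (tsum_lin _ _ fl).
by apply: eq_tsum => a b; rewrite (linZ fl).
Qed.

End Sweedler.

Lemma lfunZ (k : fieldType) (V W : vectType k) (g : 'Hom(V, W)) c v : g (c *: v) = c *: g v.
Proof. exact: linearZ. Qed.

Lemma lfun_sum (k : fieldType) (V W : vectType k) (g : 'Hom(V, W)) I (r : seq I) (Q :
    pred I) (F : I -> V) :
  g (\sum_(i <- r | Q i) F i) = \sum_(i <- r | Q i) g (F i).
Proof. exact: linear_sum. Qed.

Lemma tensZl (k : fieldType) (V W : vectType k) (v : V) (w : W) c : (c *: v) ⊗ w = c *: (v ⊗ w).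
Proof. by rewrite (linZ (f := fun s => s ⊗ w)) //; lin_tac. Qed.

Lemma tensZr (k : fieldType) (V W : vectType k) (v : V) (w : W) c : v ⊗ (c *: w) = c *: (v ⊗ w).
Proof. by rewrite (linZ (f := fun s => v ⊗ s)) //; lin_tac. Qed.

Lemma tens_suml (k : fieldType) (V W : vectType k) I (r : seq I) (Q : pred I) (F : I -> V) (w :
    W) :
  (\sum_(i <- r | Q i) F i) ⊗ w = \sum_(i <- r | Q i) F i ⊗ w.
Proof. by rewrite (lin_bigsum (f := fun s => s ⊗ w)) //; lin_tac. Qed.

Lemma tens_sumr (k : fieldType) (V W : vectType k) I (r : seq I) (Q : pred I) (F : I -> W) (w :
    V) :
  w ⊗ (\sum_(i <- r | Q i) F i) = \sum_(i <- r | Q i) w ⊗ F i.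
Proof. by rewrite (lin_bigsum (f := fun s => w ⊗ s)) //; lin_tac. Qed.

(** Converse of [sw_coassoc], used to establish coassociativity. *)
Lemma comulA_of_sw (k : fieldType) (V : vectType k) (C : coalgebra V) x :
  \tsum_(a, b <- comul C x) \tsum_(c, d <- comul C a) ((c ⊗ d) ⊗ b) =
  \tsum_(a, b <- comul C x) \tsum_(c, d <- comul C b) ((a ⊗ c) ⊗ d) ->
  tmap (comul C) id (comul C x) = tassoc V V V (tmap id (comul C) (comul C x)).
Proof.
move=> h; rewrite /tmap [LHS]tlinE [X in tassoc _ _ _ X]tlinE lfun_tsum; move: h; congr (_ = _);
  apply: eq_tsum => a b.
  rewrite -[in RHS](tsum_tens (comul C a)) (tsum_lin _ _ (g := fun s => s ⊗ b)) //; lin_tac.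
by rewrite tlin_pure //; lin_tac.
Qed.

Section MulLemmas.
Variable k : fieldType.
Lemma mul_suml (V : vectType k) (A : algebra V) I (r : seq I) (Q : pred I) (F : I -> V) x :
  (\sum_(i <- r | Q i) F i) *[A] x = \sum_(i <- r | Q i) F i *[A] x.
Proof. by rewrite (lin_bigsum (f := fun y => y *[A] x)) //; lin_tac. Qed.

Lemma mul_sumr (V : vectType k) (A : algebra V) I (r : seq I) (Q : pred I) (F : I -> V) x :
  x *[A] (\sum_(i <- r | Q i) F i) = \sum_(i <- r | Q i) x *[A] F i.
Proof. by rewrite (lin_bigsum (f := fun y => x *[A] y)) //; lin_tac. Qed.

Lemma mulZl (V : vectType k) (A : algebra V) c (x y : V) :
  (c *: x) *[A] y = c *: (x *[A] y).
Proof. by rewrite (linZ (f := fun x => x *[A] y)) //; lin_tac. Qed.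

Lemma mulZr (V : vectType k) (A : algebra V) c (x y : V) :
  x *[A] (c *: y) = c *: (x *[A] y).
Proof. by rewrite (linZ (f := fun x => _ *[A] x)) //; lin_tac. Qed.

End MulLemmas.

(** * Weak bialgebras and weak Hopf algebras *)

Section WeakBialgebra.
Variables (k : fieldType) (V : vectType k) (H : whopf_data V).
Hypothesis hH : weak_bialgebra H.

Local Notation "x ** y" := (Defs.mul (walg H) x y) (at level 40, left associativity).
Local Notation Δ := (comul (wcoalg H)).
Local Notation ε := (counit (wcoalg H)).
Local Notation e := (aone (walg H)).

Let mA := amulA (wb_alg hH).
Let m1l := amul1l (wb_alg hH).
Let m1r := amul1r (wb_alg hH).

Lemma sw_mul (X : lmodType k) x y (F : V -> V -> X) : bilin F ->
  \tsum_(a, b <- Δ (x ** y)) F a b =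
  \tsum_(a, b <- Δ x) \tsum_(c, d <- Δ y) F (a ** c) (b ** d).
Proof. by move=> Fl; rewrite wb_comulM // tsum_mul. Qed.

Lemma sw_onel (X : lmodType k) x (F : V -> V -> X) : bilin F ->
  \tsum_(a, b <- Δ e) \tsum_(c, d <- Δ x) F (a ** c) (b ** d) =
  \tsum_(a, b <- Δ x) F a b.
Proof. by move=> Fl; rewrite -sw_mul // m1l. Qed.

Lemma sw_oner (X : lmodType k) x (F : V -> V -> X) : bilin F ->
  \tsum_(a, b <- Δ x) \tsum_(c, d <- Δ e) F (a ** c) (b ** d) =
  \tsum_(a, b <- Δ x) F a b.
Proof. by move=> Fl; rewrite -sw_mul // m1r. Qed.

Lemma sw_comul1 (X : lmodType k) (F : V -> V -> V -> X) : trilin F ->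
  \tsum_(a, b <- Δ e) \tsum_(c, d <- Δ a) F c d b =
  tsum (tmap Δ id (Δ e)) (fun s c => \tsum_(a, b <- s) F a b c).
Proof. by move=> Fl; rewrite tsum_tmap //; lin_tac. Qed.

(** The weak unit axiom in Sweedler form; together with [sw_comul1r] it says
    that the two legs of the coproducts of 1 that meet in the middle commute. *)
Lemma sw_comul1l (X : lmodType k) (F : V -> V -> V -> X) : trilin F ->
  \tsum_(a, b <- Δ e) \tsum_(c, d <- Δ a) F c d b =
  \tsum_(a, b <- Δ e) \tsum_(c, d <- Δ e) F a (b ** c) d.
Proof.
move=> Fl; rewrite sw_comul1 // wb_comul1l // tsum_mul; last by lin_tac.
rewrite tsum_pure; last by lin_tac.
rewrite tsum_tassoc; last by lin_tac.
rewrite tsum_pure; last by lin_tac.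
rewrite [RHS]tsum_exch; apply: eq_tsum => a b.
rewrite tsum_mul; last by lin_tac.
apply: eq_tsum => c d; rewrite tsum_pure; last by lin_tac.
by rewrite m1r m1l.
Qed.

Lemma sw_comul1r (X : lmodType k) (F : V -> V -> V -> X) : trilin F ->
  \tsum_(a, b <- Δ e) \tsum_(c, d <- Δ a) F c d b =
  \tsum_(a, b <- Δ e) \tsum_(c, d <- Δ e) F a (c ** b) d.
Proof.
move=> Fl; rewrite sw_comul1 // wb_comul1r // tsum_mul; last by lin_tac.
rewrite tsum_tassoc; last by lin_tac.
rewrite tsum_pure; last by lin_tac.
rewrite [RHS]tsum_exch; apply: eq_tsum => a b.
rewrite tsum_pure; last by lin_tac.
rewrite tsum_mul; last by lin_tac.
rewrite tsum_pure; last by lin_tac.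
by apply: eq_tsum => c d; rewrite m1r m1l.
Qed.

(** The target and source counital maps. In a Hopf algebra both are x |-> ε(x) 1;
    in general [target] takes the value x_1 S(x_2) and [source] the value
    S(x_1) x_2, see [targetE] and [sourceE]. *)
Definition target (x : V) : V := \tsum_(a, b <- Δ e) (ε (a ** x) *: b).
Definition source (x : V) : V := \tsum_(a, b <- Δ e) (ε (x ** b) *: a).

Lemma target_lin : lin target. Proof. rewrite /target; lin_tac. Qed.
Lemma source_lin : lin source. Proof. rewrite /source; lin_tac. Qed.
Let tl := target_lin.
Let sl := source_lin.

Lemma counit_target x y : ε (x ** target y) = ε (x ** y).
Proof.
rewrite -[x in RHS]m1r wb_counitMr // /target.
rewrite (tsum_lin _ _ (g := fun s => ε (x ** s))); last by lin_tac.
by apply: eq_tsum => a b; rewrite (linZ (f := fun s => ε (x ** s))) 1?mulrC //; lin_tac.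
Qed.

Lemma counit_source x y : ε (source x ** y) = ε (x ** y).
Proof.
rewrite -[x in RHS]m1r wb_counitMr // /source.
rewrite (tsum_lin _ _ (g := fun s => ε (s ** y))); last by lin_tac.
by apply: eq_tsum => a b; rewrite (linZ (f := fun s => ε (s ** y))) //; lin_tac.
Qed.

Lemma target_mul x y : target (x ** y) = target (x ** target y).
Proof. by apply: eq_tsum => a b; rewrite !mA counit_target. Qed.

Lemma source_mul x y : source (x ** y) = source (source x ** y).
Proof. by apply: eq_tsum => a b; rewrite -!mA counit_source. Qed.

(** Both products arise from 1_1 ⊗ 1_2 1'_1 ⊗ 1'_2 by contracting the outer
    legs, and the middle factors may be exchanged. *)
Lemma target_source_comm x y : target x ** source y = source y ** target x.
Proof.
rewrite /target /source.
pose F (a b c : V) : V := ε (a ** x) *: (ε (y ** c) *: b).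
have Fl : trilin F by rewrite /F; lin_tac.
transitivity (\tsum_(a, b <- Δ e) \tsum_(c, d <- Δ e) F a (b ** c) d).
  rewrite (tsum_lin _ _ (g := fun s => s ** _)); last by lin_tac.
  apply: eq_tsum => a b; rewrite (tsum_lin _ _ (g := fun s => _ ** s)); last by lin_tac.
  apply: eq_tsum => c d.
  rewrite (linZ (f := fun s => s ** _)); last by lin_tac.
  by rewrite (linZ (f := fun s => b ** s)) //; lin_tac.
rewrite -sw_comul1l // sw_comul1r //.
rewrite (tsum_lin _ _ (g := fun s => _ ** s)); last by lin_tac.
apply: eq_tsum => a b.
rewrite (linZ (f := fun s => _ ** s)); last by lin_tac.
rewrite (tsum_lin _ _ (g := fun s => s ** _)); last by lin_tac.
rewrite -tsumZ.
apply: eq_tsum => c d.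
by rewrite (linZ (f := fun s => s ** _)) //; lin_tac.
Qed.

Lemma sw_target (X : lmodType k) y (F : V -> V -> X) : bilin F ->
  \tsum_(a, b <- Δ (target y)) F a b = \tsum_(a, b <- Δ e) F (a ** target y) b.
Proof.
move=> Fl; pose G (a c d : V) : X := ε (a ** y) *: F c d.
have Gl : trilin G by rewrite /G; lin_tac.
rewrite {1}/target (tsum_lin _ _ (g := fun s => tsum (Δ s) F)); last by lin_tac.
transitivity (\tsum_(a, b <- Δ e) \tsum_(c, d <- Δ b) G a c d).
  apply: eq_tsum => a b; rewrite (linZ (f := fun s => tsum (Δ s) F)) ?tsumZ //.
  by lin_tac.
rewrite -(sw_coassoc (wb_coalg hH) e Gl) (sw_comul1r Gl) tsum_exch; apply: eq_tsum => a b.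
rewrite /target (tsum_lin _ _ (g := fun s => F (a ** s) _)); last by lin_tac.
apply: eq_tsum => c d.
by rewrite (linZ (f := fun s => F (a ** s) _)) //; lin_tac.
Qed.

Lemma sw_source (X : lmodType k) x (F : V -> V -> X) : bilin F ->
  \tsum_(a, b <- Δ (source x)) F a b = \tsum_(a, b <- Δ e) F a (source x ** b).
Proof.
move=> Fl; pose G (c d b : V) : X := ε (x ** b) *: F c d.
have Gl : trilin G by rewrite /G; lin_tac.
rewrite {1}/source (tsum_lin _ _ (g := fun s => tsum (Δ s) F)); last by lin_tac.
transitivity (\tsum_(a, b <- Δ e) \tsum_(c, d <- Δ a) G c d b).
  apply: eq_tsum => a b; rewrite (linZ (f := fun s => tsum (Δ s) F)) ?tsumZ //.
  by lin_tac.
rewrite (sw_comul1r Gl); apply: eq_tsum => a b.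
rewrite /source (tsum_lin _ _ (g := fun s => F _ (s ** b))); last by lin_tac.
apply: eq_tsum => c d.
by rewrite (linZ (f := fun s => F _ (s ** b))) //; lin_tac.
Qed.

End WeakBialgebra.

Section WeakHopf.
Variables (k : fieldType) (V : vectType k) (H : whopf_data V).
Hypothesis hW : weak_hopf H.
Let hH := wh_wb hW.

Local Notation "x ** y" := (Defs.mul (walg H) x y) (at level 40, left associativity).
Local Notation Δ := (comul (wcoalg H)).
Local Notation S := (antipode H).

Let mA := amulA (wb_alg hH).
Let m1l := amul1l (wb_alg hH).
Let m1r := amul1r (wb_alg hH).
Let tl := target_lin H.
Let sl := source_lin H.

Lemma targetE x : \tsum_(a, b <- Δ x) (a ** S b) = target H x.
Proof.
rewrite wh_antipoder // tsum_mul; last by lin_tac.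
apply: eq_tsum => a b; rewrite tsum_pure ?m1r //; last by lin_tac.
Qed.

Lemma sourceE x : \tsum_(a, b <- Δ x) (S a ** b) = source H x.
Proof.
rewrite wh_antipodel // tsum_mul ?tsum_pure; try lin_tac.
by apply: eq_tsum => a b; rewrite m1l.
Qed.

Lemma antipode_source x : S x = \tsum_(a, b <- Δ x) (source H a ** S b).
Proof.
rewrite -wh_antipode //; apply: eq_tsum => a b.
rewrite -sourceE (tsum_lin _ _ (g := fun s => s ** S b)) //; lin_tac.
Qed.

Lemma antipode_target x : S x = \tsum_(a, b <- Δ x) (S a ** target H b).
Proof.
rewrite -wh_antipode // (sw_coassoc (wb_coalg hH) x (F := fun a b c => S a ** b ** S c));
  last by lin_tac.
apply: eq_tsum => a b.
rewrite -targetE (tsum_lin _ _ (g := fun s => S a ** s)); last by lin_tac.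
by apply: eq_tsum => c d; rewrite mA.
Qed.

(** The coproduct of a target element is 1_1 (target y) ⊗ 1_2, and 1_1, 1_2 are
    absorbed by the coproduct of x. *)
Lemma target_mulE x y :
  target H (x ** y) = \tsum_(a, b <- Δ x) (a ** target H y ** S b).
Proof.
rewrite target_mul // -targetE sw_mul //; last by lin_tac.
rewrite -(sw_oner hH x (F := fun a b => a ** target H y ** S b)); last by lin_tac.
apply: eq_tsum => a b; rewrite (sw_target hH y (F := fun c d => a ** c ** S (b ** d)));
  last by lin_tac.
by apply: eq_tsum => c d; rewrite -!mA.
Qed.

Lemma source_mulE x y :
  source H (x ** y) = \tsum_(a, b <- Δ y) (S a ** source H x ** b).
Proof.
rewrite source_mul // -sourceE sw_mul //; last by lin_tac.
rewrite -(sw_onel hH y (F := fun a b => S a ** source H x ** b)); last by lin_tac.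
rewrite (sw_source hH x (F := fun a b => \tsum_(c, d <- Δ y) (S (a ** c) ** (b ** d))));
  last by lin_tac.
by apply: eq_tsum => a b; apply: eq_tsum => c d; rewrite -!mA.
Qed.

(** The proof of Böhm, Nill and Szlachányi: S(xy) is S(x_1 y_1) target(x_2 y_2);
    expanding the target by [target_mulE] and then the source that appears by
    [source_mulE] leaves S(y_1) source(x_1) target(y_2) S(x_2), where source and
    target commute. *)
Lemma antipodeM x y : S (x ** y) = S y ** S x.
Proof.
transitivity (\tsum_(a, b <- Δ x) \tsum_(c, d <- Δ y) (source H (a ** c) ** (S d ** S b))).
  rewrite antipode_target sw_mul //; last by lin_tac.
  transitivity (\tsum_(a, b <- Δ x) \tsum_(a', b' <- Δ b) \tsum_(c, d <- Δ y) (S (a ** c) ** (a'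
    ** target H d ** S b'))).
    apply: eq_tsum => a b; rewrite [RHS]tsum_exch; apply: eq_tsum => c d.
    by rewrite target_mulE (tsum_lin _ _ (g := fun s => S (a ** c) ** s)) //; lin_tac.
  rewrite -(sw_coassoc (wb_coalg hH) x (F := fun a b c
    => \tsum_(p, q <- Δ y) (S (a ** p) ** (b ** target H q ** S c)))); last by lin_tac.
  apply: eq_tsum => a b.
  pose G a' b' := \tsum_(c, d <- Δ y) \tsum_(p, q <- Δ d) (S (a' ** c) ** (b' ** p ** (S q ** S
    b))).
  transitivity (\tsum_(a', b' <- Δ a) G a' b').
    apply: eq_tsum => a' b'; apply: eq_tsum => c d.
    rewrite -targetE (tsum_lin _ _ (g := fun s => S (a' ** c) ** (b' ** s ** S b)));
      last by lin_tac.
    by apply: eq_tsum => p q; rewrite !mA.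
  transitivity (\tsum_(a', b' <- Δ a) \tsum_(c, d <- Δ y) \tsum_(p, q <- Δ c) (S (a' ** p) **
    (b' ** q ** (S d ** S b)))).
    apply: eq_tsum => a' b'.
    by rewrite (sw_coassoc (wb_coalg hH) y (F := fun c p q
      => S (a' ** c) ** (b' ** p ** (S q ** S b)))) //; lin_tac.
  rewrite tsum_exch; apply: eq_tsum => c d.
  rewrite -sourceE sw_mul //; last by lin_tac.
  rewrite (tsum_lin _ _ (g := fun s => s ** _)); last by lin_tac.
  apply: eq_tsum => p q.
  rewrite (tsum_lin _ _ (g := fun s => s ** _)); last by lin_tac.
  by apply: eq_tsum => r t; rewrite !mA.
rewrite [in RHS](antipode_source x) (tsum_lin _ _ (g := fun s => S y ** s)); last by lin_tac.
apply: eq_tsum => a b.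
transitivity (\tsum_(c, d <- Δ y) \tsum_(p, q <- Δ c) (S p ** source H a ** q ** S d ** S b)).
  apply: eq_tsum => c d; rewrite source_mulE (tsum_lin _ _ (g := fun s => s ** _));
    last by lin_tac.
  by apply: eq_tsum => p q; rewrite !mA.
rewrite (sw_coassoc (wb_coalg hH) y (F := fun p q d => S p ** source H a ** q ** S d ** S b));
  last by lin_tac.
rewrite [in RHS](antipode_target y) (tsum_lin _ _ (g := fun s => s ** _)); last by lin_tac.
apply: eq_tsum => c d.
rewrite -!mA [target H d ** _]mA target_source_comm // -targetE.
rewrite !mA (tsum_lin _ _ (g := fun s => S c ** _ ** s ** S b)); last by lin_tac.
by apply: eq_tsum => p q; rewrite !mA.
Qed.

End WeakHopf.

(** * Hopf algebras *)

Section Hopf.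
Variables (k : fieldType) (V : vectType k) (H : whopf_data V).
Hypothesis hH : hopf H.

Local Notation "x ** y" := (Defs.mul (walg H) x y) (at level 40, left associativity).
Local Notation Δ := (comul (wcoalg H)).
Local Notation ε := (counit (wcoalg H)).
Local Notation e := (aone (walg H)).
Local Notation S := (antipode H).
Local Notation HH := (tens_alg (walg H) (walg H)).

Let m1l := amul1l (hopf_alg hH).
Let m1r := amul1r (hopf_alg hH).
Let hC := hopf_coalg hH.

Lemma hopf_weak_bialgebra : weak_bialgebra H.
Proof.
split; [exact: hopf_alg|exact: hopf_coalg|exact: hopf_comulM|..].
- move=> h g f; rewrite !hopf_counitM //.
  rewrite -(sw_counitl hC g (f := fun y => ε h * ε y * ε f : k^o)); last by lin_tac.
  by apply: eq_tsum => a b; rewrite !hopf_counitM // /GRing.scale /= !mulrA (mulrC (ε a)).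
- move=> h g f; rewrite !hopf_counitM //.
  rewrite -(sw_counitr hC g (f := fun y => ε h * ε y * ε f : k^o)); last by lin_tac.
  rewrite -[in LHS](tsum_tens (Δ g)) tsum_tsum; apply: eq_tsum => a b; rewrite tsum_pure;
    last by lin_tac.
  by rewrite !hopf_counitM // /GRing.scale /= !mulrA (mulrC (ε b)).
- by rewrite hopf_comul1 // tmapE ?hopf_comul1 // ?tassocE ?mul_tens ?m1l //; lin_tac.
- by rewrite hopf_comul1 // tmapE ?hopf_comul1 // ?tassocE ?mul_tens ?m1l //; lin_tac.
Qed.

Lemma hopf_weak_hopf : weak_hopf H.
Proof.
split; first exact: hopf_weak_bialgebra.
- move=> h; rewrite hopf_antipoder // hopf_comul1 // mul_tens !m1l ?m1r tsum_pure //.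
  by lin_tac.
- move=> h; rewrite hopf_antipodel // hopf_comul1 // mul_tens !m1l ?m1r tsum_pure //.
  by lin_tac.
- move=> h; rewrite -[RHS](sw_counitl hC h (f := fun y => S y)); last by lin_tac.
  apply: eq_tsum => a b.
  rewrite -[X in _ *: X]m1l -(linZ (f := fun y => y ** S b)); last by lin_tac.
  by rewrite -hopf_antipodel // (tsum_lin _ _ (g := fun s => s ** S b)) //; lin_tac.
Qed.

Lemma hopf_antipodeM x y : S (x ** y) = S y ** S x.
Proof. exact: (antipodeM hopf_weak_hopf). Qed.

(** Both sides are convolution inverses of the coproduct, as maps into the
    tensor square. *)
Lemma hopf_comul_antipode x : Δ (S x) = \tsum_(a, b <- Δ x) (S b ⊗ S a).
Proof.
have hHH := tens_is_algebra (hopf_alg hH) (hopf_alg hH).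
pose Y x := \tsum_(a, b <- Δ x) (S b ⊗ S a); rewrite -/(Y x).
have Yl : lin Y by rewrite /Y; lin_tac.
have DY z : \tsum_(a, b <- Δ z) (Δ a *[HH] Y b) = ε z *: (e ⊗ e).
  transitivity (\tsum_(a, b <- Δ z) \tsum_(c, d <- Δ b) (Δ a *[HH] (S d ⊗ S c))).
    by apply: eq_tsum => a b; rewrite /Y (tsum_lin _ _ (g := fun s => Δ a *[HH] s)) //; lin_tac.
  rewrite -(sw_coassoc hC z (F := fun a c d => Δ a *[HH] (S d ⊗ S c))); last by lin_tac.
  rewrite -(linZ (f := fun s => s ⊗ e)) -?hopf_antipoder //; last by lin_tac.
  rewrite (tsum_lin _ _ (g := fun s => s ⊗ e)); last by lin_tac.
  apply: eq_tsum => a b.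
  transitivity (\tsum_(p, q <- Δ a) \tsum_(c, d <- Δ p) ((c ** S b) ⊗ (d ** S q))).
    apply: eq_tsum => p q; rewrite -{1}[Δ p]tsum_tens.
    rewrite (tsum_lin _ _ (g := fun s => s *[HH] _)); last by lin_tac.
    by apply: eq_tsum => c d; rewrite mul_tens.
  rewrite (sw_coassoc hC a (F := fun p q c => (p ** S b) ⊗ (q ** S c))); last by lin_tac.
  rewrite -(sw_counitr hC a (f := fun y => y ** S b ⊗ e)); last by lin_tac.
  apply: eq_tsum => p q; rewrite -(tsum_lin _ _ (g := fun s => (p ** S b) ⊗ s)); last by lin_tac.
  by rewrite hopf_antipoder // (linZ (f := fun s => (p ** S b) ⊗ s)) //; lin_tac.
have ee : e ⊗ e = aone HH by [].
transitivity (\tsum_(a, b <- Δ x) \tsum_(c, d <- Δ b) (Δ (S a) *[HH] (Δ c *[HH] Y d))).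
  rewrite -[LHS](sw_counitr hC x (f := fun y => Δ (S y))); last by lin_tac.
  apply: eq_tsum => a b; rewrite -(tsum_lin _ _ (g := fun s => Δ (S a) *[HH] s)); last by lin_tac.
  rewrite DY (linZ (f := fun s => Δ (S a) *[HH] s)); last by lin_tac.
  by rewrite ee (amul1r hHH).
rewrite -(sw_coassoc hC x (F := fun a c d => Δ (S a) *[HH] (Δ c *[HH] Y d))); last by lin_tac.
rewrite -[RHS](sw_counitl hC x (f := Y)) //.
apply: eq_tsum => a b.
transitivity (\tsum_(c, d <- Δ a) (Δ (S c ** d) *[HH] Y b)).
  by apply: eq_tsum => c d; rewrite (amulA hHH) hopf_comulM.
rewrite -(tsum_lin _ _ (g := fun s => Δ s *[HH] Y b)); last by lin_tac.
rewrite hopf_antipodel // (linZ (f := fun s => Δ s *[HH] Y b)); last by lin_tac.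
by rewrite hopf_comul1 // ee (amul1l hHH).
Qed.

Lemma hopf_counit_antipode x : ε (S x) = ε x.
Proof.
have := congr1 ε (hopf_antipoder hH x).
rewrite linearZ /= hopf_counit1 // [RHS]mulr1 => <-.
rewrite -[in LHS](sw_counitl hC x (f := fun y => ε (S y) : k^o)); last by lin_tac.
rewrite [RHS](tsum_lin _ _ (g := fun y => ε y : k^o)); last by lin_tac.
by apply: eq_tsum => a b; rewrite hopf_counitM.
Qed.

Lemma hopf_antipode1 : S e = e.
Proof.
have := hopf_antipoder hH e; rewrite hopf_comul1 // tsum_pure; last by lin_tac.
by rewrite hopf_counit1 // scale1r m1l.
Qed.

End Hopf.

Lemma sum_covec (k : fieldType) (V : vectType k) (f : 'Hom(V, k^o)) :
  f = \sum_i f (bvec i) *: bcovec i.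
Proof.
apply/lfunP => v; rewrite sum_lfunE [LHS]sum_bvec; apply: eq_bigr => i _.
by rewrite lfunE /= /GRing.scale /= mulrC.
Qed.

(** * Integrals and injectivity of the antipode *)

Section Coaction.
Variables (k : fieldType) (V : vectType k) (C : coalgebra V).
Hypothesis hC : is_coalgebra C.
Local Notation Δ := (comul C).
Local Notation V' := 'Hom(V, k^o).

(** Convolution by functionals on the left makes the dual of V a comodule over V:
    the coaction is
    the sum over i of [coact_coef f i] ⊗ e_i, characterised by
    f_0(x) f_1 = x_1 f(x_2). [coact f G] is the Sweedler sum G(f_0, f_1). *)
Definition coact_coef (f : V') i : V' :=
  linfun (fun x : V => \tsum_(a, b <- Δ x) (bcovec i a * f b : k^o)).

Lemma coact_coefE f i x : coact_coef f i x = \tsum_(a, b <- Δ x) (bcovec i a * f b : k^o).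
Proof. by rewrite linfunE //; lin_tac. Qed.

Lemma coact_coef_lin i : lin (fun f => coact_coef f i).
Proof.
move=> a f g; apply/lfunP => x; rewrite lfunE /= lfunE /= !coact_coefE.
have L : lin (fun f : V' => \tsum_(a, b <- Δ x) (bcovec i a * f b : k^o)) by lin_tac.
exact: L.
Qed.

Definition coact (X : lmodType k) (f : V') (G : V' -> V -> X) : X :=
  \sum_i G (coact_coef f i) (bvec i).

Lemma eq_coact (X : lmodType k) f (G G' : V' -> V -> X) :
  (forall g c, G g c = G' g c) -> coact f G = coact f G'.
Proof. by move=> eqG; apply: eq_bigr => i _. Qed.

Lemma coact_lin (X : lmodType k) (G : V' -> V -> X) : bilin G -> lin (fun f => coact f G).
Proof.
move=> Gl; apply: lin_sum => i; have Cl := @coact_coef_lin i.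
by apply: (bilin_l _ Gl).
Qed.

Lemma coact_tsum (X : lmodType k) f W W' (t : tens W W') (G : V' -> V -> W -> W' -> X) :
  coact f (fun g c => tsum t (G g c)) = tsum t (fun a b => coact f (fun g c => G g c a b)).
Proof. by rewrite /coact tsum_sum. Qed.

Lemma lin_coactr (X Y : lmodType k) f (G : Y -> V' -> V -> X) :
  (forall g c, lin (fun y => G y g c)) -> lin (fun y => coact f (G y)).
Proof. by move=> Gl; apply: lin_sum => i. Qed.

Lemma coact_eval (X : lmodType k) f x (G : V -> X) : lin G ->
  coact f (fun g c => g x *: G c) = \tsum_(a, b <- Δ x) (f b *: G a).
Proof.
move=> Gl; transitivity (\sum_i \tsum_(a, b <- Δ x) ((f b * bcovec i a) *: G (bvec i))).
  apply: eq_bigr => i _.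
  rewrite coact_coefE (tsum_lin _ _ (g := fun s : k^o => s *: G (bvec i))); last by lin_tac.
  by apply: eq_tsum => a b; rewrite mulrC.
rewrite -tsum_sum; apply: eq_tsum => a b.
rewrite {2}[a]sum_bcovec (lin_bigsum Gl) scaler_sumr; apply: eq_bigr => i _.
by rewrite (linZ Gl) scalerA.
Qed.

(** Expands f_0 in the dual basis, so that the coaction of f is read off from
    coproducts of basis vectors; coassociativity then reduces to that of Δ. *)
Lemma coactE (X : lmodType k) f (G : V' -> V -> X) : bilin G ->
  coact f G = \sum_p \tsum_(a, b <- Δ (bvec p)) (f b *: G (bcovec p) a).
Proof.
move=> Gl.
transitivity (\sum_p coact f (fun g c => g (bvec p) *: G (bcovec p) c)); last first.
  by apply: eq_bigr => p _; rewrite coact_eval //; lin_tac.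
rewrite exchange_big; apply: eq_bigr => i _ /=.
rewrite {1}[coact_coef f i]sum_covec (lin_bigsum (Gl.1 _)); apply: eq_bigr => p _.
by rewrite (linZ (Gl.1 _)).
Qed.

Lemma coact_coassoc (X : lmodType k) f (F : V' -> V -> V -> X) : trilin F ->
  coact f (fun g c => coact g (fun g' c' => F g' c' c)) =
  coact f (fun g c => \tsum_(a, b <- Δ c) F g a b).
Proof.
move=> Fl.
have Rl c : lin (fun g => coact g (fun g' c' => F g' c' c)).
  by apply: coact_lin; lin_tac.
have Gl : bilin (fun g c => coact g (fun g' c' => F g' c' c)).
  by split=> // g; apply: lin_coactr => g' c; lin_tac.
rewrite coactE // [RHS]coactE; last by lin_tac.
transitivity (\sum_p \sum_q \tsum_(c, d <- Δ (bvec q)) \tsum_(a, b <- Δ (bvec p))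
   (bcovec p d *: (f b *: F (bcovec q) c a))).
  apply: eq_bigr => p _.
  under [RHS]eq_bigr => q _ do rewrite tsum_exch.
  rewrite -tsum_sum; apply: eq_tsum => a b.
  rewrite coactE; last by lin_tac.
  rewrite scaler_sumr; apply: eq_bigr => q _; rewrite -tsumZ.
  by apply: eq_tsum => c d; rewrite !scalerA mulrC.
rewrite exchange_big; apply: eq_bigr => q _ /=.
rewrite -tsum_sum.
transitivity (\tsum_(c, d <- Δ (bvec q)) \tsum_(a, b <- Δ d) (f b *: F (bcovec q) c a)).
  apply: eq_tsum => c d; pose L d := \tsum_(a, b <- Δ d) (f b *: F (bcovec q) c a).
  have Ll : lin L by rewrite /L; lin_tac.
  rewrite -/(L d) [d in RHS]sum_bcovec (lin_bigsum Ll); apply: eq_bigr => p _.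
  by rewrite (linZ Ll) tsumZ.
rewrite -(sw_coassoc hC _ (F := fun c a b => f b *: F (bcovec q) c a)); last by lin_tac.
by apply: eq_tsum => a b; rewrite tsumZ.
Qed.

End Coaction.

Section Integral.
Variables (k : fieldType) (V : vectType k) (H : whopf_data V).
Hypothesis hH : hopf H.

Local Notation "x ** y" := (Defs.mul (walg H) x y) (at level 40, left associativity).
Local Notation Δ := (comul (wcoalg H)).
Local Notation ε := (counit (wcoalg H)).
Local Notation e := (aone (walg H)).
Local Notation S := (antipode H).
Local Notation V' := 'Hom(V, k^o).

Let mA := amulA (hopf_alg hH).
Let m1l := amul1l (hopf_alg hH).
Let m1r := amul1r (hopf_alg hH).
Let hC := hopf_coalg hH.

(** The coaction intertwines the action (g z)(x) = g(x S(z)) with the coproduct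
    of z: this is the Hopf module property of the dual of V. *)
Lemma coaction_mul_antipode (g : V -> k^o) x z : lin g ->
  \tsum_(a, b <- Δ x) (g (b ** S z) *: a) =
  \tsum_(p, q <- Δ z) \tsum_(a, b <- Δ (x ** S p)) (g b *: (a ** q)).
Proof.
move=> gl; apply/esym.
transitivity (\tsum_(a, b <- Δ x) \tsum_(r, q <- Δ z) \tsum_(c, d <- Δ r) (g (b ** S c) *: (a **
  (S d ** q)))).
  rewrite [RHS]tsum_exch; apply: eq_tsum => p q.
  rewrite (sw_mul (hopf_weak_bialgebra hH) x (S p) (F := fun a b => g b *: (a ** q)));
    last by lin_tac.
  apply: eq_tsum => a b; rewrite hopf_comul_antipode // tsum_tsum; apply: eq_tsum => c d.
  by rewrite tsum_pure -?mA //; lin_tac.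
apply: eq_tsum => a b.
rewrite (sw_coassoc hC z (F := fun c d q => g (b ** S c) *: (a ** (S d ** q)))); last by lin_tac.
rewrite -[RHS](sw_counitr hC z (f := fun y => g (b ** S y) *: a)); last by lin_tac.
apply: eq_tsum => c d.
rewrite -(tsum_lin _ _ (g := fun s => g (b ** S c) *: (a ** s))); last by lin_tac.
by rewrite hopf_antipodel // (linZ (f := fun s => _ *: (a ** s))) ?m1r //; lin_tac.
Qed.

(** The projection f_0 S(f_1) of the Hopf module onto its coinvariants, which
    are the integrals. *)
Definition integral_of (f : V') (x : V) : k^o :=
  coact H f (fun g c => g (x ** S (S c)) : k^o).

Lemma integral_of_lin f : lin (integral_of f).
Proof. by apply: lin_coactr => g c; lin_tac. Qed.

Lemma integral_of_invariant f x :
  \tsum_(a, b <- Δ x) (integral_of f b *: a) = integral_of f x *: e.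
Proof.
transitivity (coact H f (fun g c => \tsum_(a, b <- Δ x) (g (b ** S (S c)) *: a))).
  rewrite coact_tsum; apply: eq_tsum => a b.
  by rewrite /integral_of /coact scaler_suml.
pose F (g' : V') c' c := \tsum_(p, q <- Δ c) (g' (x ** S (S q)) *: (c' ** S p)).
have Fl : trilin F by rewrite /F; lin_tac.
transitivity (coact H f (fun g c => coact H g (fun g' c' => F g' c' c))).
  apply: eq_coact => g c; rewrite coaction_mul_antipode; last by lin_tac.
  rewrite hopf_comul_antipode // tsum_tsum coact_tsum; apply: eq_tsum => p q.
  rewrite tsum_pure; last by lin_tac.
  by rewrite (coact_eval _ _ _ (G := fun a => a ** S p)) //; lin_tac.
rewrite coact_coassoc // /integral_of /coact scaler_suml; apply: eq_bigr => i _.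
move: (coact_coef H f i) (bvec i) => g c.
rewrite /F -(sw_coassoc hC c (F := fun a p q => g (x ** S (S q)) *: (a ** S p))); last by lin_tac.
rewrite -(sw_counitl hC c (f := fun y => g (x ** S (S y)) *: e)); last by lin_tac.
apply: eq_tsum => a b; rewrite tsumZ hopf_antipoder //.
by rewrite !scalerA mulrC.
Qed.

(** Integrals generate the Hopf module: f is the sum of (projection of f_0) f_1. *)
Lemma integral_of_generate f x :
  coact H f (fun g c => integral_of g (x ** S c)) = f x.
Proof.
rewrite (coact_coassoc hC f (F := fun g' c' c => g' (x ** S c ** S (S c')) : k^o));
  last by lin_tac.
rewrite -[RHS](sw_counitl hC x (f := fun y => f y)); last by lin_tac.
transitivity (coact H f (fun g c => g x *: (ε c : k^o))); last first.
  rewrite coact_eval; last by lin_tac.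
  by apply: eq_tsum => a b; rewrite [LHS]mulrC.
apply: eq_coact => g c.
transitivity (\tsum_(a, b <- Δ c) g (x ** S (S a ** b))).
  by apply: eq_tsum => a b; rewrite hopf_antipodeM // mA.
rewrite -(tsum_lin _ _ (g := fun s => g (x ** S s))); last by lin_tac.
rewrite hopf_antipodel // (linZ (f := fun s => g (x ** S s))); last by lin_tac.
by rewrite hopf_antipode1 // m1r [LHS]mulrC.
Qed.

(** If S(h) = 0 then lam acts by h as zero, and the action of h on an integral
    can be undone: applying the projection to lam h_1 and keeping h_2 returns
    lam ⊗ h. *)
Lemma integral_antipode_ker (lam : V -> k^o) h x : lin lam ->
  (forall y, \tsum_(a, b <- Δ y) (lam b *: a) = lam y *: e) ->
  S h = 0 -> lam x *: h = 0.
Proof.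
move=> laml lamI Sh0.
have step y : \tsum_(a, b <- Δ h) (lam (y ** S a) *: b) = 0.
  have := coaction_mul_antipode y h laml; rewrite Sh0.
  have -> : \tsum_(a, b <- Δ y) (lam (b ** 0) *: a) = 0.
    rewrite /tsum big1 // => i _; rewrite big1 // => j _.
    by rewrite (lin0 (f := fun s => lam (_ ** s) *: _)) ?scaler0 //; lin_tac.
  move=> E; rewrite [RHS]E; apply: eq_tsum => a b.
  rewrite -[b in LHS]m1l -(linZ (f := fun s => s ** b)); last by lin_tac.
  rewrite -lamI (tsum_lin _ _ (g := fun s => s ** b)); last by lin_tac.
  by apply: eq_tsum => c d; rewrite (linZ (f := fun s => s ** b)) //; lin_tac.
rewrite -(sw_counitl hC h (f := fun y => lam x *: y)); last by lin_tac.
transitivity (\tsum_(a, b <- Δ h) \tsum_(c, d <- Δ a) (lam (x ** S (c ** S d)) *: b)).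
  apply: eq_tsum => a b.
  rewrite -(tsum_lin _ _ (g := fun s => lam (x ** S s) *: b)); last by lin_tac.
  rewrite hopf_antipoder // (linZ (f := fun s => lam (x ** S s) *: b)); last by lin_tac.
  by rewrite hopf_antipode1 // m1r.
rewrite (sw_coassoc hC h (F := fun c d b => lam (x ** S (c ** S d)) *: b)); last by lin_tac.
transitivity (\tsum_(a, b <- Δ h) \sum_i \tsum_(c, d <- Δ b)
   (bcovec i c *: (lam (x ** S (S (bvec i)) ** S a) *: d))).
  apply: eq_tsum => a b; rewrite -tsum_sum; apply: eq_tsum => c d.
  rewrite hopf_antipodeM // mA.
  pose L c := lam (x ** S (S c) ** S a) *: d.
  have Ll : lin L by rewrite /L; lin_tac.
  rewrite -/(L c) [c in LHS]sum_bcovec (lin_bigsum Ll); apply: eq_bigr => i _.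
  by rewrite (linZ Ll).
rewrite tsum_sum big1 // => i _.
transitivity (tsum (Δ (\tsum_(a, b <- Δ h) (lam (x ** S (S (bvec i)) ** S a) *: b))) (fun c d
  => bcovec i c *: d)).
  rewrite (tsum_lin _ _ (g := fun s => tsum (Δ s) _)); last by lin_tac.
  apply: eq_tsum => a b; rewrite (linZ (f := fun s => tsum (Δ s) _)); last by lin_tac.
  rewrite -tsumZ; apply: eq_tsum => c d.
  by rewrite !scalerA mulrC.
by rewrite step (lin0 (f := fun s => tsum (Δ s) _)) //; lin_tac.
Qed.

(** If S killed a nonzero h, all integrals would vanish by
    [integral_antipode_ker], hence all functionals by [integral_of_generate]. *)
Lemma hopf_antipode_inj : injective S.
Proof.
move=> x y /eqP; rewrite -subr_eq0 -linearB => /eqP; set h := _ - _ => Sh0.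
apply/eqP; rewrite -subr_eq0 -/h; apply/eqP.
have [//|hn0] := eqVneq h 0.
(* Show that each coordinate functional vanishes at h: by [integral_of_generate] its
   value is a sum of values of integrals at the points h S(e_j). *)
rewrite [h]sum_bcovec big1 // => i _; rewrite -integral_of_generate /coact big1 ?scale0r //
  => j _.
have /eqP := integral_antipode_ker (h := h) (h ** S (bvec j)) (integral_of_lin _)
  (integral_of_invariant (coact_coef H (bcovec i) j)) Sh0.
by rewrite scaler_eq0 (negbTE hn0) orbF => /eqP.
Qed.

End Integral.

(** * Duality along a pairing *)

Section Separation.
Variables (k : fieldType) (V W : vectType k) (P : 'Hom(W, 'Hom(V, k^o))).
Hypothesis P_inj : injective P.

(** Evaluation of tensors over W against pure tensors over V; these values
    separate tensors when the pairing does. *)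
Definition ev2 h g (t : tens W W) : k^o := \tsum_(x, y <- t) (P x h * P y g : k^o).
Definition ev3 h g f (t : tens (tens W W) W) : k^o :=
  \tsum_(s, z <- t) (ev2 h g s * P z f : k^o).

Lemma ev2_lin h g : lin (ev2 h g). Proof. rewrite /ev2; lin_tac. Qed.

Lemma pairing_sep x y : (forall h, P x h = P y h) -> x = y.
Proof. by move=> xy; apply: P_inj; apply/lfunP. Qed.

Let q i : W := (P^-1)%VF (bcovec i).

Lemma P_lfunK : cancel P (P^-1)%VF.
Proof. by apply: lker0_lfunK; apply/lker0P. Qed.

Lemma pairing_basis x : x = \sum_i P x (bvec i) *: q i.
Proof.
rewrite -{1}[x]P_lfunK {1}[P x]sum_covec linear_sum; apply: eq_bigr => i _.
by rewrite linearZ.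
Qed.

Lemma ev2E t : t = \sum_i \sum_j ev2 (bvec i) (bvec j) t *: (q i ⊗ q j).
Proof.
have El := ev2_lin.
move: t; apply: tens_ext; [lin_tac|rewrite /ev2; lin_tac|].
move=> x y; rewrite {1}[x]pairing_basis (lin_bigsum (f := fun s => s ⊗ y)); last by lin_tac.
apply: eq_bigr => i _; rewrite (linZ (f := fun s => s ⊗ y)); last by lin_tac.
rewrite {1}[y]pairing_basis (lin_bigsum (f := fun s => q i ⊗ s)); last by lin_tac.
rewrite scaler_sumr; apply: eq_bigr => j _.
rewrite (linZ (f := fun s => q i ⊗ s)); last by lin_tac.
by rewrite scalerA /ev2 tsum_pure //; lin_tac.
Qed.

Lemma ev2_sep s t : (forall h g, ev2 h g s = ev2 h g t) -> s = t.
Proof.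
move=> st; rewrite [s]ev2E [t]ev2E.
by apply: eq_bigr => i _; apply: eq_bigr => j _; rewrite st.
Qed.

Lemma ev3E t : t = \sum_i \sum_j \sum_l ev3 (bvec i) (bvec j) (bvec l) t *: (q i ⊗ q j ⊗ q l).
Proof.
have El := ev2_lin.
move: t; apply: tens_ext; [lin_tac|rewrite /ev3 /ev2; lin_tac|].
move=> s z; rewrite {1}[s]ev2E (lin_bigsum (f := fun s => s ⊗ z)); last by lin_tac.
apply: eq_bigr => i _; rewrite (lin_bigsum (f := fun s => s ⊗ z)); last by lin_tac.
apply: eq_bigr => j _; rewrite (linZ (f := fun s => s ⊗ z)); last by lin_tac.
rewrite {1}[z]pairing_basis (lin_bigsum (f := fun s => _ ⊗ s)); last by lin_tac.
rewrite scaler_sumr; apply: eq_bigr => l _.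
rewrite (linZ (f := fun s => _ ⊗ s)); last by lin_tac.
by rewrite scalerA /ev3 tsum_pure //; lin_tac.
Qed.

Lemma ev3_sep s t : (forall h g f, ev3 h g f s = ev3 h g f t) -> s = t.
Proof.
move=> st; rewrite [s]ev3E [t]ev3E.
by do 3 (apply: eq_bigr => ? _); rewrite st.
Qed.

End Separation.

Section SkewDual.
Variables (k : fieldType) (V W : vectType k) (H : whopf_data V) (D : whopf_data W).
Variables (P : 'Hom(W, 'Hom(V, k^o))) (T : 'End(V)).
Hypothesis P_inj : injective P.
Hypothesis hH : weak_bialgebra H.
Local Notation "x ** y" := (Defs.mul (walg H) x y) (at level 40, left associativity).
Local Notation "x ## y" := (Defs.mul (walg D) x y) (at level 40, left associativity).
Local Notation Δ := (comul (wcoalg H)).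
Local Notation ε := (counit (wcoalg H)).
Local Notation e := (aone (walg H)).

Hypothesis PM : forall x y h, P (x ## y) h = \tsum_(a, b <- Δ h) (P y a * P x b : k^o).
Hypothesis P1 : forall h, P (aone D) h = ε h.
Hypothesis Pcomul : forall x h g, ev2 P h g (comul D x) = P x (h ** g).
Hypothesis Pcounit : forall x, counit D x = P x e.
Hypothesis PS : forall x h, P (antipode D x) h = P x (T h).
Hypothesis T1 : forall h,
  \tsum_(a, b <- Δ h) (b ** T a) = \tsum_(a, b <- Δ e) (ε (b ** h) *: a).
Hypothesis T2 : forall h,
  \tsum_(a, b <- Δ h) (T b ** a) = \tsum_(a, b <- Δ e) (ε (h ** a) *: b).
Hypothesis T3 : forall h,
  \tsum_(a, b <- Δ h) \tsum_(c, d <- Δ b) (T d ** c ** T a) = T h.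

Let mA := amulA (wb_alg hH).
Let m1l := amul1l (wb_alg hH).
Let m1r := amul1r (wb_alg hH).
Let hC := wb_coalg hH.
Let El := ev2_lin P.

Let P_tsum V' W' (t : tens V' W') (f : V' -> W' -> W) h :
  P (tsum t f) h = \tsum_(a, b <- t) P (f a b) h.
Proof. by rewrite (tsum_lin _ _ (g := fun s => P s h)) //; lin_tac. Qed.

Let P_tsumr x V' W' (t : tens V' W') (f : V' -> W' -> V) :
  P x (tsum t f) = \tsum_(a, b <- t) P x (f a b).
Proof. by rewrite (tsum_lin _ _ (g := fun s => P x s)) //; lin_tac. Qed.

Let PZ c x h : P (c *: x) h = c * P x h.
Proof. by rewrite (linZ (f := fun s => P s h)) //; lin_tac. Qed.

Let mul_tsuml V' W' (t : tens V' W') (f : V' -> W' -> k^o) (c : k) :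
  (tsum t f : k) * c = \tsum_(a, b <- t) (f a b * c : k^o).
Proof. by rewrite (tsum_lin _ _ (g := fun s : k^o => s * c : k^o)) //; lin_tac. Qed.

Let mul_tsumr V' W' (t : tens V' W') (f : V' -> W' -> k^o) (c : k) :
  c * (tsum t f : k) = \tsum_(a, b <- t) (c * f a b : k^o).
Proof. by rewrite (tsum_lin _ _ (g := fun s : k^o => c * s : k^o)) //; lin_tac. Qed.

Let mul4l (p q r s : k) : p * (q * r) * s = q * s * (p * r).
Proof. ring. Qed.

Let mul4r (p q r s : k) : p * (q * r) * s = r * s * (p * q).
Proof. ring. Qed.

Lemma skew_dual_alg : is_algebra D.
Proof.
split.
- move=> x y z; apply: (pairing_sep P_inj) => h; rewrite !PM.
  transitivity (\tsum_(a, b <- Δ h) \tsum_(c, d <- Δ a) (P z c * P y d * P x b : k^o)).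
    by apply: eq_tsum => a b; rewrite PM mul_tsuml.
  rewrite (sw_coassoc hC h (F := fun c d b => P z c * P y d * P x b : k^o)); last by lin_tac.
  by apply: eq_tsum => a b; rewrite PM mul_tsumr; apply: eq_tsum => c d; rewrite mulrA.
- move=> x; apply: (pairing_sep P_inj) => h; rewrite PM.
  rewrite -[RHS](sw_counitr hC h (f := P x)); last by lin_tac.
  by apply: eq_tsum => a b; rewrite P1 mulrC.
- move=> x; apply: (pairing_sep P_inj) => h; rewrite PM.
  rewrite -[RHS](sw_counitl hC h (f := P x)); last by lin_tac.
  by apply: eq_tsum => a b; rewrite P1.
Qed.

Let ev3_tassoc h g f t :
  ev3 P h g f (tassoc W W W t) = \tsum_(x, s <- t) (P x h * ev2 P g f s : k^o).
Proof.
rewrite /ev3 tsum_tassoc; last by lin_tac.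
apply: eq_tsum => x s; rewrite /ev2 mul_tsumr; apply: eq_tsum => y z.
by rewrite tsum_pure ?mulrA //; lin_tac.
Qed.

Let ev3_tmap h g f x : ev3 P h g f (tmap (comul D) id (comul D x)) = P x (h ** g ** f).
Proof.
rewrite /ev3 tsum_tmap; try lin_tac.
by rewrite -Pcomul; apply: eq_tsum => y z; rewrite Pcomul.
Qed.

Lemma skew_dual_coalg : is_coalgebra D.
Proof.
split.
- move=> x; apply: (ev3_sep P_inj) => h g f.
  rewrite ev3_tmap ev3_tassoc tsum_tmap; try lin_tac.
  by rewrite -mA -Pcomul; apply: eq_tsum => y z; rewrite Pcomul.
- move=> x; apply: (pairing_sep P_inj) => h; rewrite P_tsum.
  rewrite -[h in RHS]m1l -Pcomul; apply: eq_tsum => a b.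
  by rewrite PZ Pcounit.
- move=> x; apply: (pairing_sep P_inj) => h; rewrite P_tsum.
  rewrite -[h in RHS]m1r -Pcomul; apply: eq_tsum => a b.
  by rewrite PZ Pcounit mulrC.
Qed.

(** The axioms are exchanged by transposition: the unit axioms of D are the
    counit axioms of H and conversely, while multiplicativity of the coproduct is
    self-dual. *)
Lemma skew_dual_weak_bialgebra : weak_bialgebra D.
Proof.
have hA := skew_dual_alg.
split; [exact: skew_dual_alg|exact: skew_dual_coalg|..].
- move=> x y; apply: (ev2_sep P_inj) => h g; rewrite Pcomul PM.
  rewrite sw_mul //; last by lin_tac.
  rewrite /ev2 tsum_mul; last by lin_tac.
  transitivity (\tsum_(x1, x2 <- comul D x) \tsum_(y1, y2 <- comul D y)
     \tsum_(a, b <- Δ h) \tsum_(c, d <- Δ g) (P y1 a * P x1 b * (P y2 c * P x2 d) : k^o));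
       last first.
    apply: eq_tsum => x1 x2; apply: eq_tsum => y1 y2.
    by rewrite !PM mul_tsuml; apply: eq_tsum => a b; rewrite mul_tsumr.
  under [RHS]eq_tsum => x1 x2 do rewrite tsum_exch.
  rewrite [RHS]tsum_exch; apply: eq_tsum => a b.
  under [RHS]eq_tsum => x1 x2 do rewrite tsum_exch.
  rewrite [RHS]tsum_exch; apply: eq_tsum => c d.
  rewrite -!Pcomul /ev2 mul_tsumr; apply: eq_tsum => x1 x2.
  rewrite mul_tsuml; apply: eq_tsum => y1 y2.
  by rewrite !mulrA; congr (_ * _); rewrite mulrAC.
- move=> x y z; rewrite Pcounit PM.
  transitivity (\tsum_(a, b <- Δ e) \tsum_(c, d <- Δ b) (P z a * P y c * P x d : k^o)).
    by apply: eq_tsum => a b; rewrite PM mul_tsumr; apply: eq_tsum => c d; rewrite mulrA.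
  rewrite -(sw_coassoc hC _ (F := fun a c d => P z a * P y c * P x d : k^o)); last by lin_tac.
  rewrite (sw_comul1r hH (F := fun a c d => P z a * P y c * P x d : k^o)); last by lin_tac.
  transitivity (\tsum_(y1, y2 <- comul D y) \tsum_(a, b <- Δ e) \tsum_(c, d <- Δ e)
     (P y1 c * P x d * (P z a * P y2 b) : k^o)); last first.
    apply: eq_tsum => y1 y2; rewrite !Pcounit !PM mul_tsumr; apply: eq_tsum => a b.
    by rewrite mul_tsuml.
  rewrite [RHS]tsum_exch; apply: eq_tsum => a b.
  rewrite [RHS]tsum_exch; apply: eq_tsum => c d.
  rewrite -Pcomul /ev2 mul_tsumr mul_tsuml; apply: eq_tsum => y1 y2.
  by apply: (mul4l (P z a) (P y1 c) (P y2 b) (P x d)).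
- move=> x y z; rewrite Pcounit PM.
  transitivity (\tsum_(a, b <- Δ e) \tsum_(c, d <- Δ b) (P z a * P y c * P x d : k^o)).
    by apply: eq_tsum => a b; rewrite PM mul_tsumr; apply: eq_tsum => c d; rewrite mulrA.
  rewrite -(sw_coassoc hC _ (F := fun a c d => P z a * P y c * P x d : k^o)); last by lin_tac.
  rewrite (sw_comul1l hH (F := fun a c d => P z a * P y c * P x d : k^o)); last by lin_tac.
  transitivity (\tsum_(y1, y2 <- comul D y) \tsum_(a, b <- Δ e) \tsum_(c, d <- Δ e)
     (P y2 c * P x d * (P z a * P y1 b) : k^o)); last first.
    apply: eq_tsum => y1 y2; rewrite !Pcounit !PM mul_tsumr; apply: eq_tsum => a b.
    by rewrite mul_tsuml.
  rewrite [RHS]tsum_exch; apply: eq_tsum => a b.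
  rewrite [RHS]tsum_exch; apply: eq_tsum => c d.
  rewrite -Pcomul /ev2 mul_tsumr mul_tsuml; apply: eq_tsum => y1 y2.
  by apply: (mul4r (P z a) (P y1 b) (P y2 c) (P x d)).
- apply: (ev3_sep P_inj) => h g f; rewrite ev3_tmap P1 (wb_counitMr hH).
  rewrite /ev3 tsum_mul; last by lin_tac.
  rewrite tsum_pure; last by lin_tac.
  rewrite tsum_tassoc; last by lin_tac.
  rewrite tsum_pure; last by lin_tac.
  transitivity (\tsum_(b, c <- comul D (aone D)) \tsum_(a, b' <- comul D (aone D))
      \tsum_(g1, g2 <- Δ g) (P a h * (P b g1 * P b' g2) * P c f : k^o)); last first.
    apply: eq_tsum => b c; rewrite /ev2 tsum_mul ?mul_tsuml; last by lin_tac.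
    apply: eq_tsum => a b'; rewrite tsum_pure ?(amul1r hA) ?(amul1l hA) ?PM; last by lin_tac.
    by rewrite mul_tsumr mul_tsuml.
  under [RHS]eq_tsum => b c do rewrite tsum_exch.
  rewrite [RHS]tsum_exch; apply: eq_tsum => g1 g2.
  rewrite -!P1 -!Pcomul /ev2 mul_tsumr; apply: eq_tsum => b c.
  rewrite mul_tsuml; apply: eq_tsum => a b'; apply/esym.
  by rewrite [RHS]mulrC; exact: (mul4l (P a h) (P b g1) (P b' g2) (P c f)).
- apply: (ev3_sep P_inj) => h g f; rewrite ev3_tmap P1 (wb_counitMl hH).
  rewrite /ev3 tsum_mul; last by lin_tac.
  rewrite tsum_tassoc; last by lin_tac.
  rewrite tsum_pure; last by lin_tac.
  transitivity (\tsum_(b, c <- comul D (aone D)) \tsum_(a, b' <- comul D (aone D))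
      \tsum_(g1, g2 <- Δ g) (P a h * (P b' g1 * P b g2) * P c f : k^o)); last first.
    apply: eq_tsum => b c; rewrite tsum_pure; last by lin_tac.
    rewrite /ev2 tsum_mul; last by lin_tac.
    rewrite tsum_pure ?mul_tsuml; last by lin_tac.
    apply: eq_tsum => a b'; rewrite ?(amul1r hA) ?(amul1l hA) ?PM.
    by rewrite mul_tsumr mul_tsuml.
  under [RHS]eq_tsum => b c do rewrite tsum_exch.
  rewrite [RHS]tsum_exch; apply: eq_tsum => g1 g2.
  rewrite -!P1 -!Pcomul /ev2 mul_tsumr; apply: eq_tsum => b c.
  rewrite mul_tsuml; apply: eq_tsum => a b'.
  by rewrite !mulrA.
Qed.

(** The hypotheses on T are the antipode axioms of H with the opposite
    comultiplication; the inverse of an antipode of H is expected to satisfy them. *)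
Lemma skew_dual_weak_hopf : weak_hopf D.
Proof.
have hA := skew_dual_alg.
split; first exact: skew_dual_weak_bialgebra.
- move=> x; apply: (pairing_sep P_inj) => h; rewrite !P_tsum.
  transitivity (P x (\tsum_(a, b <- Δ h) (b ** T a))).
    rewrite P_tsumr.
    transitivity (\tsum_(y, z <- comul D x) \tsum_(a, b <- Δ h) (P z (T a) * P y b : k^o)).
      by apply: eq_tsum => y z; rewrite PM; apply: eq_tsum => a b; rewrite PS.
    rewrite tsum_exch; apply: eq_tsum => a b; rewrite -Pcomul.
    by apply: eq_tsum => y z; rewrite mulrC.
  rewrite T1 P_tsumr tsum_mul; last by lin_tac.
  transitivity (\tsum_(a, b <- comul D (aone D)) \tsum_(c, d <- Δ e) (P x c * P a d * P b h :
    k^o)); last first.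
    apply: eq_tsum => a b; rewrite tsum_pure; last by lin_tac.
    by rewrite (amul1r hA) PZ Pcounit PM mul_tsuml.
  rewrite [RHS]tsum_exch; apply: eq_tsum => a b.
  rewrite linearZ /= -P1 -Pcomul /ev2 [LHS]mulrC mul_tsumr; apply: eq_tsum => c d.
  by rewrite mulrA.
- move=> x; apply: (pairing_sep P_inj) => h; rewrite !P_tsum.
  transitivity (P x (\tsum_(a, b <- Δ h) (T b ** a))).
    rewrite P_tsumr.
    transitivity (\tsum_(y, z <- comul D x) \tsum_(a, b <- Δ h) (P z a * P y (T b) : k^o)).
      by apply: eq_tsum => y z; rewrite PM; apply: eq_tsum => a b; rewrite PS.
    rewrite tsum_exch; apply: eq_tsum => a b; rewrite -Pcomul.
    by apply: eq_tsum => y z; rewrite mulrC.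
  rewrite T2 P_tsumr tsum_mul; last by lin_tac.
  rewrite tsum_pure; last by lin_tac.
  transitivity (\tsum_(a, b <- comul D (aone D)) \tsum_(c, d <- Δ e) (P b c * P x d * P a h :
    k^o)); last first.
    apply: eq_tsum => a b.
    by rewrite (amul1l hA) PZ Pcounit PM mul_tsuml.
  rewrite [RHS]tsum_exch; apply: eq_tsum => a b.
  rewrite linearZ /= -P1 -Pcomul /ev2 [LHS]mulrC mul_tsumr; apply: eq_tsum => c d.
  by rewrite mulrA mulrC mulrA.
- move=> x; apply: (pairing_sep P_inj) => h; rewrite PS -T3 P_tsum P_tsumr.
  transitivity (\tsum_(y, z <- comul D x) \tsum_(a, b <- Δ h) \tsum_(c, d <- Δ b)
    \tsum_(p, q <- comul D y) (P z (T a) * (P q c * P p (T d)) : k^o)).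
    apply: eq_tsum => y z; rewrite P_tsum.
    transitivity (\tsum_(p, q <- comul D y) \tsum_(a, b <- Δ h) \tsum_(c, d <- Δ b) (P z (T a) *
      (P q c * P p (T d)) : k^o)).
      apply: eq_tsum => p q; rewrite PM; apply: eq_tsum => a b; rewrite PS PM mul_tsumr.
      by apply: eq_tsum => c d; rewrite PS.
    by rewrite tsum_exch; apply: eq_tsum => a b; rewrite tsum_exch.
  rewrite tsum_exch; apply: eq_tsum => a b; rewrite P_tsumr.
  rewrite tsum_exch; apply: eq_tsum => c d.
  rewrite -Pcomul /ev2; apply: eq_tsum => y z.
  rewrite -Pcomul /ev2 mul_tsuml; apply: eq_tsum => p q.
  by rewrite [LHS]mulrC [in LHS](mulrC (P q c : k)).
Qed.

End SkewDual.

(** * Functions, matrix units and the pairing of D with H *)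

Section Delta.
Variable k : fieldType.

Lemma lin_ffun (I : finType) (V : lmodType k) (f : V -> {ffun I -> k^o}) i :
  lin f -> lin (fun x => f x i : k^o).
Proof. by move=> fl a x y; rewrite fl !ffunE. Qed.

Lemma lin_ffunE (I : finType) (V : lmodType k) (f : V -> I -> k^o) :
  (forall i, lin (fun x => f x i)) -> lin (fun x => [ffun i => f x i] : {ffun I -> k^o}).
Proof. by move=> fl a x y; apply/ffunP => i; rewrite !ffunE fl. Qed.

Lemma lin_ffunx (I : finType) i : lin (fun f : {ffun I -> k^o} => f i : k^o).
Proof. by apply: lin_ffun; apply: lin_id. Qed.

Lemma sum_eq_l (I : finType) (X : lmodType k) (F : I -> X) i :
  \sum_j (j == i)%:R *: F j = F i.
Proof.
rewrite (bigD1 i) //= eqxx scale1r big1 ?addr0 // => j /negbTE->.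
by rewrite scale0r.
Qed.

Lemma sum_eq_r (I : finType) (X : lmodType k) (F : I -> X) i :
  \sum_j (i == j)%:R *: F j = F i.
Proof. by under eq_bigr do rewrite eq_sym; rewrite sum_eq_l. Qed.

Lemma deltaE (I : finType) (i j : I) : delta k i j = (j == i)%:R.
Proof. by rewrite ffunE. Qed.

Lemma sum_delta (I : finType) (f : {ffun I -> k^o}) :
  f = \sum_i f i *: delta k i.
Proof.
apply/ffunP => j; rewrite sum_ffunE -[LHS](sum_eq_r (fun i => f i)).
by apply: eq_bigr => i _; rewrite [RHS]ffunE deltaE [LHS]mulrC.
Qed.

Section Map.
Variable I : finType.

Lemma map_mulE (f g : {ffun I -> k^o}) :
  f *[map_alg k I] g = [ffun i => f i * g i].
Proof.
rewrite /Defs.mul tlin_pure //; split=> h; apply: lin_ffunE => i.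
  by apply: lin_mull; apply: lin_ffunx.
by apply: lin_mulr; apply: lin_ffunx.
Qed.

End Map.

Variable T : finZmodType.
Local Notation A := {ffun T -> k^o}.
Local Notation E := (munit k).

Lemma munitE (l m : T) f : E l m f = f m *: delta k l.
Proof. by rewrite linfunE //; apply: lin_scalel; apply: lin_ffunx. Qed.

Lemma mcoef_munit (l m a b : T) : mcoef (E l m) a b = (a == l)%:R * (b == m)%:R.
Proof. by rewrite /mcoef munitE deltaE [LHS]ffunE deltaE [LHS]mulrC (eq_sym m). Qed.

Lemma lin_mcoef (V : lmodType k) (f : V -> 'End(A)) (l m : T) : lin f -> lin (fun x
    => mcoef (f x) l m).
Proof. by move=> fl; rewrite /mcoef; apply: lin_ffun; lin_tac. Qed.

Lemma lin_mcoefx (l m : T) : lin (fun M : 'End(A) => mcoef M l m).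
Proof. by apply: lin_mcoef; apply: lin_id. Qed.

Lemma sum_munit (M : 'End(A)) : M = \sum_l \sum_m mcoef M l m *: E l m.
Proof.
apply/lfunP => f; rewrite {1}(sum_delta f) linear_sum sum_lfunE.
under [RHS]eq_bigr => l _ do rewrite sum_lfunE.
rewrite [RHS]exchange_big; apply: eq_bigr => m _ /=.
rewrite linearZ /= {1}(sum_delta (M (delta k m))) scaler_sumr.
apply: eq_bigr => l _; rewrite lfunE /= munitE !scalerA; congr (_ *: _).
by rewrite mulrC.
Qed.

Lemma end_mulE (M N : 'End(A)) : M *[end_whopf k T] N = (M \o N)%VF.
Proof.
rewrite /Defs.mul tlin_pure //; split=> K a x y; apply/lfunP => f.
  by do ?rewrite lfunE /=.
by do ?rewrite lfunE /=; rewrite linearP.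
Qed.

Lemma munitM (a b c d : T) :
  E a b *[end_whopf k T] E c d = (b == c)%:R *: E a d.
Proof.
rewrite end_mulE; apply/lfunP => f.
rewrite lfunE /= [RHS]lfunE /= !munitE [X in X *: _]ffunE deltaE scalerA.
by rewrite [X in X *: _]mulrC.
Qed.

Lemma end_one : aone (end_whopf k T) = \sum_l E l l.
Proof.
rewrite /= [LHS]sum_munit; apply: eq_bigr => l _.
rewrite -[RHS](sum_eq_r (fun m => E l m)); apply: eq_bigr => m _.
by rewrite /mcoef lfunE /= deltaE.
Qed.

Lemma sum_mcoef (X : lmodType k) (F : T -> T -> X) a b :
  \sum_l \sum_m mcoef (E a b) l m *: F l m = F a b.
Proof.
rewrite -[RHS](sum_eq_l (fun l => F l b)); apply: eq_bigr => l _.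
rewrite -[in RHS](sum_eq_l (fun m => F l m)) scaler_sumr; apply: eq_bigr => m _.
by rewrite mcoef_munit scalerA.
Qed.

Lemma end_comul (a b : T) : comul (end_whopf k T) (E a b) = E a b ⊗ E a b.
Proof.
rewrite linfunE ?sum_mcoef //; do 2!apply: lin_sum => ?.
by apply: lin_scalel; apply: lin_mcoefx.
Qed.

Lemma end_counit (a b : T) : counit (end_whopf k T) (E a b) = 1.
Proof.
rewrite linfunE.
  rewrite -[RHS](sum_mcoef (fun _ _ => 1 : k^o) a b).
  by do 2!(apply: eq_bigr => ? _); rewrite [RHS]mulr1.
by do 2!apply: lin_sum => ?; apply: lin_mcoefx.
Qed.

Lemma end_antipode (a b : T) : antipode (end_whopf k T) (E a b) = E b a.
Proof.
rewrite linfunE ?(sum_mcoef (fun a b => E b a)) //; do 2!apply: lin_sum => ?.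
by apply: lin_scalel; apply: lin_mcoefx.
Qed.

Lemma end_is_algebra : is_algebra (end_whopf k T).
Proof.
split=> [x y z|x|x]; rewrite !end_mulE; first by rewrite comp_lfunA.
- exact: comp_lfun1l.
- exact: comp_lfun1r.
Qed.

Lemma map_comul_delta (r : T) :
  comul (map_whopf k T) (delta k r) = \sum_l \sum_m (l + m == r)%:R *: (delta k l ⊗ delta k m).
Proof.
rewrite linfunE; last by do 2!apply: lin_sum => ?; apply: lin_scalel; apply: lin_ffunx.
by do 2!(apply: eq_bigr => ? _); rewrite deltaE.
Qed.

Lemma map_counit_delta (r : T) : counit (map_whopf k T) (delta k r) = (r == 0)%:R.
Proof. by rewrite linfunE ?deltaE 1?eq_sym //; apply: lin_ffunx. Qed.

Lemma map_antipode_delta (r : T) : antipode (map_whopf k T) (delta k r) = delta k (- r).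
Proof.
rewrite linfunE.
  by apply/ffunP => l; rewrite ffunE !deltaE eqr_oppLR.
by apply: lin_ffunE => l; apply: lin_ffunx.
Qed.

End Delta.

Section Minid.
Variables (k : fieldType) (T : finZmodType) (U : vectType k) (HU : whopf_data U).
Variable iota : 'Hom({ffun T -> k^o}, U).
Hypothesis hA : is_morphism (map_whopf k T) HU iota.
Local Notation "x ** y" := (Defs.mul (walg HU) x y) (at level 40, left associativity).
Local Notation P := (minid iota).

Lemma minidM l m : P l ** P m = (l == m)%:R *: P l.
Proof.
rewrite /minid -(morM hA) map_mulE -linearZ /=; congr (iota _).
apply/ffunP => j; rewrite [LHS]ffunE !deltaE [RHS]ffunE deltaE.
by case: (eqVneq j l) => [->|_]; [rewrite mul1r [RHS]mulr1|rewrite mul0r [RHS]mulr0].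
Qed.

Lemma sum_minid : \sum_m P m = aone HU.
Proof.
rewrite /minid -linear_sum -(mor1 hA); congr (iota _); apply/ffunP => j.
rewrite sum_ffunE ffunE (bigD1 j) //= deltaE eqxx big1 ?addr0 // => i /negbTE ij.
by rewrite deltaE eq_sym ij.
Qed.

Lemma comul_minid r : comul HU (P r) = \sum_l \sum_m (l + m == r)%:R *: (P l ⊗ P m).
Proof.
rewrite /minid (mor_comul hA) map_comul_delta linear_sum; apply: eq_bigr => l _.
rewrite linear_sum; apply: eq_bigr => m _; rewrite linearZ /= tmapE //; lin_tac.
Qed.

Lemma counit_minid r : counit HU (P r) = (r == 0)%:R.
Proof. by rewrite /minid (mor_counit hA) map_counit_delta. Qed.

Lemma antipode_minid r : antipode HU (P r) = P (- r).
Proof. by rewrite /minid -(mor_antipode hA) map_antipode_delta. Qed.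

End Minid.

Section HspExt.
Variables (k : fieldType) (T : finZmodType) (U : vectType k).
Local Notation E := (munit k).

(** Matrix units times elements of U span H. *)
Lemma Hsp_ext (X : lmodType k) (L R : Hsp T U -> X) : lin L -> lin R ->
  (forall n1 n2 u, L (E n1 n2 ⊗ u) = R (E n1 n2 ⊗ u)) -> forall h, L h = R h.
Proof.
move=> Ll Rl LR; apply: tens_ext => // M u; rewrite [M]sum_munit.
pose Lu M := L (M ⊗ u); pose Ru M := R (M ⊗ u).
have Lul : lin Lu by rewrite /Lu; lin_tac.
have Rul : lin Ru by rewrite /Ru; lin_tac.
rewrite -/(Lu _) -/(Ru _) !(lin_bigsum Lul) !(lin_bigsum Rul); apply: eq_bigr => l _.
rewrite !(lin_bigsum Lul) !(lin_bigsum Rul); apply: eq_bigr => m _.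
by rewrite (linZ Lul) (linZ Rul) /Lu LR.
Qed.

End HspExt.

Section Pairing.
Variables (k : fieldType) (T : finZmodType) (U : vectType k).
Local Notation E := (munit k).
Local Notation H := (Hsp T U).
Local Notation D := (Dsp T U).
Local Notation U' := 'Hom(U, k^o).
Local Notation Eu n1 n2 u := (E n1 n2 ⊗ u : H).
Local Notation pm := (pairing_map T U).

Let pair_lin (f : {ffun T * T -> k^o}) (x : U') :
  bilin (fun (M : 'End({ffun T -> k^o})) (u : U) => (\sum_l f l * mcoef M l.1 l.2) * x u : k^o).
Proof.
split=> [u|M]; last by lin_tac.
by apply: lin_mull; apply: lin_sum => l; apply: lin_mulr; apply: lin_mcoefx.
Qed.

Let pair_lin' (h : H) :
  bilin (fun (f : {ffun T * T -> k^o}) (x : U') =>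
    \tsum_(M, u <- h) ((\sum_l f l * mcoef M l.1 l.2) * x u : k^o)).
Proof.
split=> [x|f]; last by lin_tac.
apply: lin_tsumr => M u; apply: lin_mull; apply: lin_sum => l; apply: lin_mull.
exact: lin_ffunx.
Qed.

Lemma pairing_bilin : bilin (@pairing k T U).
Proof. by split=> [h|d]; rewrite /pairing; lin_tac. Qed.

Lemma pairing_mapE d h : pm d h = pairing d h.
Proof.
have pl := pairing_bilin.
rewrite linfunE; first by rewrite linfunE //; lin_tac.
by move=> a x y; apply/lfunP => g; rewrite !lfunE /= lfunE /= !linfunE; try lin_tac; rewrite pl.1.
Qed.

Lemma pairing_pure f x n1 n2 u : pm (f ⊗ x) (Eu n1 n2 u) = f (n1, n2) * x u.
Proof.
rewrite pairing_mapE /pairing tsum_pure // tsum_pure //; congr (_ * _).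
rewrite -[RHS](sum_eq_l (fun l => f l : k^o)); apply: eq_bigr => -[a b] _.
by rewrite mcoef_munit /GRing.scale /= [RHS]mulrC xpair_eqE -natrM mulnb.
Qed.

Definition restr_unit (phi : 'Hom(H, k^o)) l : U' := linfun (fun u : U => phi (Eu l.1 l.2 u)).

Lemma restr_unitE phi l u : restr_unit phi l u = phi (Eu l.1 l.2 u).
Proof. by rewrite linfunE //; lin_tac. Qed.

(** The inverse of the pairing: coefficients of a functional along the matrix
    units. *)
Definition unpair (phi : 'Hom(H, k^o)) : D := \sum_l delta k l ⊗ restr_unit phi l.

Lemma unpair_lin : lin unpair.
Proof.
apply: lin_sum => l; apply: lin_tensr => a f g; apply/lfunP => u.
by rewrite add_lfunE scale_lfunE !restr_unitE add_lfunE scale_lfunE.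
Qed.

Lemma unpairK phi : pm (unpair phi) = phi.
Proof.
apply/lfunP; apply: Hsp_ext; [lin_tac|lin_tac|] => n1 n2 u.
rewrite lfun_sum sum_lfunE -[RHS](sum_eq_r (fun l => phi (Eu l.1 l.2 u) : k^o) (n1, n2)).
by apply: eq_bigr => l _; rewrite pairing_pure deltaE restr_unitE.
Qed.

Lemma pairK d : unpair (pm d) = d.
Proof.
have ul := unpair_lin.
move: d; apply: tens_ext; [lin_tac|lin_tac|] => f x.
rewrite {2}(sum_delta f) tens_suml; apply: eq_bigr => -[a b] _.
rewrite tensZl -tensZr; congr (_ ⊗ _); apply/lfunP => u.
by rewrite restr_unitE pairing_pure scale_lfunE.
Qed.

Lemma pairing_map_inj : injective pm. Proof. exact: can_inj pairK. Qed.

Lemma pairing_map_bij : bijective pm.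
Proof. by exists unpair; [exact: pairK|exact: unpairK]. Qed.

Lemma D_ext x y : (forall n1 n2 u, pm x (Eu n1 n2 u) = pm y (Eu n1 n2 u)) -> x = y.
Proof.
by move=> xy; apply: pairing_map_inj; apply/lfunP; apply: Hsp_ext => //; lin_tac.
Qed.

Lemma dual_mulE (V : vectType k) (C : coalgebra V) (phi psi : 'Hom(V, k^o)) h :
  (phi *[dual_alg C] psi) h = \tsum_(a, b <- comul C h) (phi a * psi b : k^o).
Proof.
rewrite /Defs.mul tlin_pure; first by rewrite linfunE //; lin_tac.
split=> z a x y; apply/lfunP => v; rewrite add_lfunE scale_lfunE !linfunE; try lin_tac.
  have L : lin (fun x : 'Hom(V, k^o) => \tsum_(a, b <- comul C v) (x a * z b : k^o)) by lin_tac.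
  exact: L.
have L : lin (fun x : 'Hom(V, k^o) => \tsum_(a, b <- comul C v) (z a * x b : k^o)) by lin_tac.
exact: L.
Qed.

Lemma op_mulE (V : vectType k) (G : whopf_data V) x y : x *[op_whopf G] y = y *[G] x.
Proof. by rewrite [LHS]/Defs.mul tlin_pure //; lin_tac. Qed.

Lemma ev2_dual (V : vectType k) (A : algebra V) (phi : 'Hom(V, k^o)) h g :
  @ev2 k V 'Hom(V, k^o) (\1%VF : 'End('Hom(V, k^o))) h g (comul (dual_coalg A) phi) =
    phi (h *[A] g).
Proof.
have el := @ev2_lin k V 'Hom(V, k^o) (\1%VF : 'End('Hom(V, k^o))) h g.
rewrite linfunE; last by do 2!apply: lin_sum => ?; lin_tac.
rewrite (lin_bigsum el) [h in RHS]sum_bcovec (lin_bigsum (f := fun s => phi (s *[A] g)));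
  last by lin_tac.
apply: eq_bigr => i _; rewrite (lin_bigsum el) (linZ (f := fun s => phi (s *[A] g)));
  last by lin_tac.
rewrite [g in RHS]sum_bcovec (lin_bigsum (f := fun s => phi (_ *[A] s))); last by lin_tac.
rewrite scaler_sumr; apply: eq_bigr => j _.
rewrite (linZ el) /ev2 tsum_pure; last by lin_tac.
rewrite (linZ (f := fun s => phi (_ *[A] s))); last by lin_tac.
by rewrite !lfunE /= scalerA [LHS]mulrC.
Qed.

End Pairing.

(** * The twisted family of coproducts of U *)

Section Inverse.
Variables (k : fieldType) (V : vectType k) (A : algebra V).
Hypothesis hA : is_algebra A.

Lemma linfun_mul x y : linfun (fun y : V => x *[A] y) y = x *[A] y.
Proof. by rewrite linfunE //; lin_tac. Qed.

Lemma ainv_uniq x y : x *[A] y = aone A -> y *[A] x = aone A -> ainv A x = y.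
Proof.
move=> xy yx; rewrite /ainv -xy -linfun_mul lker0_lfunK //.
apply/lker0P => a b; rewrite !linfun_mul => xab.
by rewrite -[a](amul1l hA) -yx -(amulA hA) xab (amulA hA) yx amul1l.
Qed.

Lemma mulxV x : invertible A x -> x *[A] ainv A x = aone A.
Proof. by case=> y [xy yx]; rewrite (ainv_uniq xy yx). Qed.

Lemma mulVx x : invertible A x -> ainv A x *[A] x = aone A.
Proof. by case=> y [xy yx]; rewrite (ainv_uniq xy yx). Qed.

(** In finite dimension multiplication by y is injective, hence surjective. *)
Lemma invertible_left x y : x *[A] y = aone A -> invertible A y.
Proof.
move=> xy; exists x; split=> //.
have inj : lker (linfun (fun z : V => y *[A] z)) == 0%VS.
  apply/lker0P => a b; rewrite !linfun_mul => yab.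
  by rewrite -[a](amul1l hA) -xy -(amulA hA) yab (amulA hA) xy amul1l.
have yK := lker0_lfunVK inj (aone A); rewrite linfun_mul in yK.
move: yK; set z := (X in _ *[A] X) => yz.
by have <- : z = x by rewrite -[z](amul1l hA) -xy -(amulA hA) yz amul1r.
Qed.
End Inverse.

Lemma tassocM (k : fieldType) (U V W : vectType k) (A : algebra U) (B : algebra V) (C :
    algebra W) s t :
  tassoc U V W (s *[tens_alg A (tens_alg B C)] t) =
  tassoc U V W s *[tens_alg (tens_alg A B) C] tassoc U V W t.
Proof.
move: s; apply: tens_ext; [lin_tac|lin_tac|] => a s.
move: s; apply: tens_ext; [lin_tac|lin_tac|] => b c.
move: t; apply: tens_ext; [lin_tac|lin_tac|] => a' t.
move: t; apply: tens_ext; [lin_tac|lin_tac|] => b' c'.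
by rewrite !mul_tens !tassocE !mul_tens.
Qed.

Lemma tmapM (k : fieldType) (V W V' W' : vectType k) (A : algebra V) (B : algebra W)
    (A' : algebra V') (B' : algebra W') (f : V -> V') (g : W -> W') s t :
  lin f -> lin g ->
  (forall x y, f (x *[A] y) = f x *[A'] f y) -> (forall x y, g (x *[B] y) = g x *[B'] g y) ->
  tmap f g (s *[tens_alg A B] t) = tmap f g s *[tens_alg A' B'] tmap f g t.
Proof.
move=> fl gl fM gM.
move: s; apply: tens_ext; [lin_tac|lin_tac|] => a b.
move: t; apply: tens_ext; [lin_tac|lin_tac|] => a' b'.
by rewrite mul_tens !tmapE // mul_tens fM gM.
Qed.

Section Dynamical.
Variables (k : fieldType) (T : finZmodType) (U : vectType k) (HU : whopf_data U).
Variables (iota : 'Hom({ffun T -> k^o}, U)) (J : T -> tens U U).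
Hypotheses (hU : hopf HU) (hA : is_morphism (map_whopf k T) HU iota).
Hypothesis hJ : dynamical_twist HU iota J.

Local Notation "x ** y" := (Defs.mul (walg HU) x y) (at level 40, left associativity).
Local Notation P := (minid iota).
Local Notation Δ := (comul (wcoalg HU)).
Local Notation ε := (counit (wcoalg HU)).
Local Notation e := (aone (walg HU)).
Local Notation S := (antipode HU).
Local Notation UU := (tens_alg (walg HU) (walg HU)).
Local Notation UUU := (tens_alg UU (walg HU)).
Local Notation Ji := (Jinv HU J).
Local Notation "x °° y" := (Defs.mul UU x y) (at level 40, left associativity).

Let mA := amulA (hopf_alg hU).
Let m1l := amul1l (hopf_alg hU).
Let m1r := amul1r (hopf_alg hU).
Let hC := hopf_coalg hU.
Let hUU : is_algebra UU := tens_is_algebra (hopf_alg hU) (hopf_alg hU).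
Let hUUU : is_algebra UUU := tens_is_algebra hUU (hopf_alg hU).

Lemma twistK l : J l °° Ji l = e ⊗ e.
Proof. exact: (mulxV hUU (twist_inv hJ l)). Qed.

Lemma twistVK l : Ji l °° J l = e ⊗ e.
Proof. exact: (mulVx hUU (twist_inv hJ l)). Qed.

Lemma Jinv_weight l r : Ji l °° Δ (P r) = Δ (P r) °° Ji l.
Proof.
rewrite -[LHS](amul1r hUU) -[aone UU]/(e ⊗ e) -(twistK l) !(amulA hUU).
rewrite -(amulA hUU (Ji l)) -(twist_weight hJ) (amulA hUU (Ji l)) twistVK.
by rewrite (amul1l hUU).
Qed.

(** The coproduct of U twisted by J at both ends: E_(n1,n2) u has [dcomul n1 n2 u]
    as the U-part of its coproduct in H_J. *)
Definition dcomul n1 n2 (u : U) : tens U U := Ji n1 °° Δ u °° J n2.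
Local Notation W := dcomul.

Lemma dcomulM n1 n2 n3 u v : W n1 n2 u °° W n2 n3 v = W n1 n3 (u ** v).
Proof.
rewrite /W hopf_comulM // !(amulA hUU); congr (_ °° _).
rewrite -!(amulA hUU); congr (_ °° _); congr (_ °° _).
by rewrite (amulA hUU) twistK (amul1l hUU).
Qed.

Lemma dcomul1 n : W n n e = e ⊗ e.
Proof. by rewrite /W hopf_comul1 // -[e ⊗ e]/(aone UU) (amul1r hUU) twistVK. Qed.

Lemma dcomul_minidl n1 n2 r u : W n1 n2 (P r ** u) = Δ (P r) °° W n1 n2 u.
Proof.
by rewrite /W hopf_comulM // !(amulA hUU) Jinv_weight.
Qed.

Lemma dcomul_minidr n1 n2 r u : W n1 n2 (u ** P r) = W n1 n2 u °° Δ (P r).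
Proof.
rewrite /W hopf_comulM // -!(amulA hUU); congr (_ °° _); congr (_ °° _).
by rewrite (twist_weight hJ).
Qed.

Lemma dcomul_lin n1 n2 : lin (dcomul n1 n2).
Proof. rewrite /dcomul; lin_tac. Qed.

(* Contracting a leg with the counit is multiplicative, so the counit condition
   passes from J to its inverse. *)
Let epsl t : U := \tsum_(a, b <- t) (ε a *: b).
Let epsr t : U := \tsum_(a, b <- t) (ε b *: a).

Let epslM s t : epsl (s °° t) = epsl s ** epsl t.
Proof.
rewrite /epsl; move: s; apply: tens_ext; [lin_tac|lin_tac|] => a b.
move: t; apply: tens_ext; [lin_tac|lin_tac|] => c d.
rewrite mul_tens !tsum_pure; try lin_tac.
rewrite hopf_counitM // (linZ (f := fun s => s ** _)); last by lin_tac.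
by rewrite (linZ (f := fun s => _ ** s)) ?scalerA //; lin_tac.
Qed.

Let epsrM s t : epsr (s °° t) = epsr s ** epsr t.
Proof.
rewrite /epsr; move: s; apply: tens_ext; [lin_tac|lin_tac|] => a b.
move: t; apply: tens_ext; [lin_tac|lin_tac|] => c d.
rewrite mul_tens !tsum_pure; try lin_tac.
rewrite hopf_counitM // (linZ (f := fun s => s ** _)); last by lin_tac.
by rewrite (linZ (f := fun s => _ ** s)) ?scalerA //; lin_tac.
Qed.

Let eps_ee : (epsl (e ⊗ e) = e) * (epsr (e ⊗ e) = e).
Proof.
by split; rewrite /epsl /epsr tsum_pure ?hopf_counit1 ?scale1r //; lin_tac.
Qed.

Lemma Jinv_counitl l : \tsum_(a, b <- Ji l) (ε a *: b) = e.
Proof. by have := epslM (J l) (Ji l); rewrite twistK eps_ee /epsl (twist_counitl hJ) m1l. Qed.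

Lemma Jinv_counitr l : \tsum_(a, b <- Ji l) (ε b *: a) = e.
Proof. by have := epsrM (J l) (Ji l); rewrite twistK eps_ee /epsr (twist_counitr hJ) m1l. Qed.

Lemma dcomul_counitl n1 n2 u : \tsum_(a, b <- W n1 n2 u) (ε a *: b) = u.
Proof.
rewrite -/(epsl _) /W !epslM {1}/epsl Jinv_counitl m1l /epsl (twist_counitl hJ) m1r.
exact: (counitl hC).
Qed.

Lemma dcomul_counitr n1 n2 u : \tsum_(a, b <- W n1 n2 u) (ε b *: a) = u.
Proof.
rewrite -/(epsr _) /W !epsrM {1}/epsr Jinv_counitr m1l /epsr (twist_counitr hJ) m1r.
exact: (counitr hC).
Qed.

(* The four factors of the cocycle equation: dl and dr apply the coproduct to a
   leg, sh is the shifted J(l + h^(3)) ⊗ 1, and em is 1 ⊗ J. All four are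
   multiplicative in J. *)
Let dl (s : tens U U) : tens (tens U U) U := tmap Δ id s.
Let dr (s : tens U U) : tens (tens U U) U := tassoc U U U (tmap id Δ s).

Let dlM s t : dl (s °° t) = dl s *[UUU] dl t.
Proof. by apply: tmapM => //; try lin_tac; apply: hopf_comulM. Qed.

Let drM s t : dr (s °° t) = dr s *[UUU] dr t.
Proof.
by rewrite /dr -tassocM; congr (tassoc _ _ _ _); apply: tmapM => //; try lin_tac;
  apply: hopf_comulM.
Qed.

Let dl1 : dl (e ⊗ e) = aone UUU.
Proof. by rewrite /dl tmapE ?hopf_comul1 //; lin_tac. Qed.

Let dr1 : dr (e ⊗ e) = aone UUU.
Proof. by rewrite /dr tmapE ?hopf_comul1 ?tassocE //; lin_tac. Qed.

Let sh (F : T -> tens U U) l : tens (tens U U) U := \sum_m F (l + m) ⊗ P m.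
Let em (s : tens U U) : tens (tens U U) U := tassoc U U U (e ⊗ s).

Let shM (F G : T -> tens U U) l : sh F l *[UUU] sh G l = sh (fun n => F n °° G n) l.
Proof.
rewrite /sh mul_suml; apply: eq_bigr => m _; rewrite mul_sumr.
under eq_bigr => n _ do rewrite mul_tens (minidM hA) tensZr.
by rewrite sum_eq_r.
Qed.

Let sh1 l : sh (fun _ => e ⊗ e) l = aone UUU.
Proof.
rewrite /sh -(lin_bigsum (f := fun s => (e ⊗ e) ⊗ s)); last by lin_tac.
by rewrite (sum_minid hA).
Qed.

Let eq_sh F G l : F =1 G -> sh F l = sh G l.
Proof. by move=> FG; apply: eq_bigr => m _; rewrite FG. Qed.

Let emM s t : em (s °° t) = em s *[UUU] em t.
Proof. by rewrite /em -tassocM mul_tens m1l. Qed.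

Let em1 : em (e ⊗ e) = aone UUU. Proof. by rewrite /em tassocE. Qed.

Let cocycle l : dl (J l) *[UUU] sh J l = dr (J l) *[UUU] em (J l).
Proof. exact: (twist_cocycle hJ). Qed.

Lemma cocycle_inv l : sh Ji l *[UUU] dl (Ji l) = em (Ji l) *[UUU] dr (Ji l).
Proof.
have h1 : (sh Ji l *[UUU] dl (Ji l)) *[UUU] (dl (J l) *[UUU] sh J l) = aone UUU.
  rewrite -(amulA hUUU) (amulA hUUU (dl (Ji l))) -dlM twistVK dl1 (amul1l hUUU) shM.
  by rewrite (eq_sh _ twistVK) sh1.
have h2 : (dr (J l) *[UUU] em (J l)) *[UUU] (em (Ji l) *[UUU] dr (Ji l)) = aone UUU.
  by rewrite -(amulA hUUU) (amulA hUUU (em (J l))) -emM twistK em1 (amul1l hUUU) -drM twistK dr1.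
by rewrite -[LHS](amul1r hUUU) -h2 (amulA hUUU) -cocycle h1 (amul1l hUUU).
Qed.

Lemma dcomul_coassocE n1 n2 u :
  sh Ji n1 *[UUU] dl (W n1 n2 u) *[UUU] sh J n2 =
  em (Ji n1) *[UUU] dr (W n1 n2 u) *[UUU] em (J n2).
Proof.
rewrite /W !dlM !drM -!(amulA hUUU) cocycle !(amulA hUUU) cocycle_inv.
rewrite -!(amulA hUUU); do 2!congr (_ *[UUU] _); congr (_ *[UUU] _).
exact: (comulA hC).
Qed.

(** The cocycle equation and its inverse conjugate the two iterated coproducts of
    u into each other; on the left the shifts by the weight of the third leg
    appear. *)
Lemma dcomul_coassoc (X : lmodType k) n1 n2 u (F : U -> U -> U -> X) : trilin F ->
  \sum_m \sum_m' \tsum_(a, b <- W n1 n2 u)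
    \tsum_(c, d <- W (n1 + m) (n2 + m') a) F c d (P m ** b ** P m') =
  \tsum_(a, b <- W n1 n2 u) \tsum_(c, d <- W n1 n2 b) F a c d.
Proof.
move=> Fl; pose G s f := \tsum_(a, b <- s) F a b f.
have Gl : bilin G by rewrite /G; lin_tac.
have Wl := dcomul_lin.
transitivity (tsum (sh Ji n1 *[UUU] dl (W n1 n2 u) *[UUU] sh J n2) G).
  rewrite {1}/sh mul_suml mul_suml (lin_bigsum (f := fun s => tsum s G)); last by lin_tac.
  apply: eq_bigr => m _; rewrite mul_sumr (lin_bigsum (f := fun s => tsum s G)); last by lin_tac.
  apply: eq_bigr => m' _; rewrite /dl.
  move: (W n1 n2 u); apply: tens_ext; [lin_tac|lin_tac|] => a b.
  rewrite tsum_pure; last by lin_tac.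
  by rewrite tmapE ?mul_tens ?tsum_pure //; lin_tac.
rewrite dcomul_coassocE /em /dr -!tassocM.
move: (W n1 n2 u); apply: tens_ext; [lin_tac|lin_tac|] => a b.
rewrite tmapE ?mul_tens; try lin_tac.
rewrite m1l m1r tsum_pure; last by lin_tac.
rewrite -/(W n1 n2 b) tsum_tassoc // tsum_pure; last by lin_tac.
by apply: eq_tsum => c d; rewrite /G tsum_pure //; lin_tac.
Qed.

(** The function K of D_J is K(l) = sum over m of [mulSJ (l - m)] P_m. *)
Definition mulSJ l : U := \tsum_(a, b <- J l) (S a ** b).
Local Notation Kbar := (KbarJ HU J).

Let chi (t : tens (tens U U) U) : U := \tsum_(s, c <- t) \tsum_(a, b <- s) (a ** S b ** c).

(** Apply x ⊗ y ⊗ z |-> x S(y) z to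
    (id ⊗ Δ)(J^-1) (Δ ⊗ id)(J) = (1 ⊗ J) (J(l + h^(3))^-1 ⊗ 1): the left side
    collapses to 1 by the antipode and counit axioms, and the right side is the
    sum. *)
Lemma sum_Kbar_mulSJ l : \sum_m Kbar (l + m) ** mulSJ l ** P m = e.
Proof.
have cl : lin chi by rewrite /chi; lin_tac.
transitivity (chi (em (J l) *[UUU] sh Ji l)).
  rewrite /sh mul_sumr (lin_bigsum cl); apply: eq_bigr => m _.
  rewrite /em /KbarJ /mulSJ.
  move: (Ji (l + m)); apply: tens_ext; [lin_tac|lin_tac|] => p q.
  move: (J l); apply: tens_ext; [lin_tac|lin_tac|] => a b.
  rewrite tassocE !mul_tens /chi !tsum_pure; try lin_tac.
  by rewrite m1l hopf_antipodeM // !mA.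
have -> : em (J l) *[UUU] sh Ji l = dr (Ji l) *[UUU] dl (J l).
  have drK : dr (Ji l) *[UUU] dr (J l) = aone UUU by rewrite -drM twistVK dr1.
  have shK : sh J l *[UUU] sh Ji l = aone UUU by rewrite shM (eq_sh _ twistK) sh1.
  rewrite -[LHS](amul1l hUUU) -drK -[RHS](amul1r hUUU) -shK.
  by rewrite -!(amulA hUUU); congr (_ *[UUU] _); rewrite !(amulA hUUU) cocycle.
transitivity (epsr (Ji l) ** epsl (J l)); last first.
  by rewrite /epsr /epsl Jinv_counitr (twist_counitl hJ) m1l.
rewrite /dr /dl /epsr /epsl.
move: (Ji l); apply: tens_ext; [lin_tac|lin_tac|] => p q.
move: (J l); apply: tens_ext; [lin_tac|lin_tac|] => r s.
rewrite !tmapE; try lin_tac.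
transitivity (\tsum_(r1, r2 <- Δ r) \tsum_(q1, q2 <- Δ q) (p ** (r1 ** S r2) ** (S q1 ** q2) **
  s)).
  move: (Δ q); apply: tens_ext; [lin_tac|lin_tac|] => q1 q2.
  rewrite tassocE.
  move: (Δ r); apply: tens_ext; [lin_tac|lin_tac|] => r1 r2.
  by rewrite !mul_tens /chi !tsum_pure ?hopf_antipodeM ?mA //; lin_tac.
rewrite tsum_exch.
transitivity (\tsum_(q1, q2 <- Δ q) (p ** (ε r *: e) ** (S q1 ** q2) ** s)).
  apply: eq_tsum => q1 q2.
  by rewrite -hopf_antipoder // (tsum_lin _ _ (g := fun x => p ** x ** _ ** s)) //; lin_tac.
rewrite -(tsum_lin _ _ (g := fun x => p ** (ε r *: e) ** x ** s)); last by lin_tac.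
rewrite hopf_antipodel // !tsum_pure; try lin_tac.
by do 3!rewrite ?mulZr ?mulZl ?m1r; rewrite !scalerA mulrC.
Qed.

Lemma Kbar_mulSJ l m : Kbar (l + m) ** mulSJ l ** P m = P m.
Proof.
rewrite -[RHS]m1l -(sum_Kbar_mulSJ l) mul_suml (bigD1 m) //= -[in RHS](mA _ (P m)) (minidM hA)
  eqxx scale1r.
rewrite big1 ?addr0 // => n /negbTE nm.
by rewrite -mA (minidM hA) nm scale0r (lin0 (f := fun x => _ ** x)) //; lin_tac.
Qed.

(* phi x and psi x compose along products of tensors, so the factors of dcomul
   can be contracted one at a time. *)
Let phi x t : U := \tsum_(a, b <- t) (S a ** x ** b).
Let psi x t : U := \tsum_(a, b <- t) (a ** x ** S b).

Let phiM x s t : phi x (s °° t) = phi (phi x s) t.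
Proof.
rewrite /phi; move: s; apply: tens_ext; [lin_tac|lin_tac|] => a b.
move: t; apply: tens_ext; [lin_tac|lin_tac|] => c d.
by rewrite mul_tens !tsum_pure ?hopf_antipodeM // ?mA //; lin_tac.
Qed.

Let psiM x s t : psi x (s °° t) = psi (psi x t) s.
Proof.
rewrite /psi; move: s; apply: tens_ext; [lin_tac|lin_tac|] => a b.
move: t; apply: tens_ext; [lin_tac|lin_tac|] => c d.
by rewrite mul_tens !tsum_pure ?hopf_antipodeM // ?mA //; lin_tac.
Qed.

Let phi_ee x : phi x (e ⊗ e) = x.
Proof. by rewrite /phi tsum_pure ?hopf_antipode1 ?m1l ?m1r //; lin_tac. Qed.

Let psi_ee x : psi x (e ⊗ e) = x.
Proof. by rewrite /psi tsum_pure ?hopf_antipode1 ?m1l ?m1r //; lin_tac. Qed.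

Let phi_J l : phi e (J l) = mulSJ l.
Proof. by apply: eq_tsum => a b; rewrite m1r. Qed.

Let psi_Ji l : psi e (Ji l) = Kbar l.
Proof. by apply: eq_tsum => a b; rewrite m1r. Qed.

Let phi_comul u : phi e (Δ u) = ε u *: e.
Proof. by rewrite -hopf_antipodel //; apply: eq_tsum => a b; rewrite m1r. Qed.

Let psi_comul u : psi e (Δ u) = ε u *: e.
Proof. by rewrite -hopf_antipoder //; apply: eq_tsum => a b; rewrite m1r. Qed.

Lemma dcomul_mulSJ n1 n2 u : \tsum_(a, b <- W n1 n2 u) (S a ** mulSJ n1 ** b) = ε u *: mulSJ n2.
Proof.
rewrite -/(phi _ _) /W !phiM -{1}phi_J -(phiM _ (J n1)) twistK phi_ee phi_comul -phi_J.
by rewrite /phi -tsumZ; apply: eq_tsum => a b; rewrite mulZr mulZl.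
Qed.

Lemma dcomul_Kbar n1 n2 u : \tsum_(a, b <- W n1 n2 u) (a ** Kbar n2 ** S b) = ε u *: Kbar n1.
Proof.
rewrite -/(psi _ _) /W !psiM -{1}psi_Ji -(psiM _ (J n2)) twistK psi_ee psi_comul -psi_Ji.
by rewrite /psi -tsumZ; apply: eq_tsum => a b; rewrite mulZr mulZl.
Qed.

(** Contracting J Δ(P_r) = Δ(P_r) J with S(a) b gives P_a κ P_c = 0 unless a = c. *)
Lemma mulSJ_minid l b : mulSJ l ** P b = P b ** mulSJ l.
Proof.
have PkP a c : P a ** mulSJ l ** P c = (a == c)%:R *: (P a ** mulSJ l).
  have := congr1 (fun t => P a ** phi e t) (twist_weight hJ l (delta k (c - a))).
  rewrite -[iota _]/(P (c - a)) !phiM phi_comul phi_J (counit_minid hA) subr_eq0 (eq_sym c).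
  have -> : phi ((a == c)%:R *: e) (J l) = (a == c)%:R *: mulSJ l.
    by rewrite -phi_J /phi -tsumZ; apply: eq_tsum => x y; rewrite mulZr mulZl.
  rewrite mulZr => <-; move: (mulSJ l) => K.
  have pl : lin (phi K) by rewrite /phi; lin_tac.
  rewrite (comul_minid hA) (lin_bigsum pl) mul_sumr.
  rewrite (bigD1 (- a)) //= [X in _ = _ + X]big1 ?addr0; last first.
    move=> d /negbTE da; rewrite (lin_bigsum pl) mul_sumr big1 // => d' _.
    rewrite (linZ pl) /phi tsum_pure; last by lin_tac.
    have ad : (a == - d) = false by rewrite eq_sym eqr_oppLR da.
    rewrite (antipode_minid hA) mulZr !mA (minidM hA) ad.
    by rewrite !mulZl scale0r scaler0.
  rewrite (lin_bigsum pl) mul_sumr (bigD1 c) //= [X in _ = _ + X]big1 ?addr0; last first.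
    move=> d /negbTE dc; rewrite (linZ pl) addrC (inj_eq (addIr _)) dc scale0r.
    by rewrite (lin0 (f := fun x => P a ** x)) //; lin_tac.
  rewrite (linZ pl) addrC eqxx scale1r /phi tsum_pure; last by lin_tac.
  by rewrite (antipode_minid hA) opprK !mA (minidM hA) eqxx scale1r.
rewrite -[LHS]m1l -(sum_minid hA) mul_suml (bigD1 b) //= mA PkP eqxx scale1r.
by rewrite big1 ?addr0 // => a /negbTE ab; rewrite mA PkP ab scale0r.
Qed.

End Dynamical.

(** * The weak bialgebra H_J *)

Section TwistedWeakHopf.
Variables (k : fieldType) (T : finZmodType) (U : vectType k) (HU : whopf_data U).
Variables (iota : 'Hom({ffun T -> k^o}, U)) (J : T -> tens U U).
Hypotheses (hU : hopf HU) (hA : is_morphism (map_whopf k T) HU iota).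
Hypothesis hJ : dynamical_twist HU iota J.

Local Notation "x ** y" := (Defs.mul (walg HU) x y) (at level 40, left associativity).
Local Notation P := (minid iota).
Local Notation Δ := (comul (wcoalg HU)).
Local Notation ε := (counit (wcoalg HU)).
Local Notation e := (aone (walg HU)).
Local Notation S := (antipode HU).
Local Notation UU := (tens_alg (walg HU) (walg HU)).
Local Notation Ji := (Jinv HU J).
Local Notation "x °° y" := (Defs.mul UU x y) (at level 40, left associativity).
Local Notation W := (dcomul HU J).
Local Notation E := (munit k).
Local Notation H0 := (H0 T HU).
Local Notation HJ := (HJ HU iota J).
Local Notation HH := (tens_alg (walg H0) (walg H0)).

Let mA := amulA (hopf_alg hU).
Let m1l := amul1l (hopf_alg hU).
Let m1r := amul1r (hopf_alg hU).
Let hUU : is_algebra UU := tens_is_algebra (hopf_alg hU) (hopf_alg hU).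
Let hEnd := end_is_algebra k T.
Let hH0 : is_algebra H0 := tens_is_algebra (end_is_algebra k T) (hopf_alg hU).

Local Notation "x *' y" := (Defs.mul (walg H0) x y) (at level 40, left associativity).
Local Notation Eu n1 n2 u := (E n1 n2 ⊗ u : Hsp T U).

(** Elements M a ⊗ N b of the tensor square of H; products separate into the
    matrix part and the U-part ([lift_tensM]). *)
Definition lift_tens (M N : 'End({ffun T -> k^o})) (t : tens U U) : tens (Hsp T U) (Hsp T U) :=
  \tsum_(a, b <- t) ((M ⊗ a : Hsp T U) ⊗ (N ⊗ b : Hsp T U)).

Lemma lift_tens_lin M N : lin (lift_tens M N). Proof. rewrite /lift_tens; lin_tac. Qed.

Lemma lift_tens_pure M N a b : lift_tens M N (a ⊗ b) = (M ⊗ a : Hsp T U) ⊗ (N ⊗ b : Hsp T U).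
Proof. by rewrite /lift_tens tsum_pure //; lin_tac. Qed.

Lemma lift_tensM M N M' N' s t : lift_tens M N s *[HH] lift_tens M' N' t =
  lift_tens (M *[end_whopf k T] M') (N *[end_whopf k T] N') (s °° t).
Proof.
have Tl := lift_tens_lin.
move: s; apply: tens_ext; [lin_tac|lin_tac|] => a b.
move: t; apply: tens_ext; [lin_tac|lin_tac|] => c d.
by rewrite mul_tens !lift_tens_pure !mul_tens.
Qed.

Lemma lift_tensZ c d M N t : lift_tens (c *: M) (d *: N) t = (c * d) *: lift_tens M N t.
Proof.
rewrite /lift_tens -tsumZ; apply: eq_tsum => a b.
rewrite (linZ (f := fun s => s ⊗ a)); last by lin_tac.
rewrite (linZ (f := fun s => s ⊗ b)); last by lin_tac.
rewrite (linZ (f := fun s => s ⊗ _)); last by lin_tac.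
by rewrite (linZ (f := fun s => _ ⊗ s)) ?scalerA //; lin_tac.
Qed.

Lemma FJE : FJ HU iota J = \sum_l \sum_m lift_tens (E l (l + m)) (E l l) (J l °° (e ⊗ P m)).
Proof.
apply: eq_bigr => l _; apply: eq_bigr => m _.
move: (J l); apply: tens_ext; [lin_tac|rewrite /lift_tens; lin_tac|] => a b.
by rewrite mul_tens lift_tens_pure m1r tsum_pure //; lin_tac.
Qed.

Lemma FbarJE : FbarJ HU iota J =
  \sum_l \sum_m lift_tens (E (l + m) l) (E l l) ((e ⊗ P m) °° Ji l).
Proof.
apply: eq_bigr => l _; apply: eq_bigr => m _.
move: (Ji l); apply: tens_ext; [lin_tac|rewrite /lift_tens; lin_tac|] => a b.
by rewrite mul_tens lift_tens_pure m1l tsum_pure //; lin_tac.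
Qed.

Lemma H0_comul n1 n2 u : comul H0 (E n1 n2 ⊗ u) = lift_tens (E n1 n2) (E n1 n2) (Δ u).
Proof.
rewrite tlin_pure; last by lin_tac.
by rewrite end_comul tsum_pure //; lin_tac.
Qed.

Lemma FbarJM n1 n2 n3 t : FbarJ HU iota J *[HH] lift_tens (E n1 n2) (E n1 n3) t =
  \sum_m lift_tens (E (n1 + m) n2) (E n1 n3) ((e ⊗ P m) °° Ji n1 °° t).
Proof.
rewrite FbarJE mul_suml.
rewrite -(sum_eq_l (fun l => \sum_m lift_tens (E (l + m) n2) (E l n3) ((e ⊗ P m) °° Ji l °° t))
  n1).
apply: eq_bigr => l _; rewrite mul_suml scaler_sumr; apply: eq_bigr => m _.
by rewrite lift_tensM !munitM lift_tensZ -natrM mulnb andbb.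
Qed.

Lemma FJM n1 n2 n3 t : lift_tens (E n1 n3) (E n2 n3) t *[HH] FJ HU iota J =
  \sum_m lift_tens (E n1 (n3 + m)) (E n2 n3) (t °° J n3 °° (e ⊗ P m)).
Proof.
rewrite FJE mul_sumr.
rewrite -(sum_eq_r (fun l => \sum_m lift_tens (E n1 (l + m)) (E n2 l) (t °° J l °° (e ⊗ P m)))
  n3).
apply: eq_bigr => l _; rewrite mul_sumr scaler_sumr; apply: eq_bigr => m _.
by rewrite lift_tensM !munitM lift_tensZ -natrM mulnb andbb (amulA hUU).
Qed.

(** Multiplying by Fbar and F selects the rows l = n1 and l = n2 of the
    sums over l, and the sums over the weights m remain. *)
Lemma HJ_comul n1 n2 u : comul HJ (E n1 n2 ⊗ u) =
  \sum_m \sum_m' lift_tens (E (n1 + m) (n2 + m')) (E n1 n2)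
    ((e ⊗ P m) °° W n1 n2 u °° (e ⊗ P m')).
Proof.
rewrite linfunE; last by lin_tac.
rewrite H0_comul FbarJM mul_suml; apply: eq_bigr => m _.
by rewrite FJM; apply: eq_bigr => m' _; rewrite /dcomul !(amulA hUU).
Qed.

Lemma tsum_lift_tens (X : lmodType k) M N t (F : Hsp T U -> Hsp T U -> X) : bilin F ->
  tsum (lift_tens M N t) F = \tsum_(a, b <- t) F (M ⊗ a) (N ⊗ b).
Proof. by move=> Fl; rewrite tsum_tsum; apply: eq_tsum => a b; rewrite tsum_pure. Qed.

Lemma sw_HJ_unit (X : lmodType k) n1 n2 u (F : Hsp T U -> Hsp T U -> X) : bilin F ->
  tsum (comul HJ (E n1 n2 ⊗ u)) F = \sum_m \sum_m' \tsum_(a, b <- W n1 n2 u)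
    F (E (n1 + m) (n2 + m') ⊗ a) (E n1 n2 ⊗ (P m ** b ** P m')).
Proof.
move=> Fl; rewrite HJ_comul (lin_bigsum (f := fun s => tsum s F)); last by lin_tac.
apply: eq_bigr => m _; rewrite (lin_bigsum (f := fun s => tsum s F)); last by lin_tac.
apply: eq_bigr => m' _; rewrite tsum_lift_tens //.
rewrite tsum_mul; last by lin_tac.
rewrite tsum_mul; last by lin_tac.
rewrite tsum_pure; last by lin_tac.
apply: eq_tsum => a b; rewrite tsum_pure; last by lin_tac.
by rewrite m1l m1r.
Qed.

Lemma HJ_mul_unit n1 n2 n3 n4 u v :
  (E n1 n2 ⊗ u : Hsp T U) *[HJ] (E n3 n4 ⊗ v) = (n2 == n3)%:R *: (E n1 n4 ⊗ (u ** v)).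
Proof.
rewrite mul_tens munitM (linZ (f := fun s => s ⊗ _)) //; lin_tac.
Qed.

Lemma HJ_counit_unit n1 n2 u : counit HJ (E n1 n2 ⊗ u) = ε u.
Proof. by rewrite tlin_pure ?end_counit ?[LHS]mul1r //; lin_tac. Qed.

Lemma HJ_one : aone HJ = \sum_l (E l l ⊗ e : Hsp T U).
Proof.
rewrite /= -[\1%VF]/(aone (end_whopf k T)) end_one (lin_bigsum (f := fun s => s ⊗ e)) //.
by lin_tac.
Qed.

Lemma sum_minid2 (X : lmodType k) (f : U -> X) x : lin f ->
  \sum_m \sum_m' f (P m ** x ** P m') = f x.
Proof.
move=> fl; rewrite -[x in RHS]m1l -[_ ** x]m1r -(sum_minid hA).
rewrite mul_suml mul_suml (lin_bigsum fl); apply: eq_bigr => m _.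
by rewrite mul_sumr (lin_bigsum fl).
Qed.

Lemma minid_proj m r x s m' : P m ** (P r ** x ** P s) ** P m' =
  ((m == r)%:R * (s == m')%:R) *: (P m ** x ** P s).
Proof.
rewrite !mA (minidM hA) !mulZl -!mA (minidM hA) !mulZr !scalerA !mA.
by [].
Qed.

Lemma counit_minid2 m m' x : ε (P m ** x ** P m') = (m == 0)%:R * (m' == 0)%:R * ε x.
Proof.
by rewrite !hopf_counitM // !(counit_minid hA) mulrAC.
Qed.

Lemma sum_eq_l2 (X : lmodType k) (F : T -> T -> X) a b :
  \sum_m \sum_m' ((m == a)%:R * (m' == b)%:R) *: F m m' = F a b.
Proof.
rewrite -(sum_eq_l (fun m => F m b)); apply: eq_bigr => m _.
by rewrite -[in RHS](sum_eq_l (fun m' => F m m')) scaler_sumr; apply: eq_bigr => m' _;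
  rewrite scalerA.
Qed.

Lemma sum_shift (X : lmodType k) (F : T -> T -> T -> T -> X) :
  \sum_r \sum_r' \sum_m \sum_m' F m m' (r - m) (r' - m') =
  \sum_m \sum_m' \sum_q \sum_q' F m m' q q'.
Proof.
under eq_bigr => r _ do rewrite exchange_big.
rewrite exchange_big; apply: eq_bigr => m _ /=.
under eq_bigr => r _ do rewrite exchange_big.
rewrite exchange_big; apply: eq_bigr => m' _ /=.
rewrite (reindex_inj (addIr m)); apply: eq_bigr => r _ /=.
rewrite (reindex_inj (addIr m')); apply: eq_bigr => r' _ /=.
by rewrite !addrK.
Qed.

Lemma comul_minid_projl r m : (e ⊗ P m) °° Δ (P r) = P (r - m) ⊗ P m.
Proof.
rewrite (comul_minid hA) mul_sumr -(sum_eq_l (fun l => P l ⊗ P m)).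
apply: eq_bigr => l _; rewrite mul_sumr.
rewrite (bigD1 m) //= big1 ?addr0; last first.
  by move=> n /negbTE nm; rewrite mulZr mul_tens (minidM hA) (eq_sym m n) nm tensZr scale0r
    scaler0.
by rewrite mulZr mul_tens (minidM hA) eqxx scale1r m1l (eq_sym l) subr_eq (eq_sym r).
Qed.

Lemma comul_minid_projr r m : Δ (P r) °° (e ⊗ P m) = P (r - m) ⊗ P m.
Proof.
rewrite (comul_minid hA) mul_suml -(sum_eq_l (fun l => P l ⊗ P m)).
apply: eq_bigr => l _; rewrite mul_suml.
rewrite (bigD1 m) //= big1 ?addr0; last first.
  by move=> n /negbTE nm; rewrite mulZl mul_tens (minidM hA) nm tensZr scale0r scaler0.
by rewrite mulZl mul_tens (minidM hA) eqxx scale1r m1r (eq_sym l) subr_eq (eq_sym r).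
Qed.

Lemma sw_proj (X : lmodType k) s t t' (F : U -> U -> X) : bilin F ->
  \tsum_(c, d <- s) F c (P t ** d ** P t') = tsum ((e ⊗ P t) °° s °° (e ⊗ P t')) F.
Proof.
move=> Fl; move: s; apply: tens_ext; [lin_tac|lin_tac|] => c d.
by rewrite !mul_tens !tsum_pure ?m1l ?m1r //; lin_tac.
Qed.

(** Zero weight converts the total weights r, r' of u into weights r - m, r' - m'
    of the first leg once the second leg has weights m, m'. *)
Lemma sw_dcomul_minid (X : lmodType k) n1 n2 r r' m m' u (F : U -> U -> X) : bilin F ->
  \tsum_(c, d <- W n1 n2 (P r ** u ** P r')) F c (P m ** d ** P m') =
  \tsum_(c, d <- W n1 n2 u) F (P (r - m) ** c ** P (r' - m')) (P m ** d ** P m').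
Proof.
move=> Fl; rewrite sw_proj // (dcomul_minidr hU hJ) (dcomul_minidl hU hJ).
move: (W n1 n2 u) => w; rewrite -!(amulA hUU) comul_minid_projr !(amulA hUU) comul_minid_projl.
move: w; apply: tens_ext; [lin_tac|lin_tac|] => c d.
by rewrite !mul_tens !tsum_pure //; lin_tac.
Qed.

(** Only the summand of [dcomul_coassoc] whose weights agree with the projections
    on the third leg survives. *)
Lemma dcomul_coassoc_proj (X : lmodType k) n1 n2 u m m' (F : U -> U -> U -> X) : trilin F ->
  \tsum_(a, b <- W n1 n2 u)
    \tsum_(c, d <- W (n1 + m) (n2 + m') a) F c d (P m ** b ** P m') =
  \tsum_(a, b <- W n1 n2 u) \tsum_(c, d <- W n1 n2 b) F a c (P m ** d ** P m').
Proof.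
move=> Fl; have Wl := dcomul_lin HU J.
rewrite -(dcomul_coassoc hU hA hJ n1 n2 u (F := fun a b c => F a b (P m ** c ** P m')));
  last by lin_tac.
rewrite -(sum_eq_l2 (fun r r' => \tsum_(a, b <- W n1 n2 u)
    \tsum_(c, d <- W (n1 + r) (n2 + r') a) F c d (P m ** b ** P m')) m m').
apply: eq_bigr => r _; apply: eq_bigr => r' _.
rewrite -tsumZ; apply: eq_tsum => a b; rewrite -tsumZ; apply: eq_tsum => c d.
rewrite minid_proj (linZ (f := F c d)); last by lin_tac.
by rewrite (eq_sym m); case: (eqVneq r m) => _; case: (eqVneq r' m') => [->|];
  rewrite ?mulr0 ?mul0r ?scale0r.
Qed.

(** In the coassociativity of Δ_J the two sides are indexed differently: total
    weights (r, r') of two legs on one side are the sums of their separate weights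
    on the other, which [sum_shift] reindexes. *)
Lemma HJ_is_coalgebra : is_coalgebra HJ.
Proof.
have Wl := dcomul_lin HU J.
split.
- move=> x; apply: comulA_of_sw; move: x; apply: Hsp_ext; [lin_tac|lin_tac|] => n1 n2 u.
  rewrite sw_HJ_unit; last by lin_tac.
  rewrite sw_HJ_unit; last by lin_tac.
  pose G (m m' q q' : T) (a c d : U) : tens (tens (Hsp T U) (Hsp T U)) (Hsp T U) :=
    ((E (n1 + m + q) (n2 + m' + q') ⊗ a : Hsp T U) ⊗
     (E (n1 + m) (n2 + m') ⊗ (P q ** c ** P q') : Hsp T U)) ⊗ (E n1 n2 ⊗ d : Hsp T U).
  have Gl m m' q q' : trilin (G m m' q q') by rewrite /G; lin_tac.
  transitivity (\sum_m \sum_m' \sum_q \sum_q'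
    \tsum_(a, b <- W n1 n2 u) \tsum_(c, d <- W n1 n2 b) G m m' q q' a c (P m ** d ** P m')).
    apply: eq_bigr => m _; apply: eq_bigr => m' _.
    under eq_tsum => a b do [rewrite sw_HJ_unit; last by lin_tac].
    rewrite tsum_sum; apply: eq_bigr => q _; rewrite tsum_sum; apply: eq_bigr => q' _.
    exact: (dcomul_coassoc_proj n1 n2 u m m' (Gl m m' q q')).
  apply/esym.
  under eq_bigr => r _ do under eq_bigr => r' _ do
    under eq_tsum => a b do [rewrite sw_HJ_unit; last by lin_tac].
  rewrite -(sum_shift (fun m m' q q' => \tsum_(a, b <- W n1 n2 u)
     \tsum_(c, d <- W n1 n2 b) G m m' q q' a c (P m ** d ** P m'))).
  apply: eq_bigr => r _; apply: eq_bigr => r' _; rewrite tsum_sum.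
  apply: eq_bigr => m _; rewrite tsum_sum; apply: eq_bigr => m' _.
  apply: eq_tsum => a b.
  rewrite (sw_dcomul_minid n1 n2 r r' m m' b (F := fun c d =>
     (E (n1 + r) (n2 + r') ⊗ a : Hsp T U) ⊗ (E (n1 + m) (n2 + m') ⊗ c :
       Hsp T U) ⊗ (E n1 n2 ⊗ d : Hsp T U)));
    last by lin_tac.
  by apply: eq_tsum => c d; rewrite /G -!addrA [m + _]addrC [m' + _]addrC !subrK.
- apply: Hsp_ext; [lin_tac|lin_tac|] => n1 n2 u.
  rewrite sw_HJ_unit; last by lin_tac.
  rewrite -(sum_minid2 (f := fun u => E n1 n2 ⊗ u)); last by lin_tac.
  apply: eq_bigr => m _; apply: eq_bigr => m' _.
  rewrite -[u in RHS](dcomul_counitl hU hJ n1 n2).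
  rewrite (tsum_lin _ _ (g := fun s => E n1 n2 ⊗ (P m ** s ** P m'))); last by lin_tac.
  apply: eq_tsum => a b; rewrite HJ_counit_unit.
  by rewrite (linZ (f := fun s => E n1 n2 ⊗ (P m ** s ** P m'))) //; lin_tac.
- apply: Hsp_ext; [lin_tac|lin_tac|] => n1 n2 u.
  rewrite sw_HJ_unit; last by lin_tac.
  rewrite -[u in RHS](dcomul_counitr hU hJ n1 n2).
  rewrite (tsum_lin _ _ (g := fun s => E n1 n2 ⊗ s)); last by lin_tac.
  transitivity (\tsum_(v, w <- W n1 n2 u) (E (n1 + 0) (n2 + 0) ⊗ (ε w *: v)));
    last by rewrite !addr0.
  rewrite -(sum_eq_l2 (fun m m' => \tsum_(v, w <- W n1 n2 u) E (n1 + m) (n2 + m') ⊗ (ε w *: v))).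
  apply: eq_bigr => m _; apply: eq_bigr => m' _.
  rewrite -tsumZ; apply: eq_tsum => a b; rewrite HJ_counit_unit counit_minid2.
  by rewrite tensZr scalerA.
Qed.

Lemma lift_tens_unitM m1 m2 m3 m4 n1 n2 n3 n4 s t :
  lift_tens (E m1 m2) (E n1 n2) s *[HH] lift_tens (E m3 m4) (E n3 n4) t =
  ((m2 == m3)%:R * (n2 == n3)%:R) *: lift_tens (E m1 m4) (E n1 n4) (s °° t).
Proof. by rewrite lift_tensM !munitM lift_tensZ. Qed.

Lemma sum_unit_idem : \sum_m' (e ⊗ P m') °° (e ⊗ P m') = e ⊗ e.
Proof.
under eq_bigr => m' _ do rewrite mul_tens m1l (minidM hA) eqxx scale1r.
by rewrite -tens_sumr (sum_minid hA).
Qed.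

Lemma HJ_comulM h g : comul HJ (h *[HJ] g) = comul HJ h *[HH] comul HJ g.
Proof.
have Wl := dcomul_lin HU J; have Tl := lift_tens_lin.
move: h; apply: Hsp_ext; [lin_tac|lin_tac|] => n1 n2 u.
move: g; apply: Hsp_ext; [lin_tac|lin_tac|] => n3 n4 v.
rewrite HJ_mul_unit lfunZ !HJ_comul mul_suml scaler_sumr; apply: eq_bigr => m _.
rewrite mul_suml scaler_sumr.
case: (eqVneq n2 n3) => [<-|/negbTE n23]; last first.
  apply: eq_bigr => m' _; rewrite scale0r; apply/esym.
  rewrite mul_sumr big1 // => p _; rewrite mul_sumr big1 // => p' _.
  by rewrite lift_tens_unitM n23 mulr0 scale0r.
under [RHS]eq_bigr => m' _ do rewrite mul_sumr.
rewrite [RHS](_ : _ = \sum_m' \sum_p \sum_p' (m' == p)%:R *: lift_tens (E (n1 + m) (n4 + p')) (E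
  n1 n4)
   ((e ⊗ P m °° W n1 n2 u °° (e ⊗ P m')) °° (e ⊗ P p °° W n2 n4 v °° (e ⊗ P p')))); last first.
  apply: eq_bigr => m' _; apply: eq_bigr => p _; rewrite mul_sumr; apply: eq_bigr => p' _.
  by rewrite lift_tens_unitM eqxx mulr1 (inj_eq (addrI n2)).
under [RHS]eq_bigr => m' _ do rewrite exchange_big.
rewrite exchange_big; apply: eq_bigr => p' _ /=.
under [RHS]eq_bigr => m' _ do rewrite sum_eq_r.
rewrite -(lin_bigsum (Tl _ _)) scale1r; congr (lift_tens _ _ _).
rewrite -(dcomulM hU hJ n1 n2 n4).
move: (W n1 n2 u) (W n2 n4 v) => w1 w2; rewrite !(amulA hUU).
under [RHS]eq_bigr => m' _ do rewrite !(amulA hUU) -(amulA hUU _ (e ⊗ P m') (e ⊗ P m')).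
rewrite -mul_suml -mul_suml -mul_sumr sum_unit_idem -[e ⊗ e]/(aone UU).
by rewrite (amul1r hUU).
Qed.

Lemma HJ_comul_diag n : comul HJ (E n n ⊗ e) =
  \sum_m ((E (n + m) (n + m) ⊗ e : Hsp T U) ⊗ (E n n ⊗ P m : Hsp T U)).
Proof.
have Tl := lift_tens_lin.
rewrite HJ_comul (dcomul1 hU hJ); apply: eq_bigr => m _.
rewrite -[RHS](sum_eq_r (fun m' => (E (n + m) (n + m') ⊗ e : Hsp T U) ⊗ (E n n ⊗ P m : Hsp T U))).
apply: eq_bigr => m' _.
by rewrite !mul_tens !m1r (minidM hA) tensZr (linZ (Tl _ _)) lift_tens_pure.
Qed.

Lemma HJ_comul1 : comul HJ (aone HJ) =
  \sum_n \sum_m ((E (n + m) (n + m) ⊗ e : Hsp T U) ⊗ (E n n ⊗ P m : Hsp T U)).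
Proof.
by rewrite HJ_one lfun_sum; apply: eq_bigr => n _; exact: HJ_comul_diag.
Qed.

Let comul2_one_term n m l q : tens (tens (Hsp T U) (Hsp T U)) (Hsp T U) :=
  ((E (l + q) (l + q) ⊗ e : Hsp T U) ⊗ (E l l ⊗ P q : Hsp T U)) ⊗ (E n n ⊗ P m : Hsp T U).

Let sum_comul2_one_term : \sum_n \sum_m \sum_q comul2_one_term n m (n + m) q =
  \sum_l \sum_q \sum_n \sum_m (l == n + m)%:R *: comul2_one_term n m l q.
Proof.
under [RHS]eq_bigr => l _ do rewrite exchange_big.
rewrite [RHS]exchange_big; apply: eq_bigr => n _ /=.
under [RHS]eq_bigr => l _ do rewrite exchange_big.
rewrite [RHS]exchange_big; apply: eq_bigr => m _ /=.
rewrite [RHS]exchange_big; apply: eq_bigr => q _ /=.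
by rewrite (sum_eq_l (fun l => comul2_one_term n m l q)).
Qed.

Let comul2_oneE : tmap (comul HJ) id (comul HJ (aone HJ)) = \sum_n \sum_m \sum_q comul2_one_term
    n m (n + m) q.
Proof.
rewrite HJ_comul1 lfun_sum; apply: eq_bigr => n _.
rewrite lfun_sum; apply: eq_bigr => m _.
by rewrite tmapE ?HJ_comul_diag ?tens_suml //; lin_tac.
Qed.

Let counit_shuffle_l (d d' x y u a b w : k) :
  x * (u * a) * (y * (d * d' * b * w)) = (d * d') * (x * (y * (u * (a * b) * w))).
Proof. ring. Qed.

Let counit_shuffle_r (d d' x y u a b w : k) :
  x * (u * (d * d' * b)) * (y * (a * w)) = (d * d') * (x * (y * (u * (a * b) * w))).
Proof. ring. Qed.

Lemma HJ_weak_bialgebra : weak_bialgebra HJ.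
Proof.
have Wl := dcomul_lin HU J.
have EM n1 n2 n3 n4 u v : counit HJ ((E n1 n2 ⊗ u : Hsp T U) *[HJ] (E n3 n4 ⊗ v)) =
  (n2 == n3)%:R * (ε u * ε v).
  rewrite HJ_mul_unit (linZ (f := fun s => counit HJ s)); last by lin_tac.
  by rewrite HJ_counit_unit (hopf_counitM hU).
split; [exact: hH0|exact: HJ_is_coalgebra|exact: HJ_comulM|..].
- move=> h g f.
  move: h; apply: Hsp_ext; [lin_tac|lin_tac|] => n1 n2 u.
  move: g; apply: Hsp_ext; [lin_tac|lin_tac|] => n3 n4 v.
  move: f; apply: Hsp_ext; [lin_tac|lin_tac|] => n5 n6 w.
  rewrite sw_HJ_unit; last by lin_tac.
  rewrite HJ_mul_unit mulZl (linZ (f := fun s => counit HJ s)); last by lin_tac.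
  rewrite EM (hopf_counitM hU).
  pose Q m m' := \tsum_(a, b <- W n3 n4 v)
    ((n2 == n3 + m)%:R *: ((n4 + m' *+ 0 == n5)%:R * (ε u * ε (ε a *: b) * ε w) : k^o)).
  transitivity (Q 0 0).
    rewrite /Q -(tsum_lin _ _ (g := fun s => _ *: (_ * (ε u * ε s * ε w) : k^o)));
      last by lin_tac.
    by rewrite (dcomul_counitl hU hJ) !addr0.
  rewrite -(sum_eq_l2 Q).
  apply: eq_bigr => m _; apply: eq_bigr => m' _; rewrite -tsumZ; apply: eq_tsum => a b.
  rewrite !EM counit_minid2 (linZ (f := fun s => ε s)) ?addr0; [apply/esym|lin_tac].
  exact: (counit_shuffle_l (m == 0)%:R (m' == 0)%:R (n2 == n3 + m)%:R (n4 == n5)%:R (ε u) (ε a)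
    (ε b) (ε w)).
- move=> h g f.
  move: h; apply: Hsp_ext; [lin_tac|lin_tac|] => n1 n2 u.
  move: g; apply: Hsp_ext; [lin_tac|lin_tac|] => n3 n4 v.
  move: f; apply: Hsp_ext; [lin_tac|lin_tac|] => n5 n6 w.
  rewrite sw_HJ_unit; last by lin_tac.
  rewrite HJ_mul_unit mulZl (linZ (f := fun s => counit HJ s)); last by lin_tac.
  rewrite EM (hopf_counitM hU).
  pose Q m m' := \tsum_(a, b <- W n3 n4 v)
    ((n2 == n3 + m *+ 0)%:R *: ((n4 + m' == n5)%:R * (ε u * ε (ε a *: b) * ε w) : k^o)).
  transitivity (Q 0 0).
    rewrite /Q -(tsum_lin _ _ (g := fun s => _ *: (_ * (ε u * ε s * ε w) : k^o)));
      last by lin_tac.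
    by rewrite (dcomul_counitl hU hJ) !addr0.
  rewrite -(sum_eq_l2 Q).
  apply: eq_bigr => m _; apply: eq_bigr => m' _; rewrite -tsumZ; apply: eq_tsum => a b.
  rewrite !EM counit_minid2 (linZ (f := fun s => ε s)) ?addr0; [apply/esym|lin_tac].
  exact: (counit_shuffle_r (m == 0)%:R (m' == 0)%:R (n2 == n3)%:R (n4 + m' == n5)%:R (ε u) (ε a)
    (ε b) (ε w)).
- rewrite comul2_oneE HJ_comul1 tens_suml mul_suml tens_sumr lfun_sum.
  rewrite [RHS](_ : _ = \sum_l \sum_q \sum_n \sum_m (l == n + m)%:R *: comul2_one_term n m l q);
    last first.
    apply: eq_bigr => l _; rewrite tens_suml mul_suml; apply: eq_bigr => q _.
    rewrite mul_sumr; apply: eq_bigr => n _; rewrite tens_sumr lfun_sum mul_sumr;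
      apply: eq_bigr => m _.
    rewrite tassocE !mul_tens !(amul1l hEnd) !(amul1r hEnd) munitM !m1r ?m1l tensZl tensZr tensZl.
    by case: (eqVneq l (n + m)) => [->|]; rewrite ?scale0r.
  exact: sum_comul2_one_term.
- rewrite comul2_oneE HJ_comul1 tens_suml mul_sumr tens_sumr lfun_sum.
  rewrite [RHS](_ : _ = \sum_l \sum_q \sum_n \sum_m (l == n + m)%:R *: comul2_one_term n m l q);
    last first.
    apply: eq_bigr => l _; rewrite tens_suml mul_sumr; apply: eq_bigr => q _.
    rewrite mul_suml; apply: eq_bigr => n _; rewrite tens_sumr lfun_sum mul_suml;
      apply: eq_bigr => m _.
    rewrite tassocE !mul_tens !(amul1l hEnd) !(amul1r hEnd) munitM !m1r ?m1l tensZl tensZr tensZl.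
    by rewrite (eq_sym l); case: (eqVneq (n + m) l) => [->|]; rewrite ?scale0r.
  exact: sum_comul2_one_term.
Qed.

(** * The antipode of H_J *)

Local Notation κ := (mulSJ HU J).
Local Notation Kbar := (KbarJ HU J).

Lemma H0_mul_unit n1 n2 n3 n4 u v :
  Eu n1 n2 u *' Eu n3 n4 v = (n2 == n3)%:R *: Eu n1 n4 (u ** v).
Proof. by rewrite mul_tens munitM tensZl. Qed.

Lemma vJE : vJ HU iota J = \sum_l \sum_m Eu (l + m) l (κ l ** P m).
Proof.
rewrite /vJ FJE // (lin_bigsum (f := fun s => tsum s _)); last by lin_tac.
apply: eq_bigr => l _; rewrite (lin_bigsum (f := fun s => tsum s _)); last by lin_tac.
apply: eq_bigr => m _; rewrite tsum_lift_tens; last by lin_tac.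
rewrite tsum_mul; last by lin_tac.
rewrite {1}/mulSJ (tsum_lin _ _ (g := fun s => Eu (l + m) l (s ** P m))); last by lin_tac.
apply: eq_tsum => a b; rewrite tsum_pure; last by lin_tac.
rewrite [antipode H0 _]tmapE; try lin_tac.
by rewrite end_antipode H0_mul_unit eqxx scale1r m1r mA.
Qed.

(** The candidate m(id ⊗ S)(Fbar) for the inverse of v. *)
Definition vbar : Hsp T U := \sum_l \sum_m Eu (l + m) l (Kbar l ** P (- m)).

Lemma vbar_mul n1 n2 u :
  vbar *' Eu n1 n2 u = \sum_m Eu (n1 + m) n2 (Kbar n1 ** P (- m) ** u).
Proof.
rewrite /vbar mul_suml -(sum_eq_l (fun l => \sum_m Eu (l + m) n2 (Kbar l ** P (- m) ** u)) n1).
by apply: eq_bigr => l _; rewrite mul_suml scaler_sumr; apply: eq_bigr => m _;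
  rewrite H0_mul_unit.
Qed.

Lemma mul_vJ n1 n2 u :
  Eu n1 n2 u *' vJ HU iota J = \sum_m Eu n1 (n2 - m) (u ** κ (n2 - m) ** P m).
Proof.
rewrite vJE mul_sumr.
transitivity (\sum_m \sum_l (l == n2 - m)%:R *: Eu n1 l (u ** κ l ** P m)).
  rewrite exchange_big; apply: eq_bigr => l _; rewrite mul_sumr; apply: eq_bigr => m _.
  by rewrite H0_mul_unit mA (eq_sym l) subr_eq.
by apply: eq_bigr => m _; rewrite (sum_eq_l (fun l => Eu n1 l (u ** κ l ** P m))).
Qed.

Lemma minid_mulSJ_minid l m m' u : u ** P m ** κ l ** P m' = (m == m')%:R *: (u ** κ l ** P m').
Proof.
rewrite -!mA (mulSJ_minid hU hA hJ) (mA (P m)) (minidM hA) mulZl mulZr.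
by case: (eqVneq m m') => [->|]; rewrite ?scale0r.
Qed.

Lemma vbarK : vbar *' vJ HU iota J = aone H0.
Proof.
rewrite {1}/vbar mul_suml.
transitivity (\sum_l \sum_m \sum_m' (- m == m')%:R *: Eu (l + m) (l - m') (Kbar l ** κ (l - m')
  ** P m')).
  apply: eq_bigr => l _; rewrite mul_suml; apply: eq_bigr => m _.
  by rewrite mul_vJ; apply: eq_bigr => m' _; rewrite minid_mulSJ_minid tensZr.
transitivity (\sum_l \sum_m Eu (l + m) (l + m) (P (- m))).
  apply: eq_bigr => l _; apply: eq_bigr => m _.
  rewrite (sum_eq_r (fun m' => Eu (l + m) (l - m') (Kbar l ** κ (l - m') ** P m'))) opprK.
  by rewrite -{3}[l](addrK m) (Kbar_mulSJ hU hA hJ).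
transitivity (\sum_l Eu l l e); last by rewrite HJ_one.
transitivity (\sum_l \sum_m Eu l l (P (- m))).
  rewrite exchange_big [RHS]exchange_big; apply: eq_bigr => m _ /=.
  by rewrite [RHS](reindex_inj (addIr m)).
apply: eq_bigr => l _.
by rewrite -tens_sumr -(sum_minid hA) [in RHS](reindex_inj (@oppr_inj _)).
Qed.

Let vJK : vJ HU iota J *' vbar = aone H0.
Proof.
have [w [vw wv]] := invertible_left hH0 vbarK.
by rewrite -[vbar](amul1r hH0) -vw (amulA hH0 vbar) vbarK (amul1l hH0).
Qed.

Lemma ainv_vJ : ainv H0 (vJ HU iota J) = vbar.
Proof. exact: (ainv_uniq hH0 vJK vbarK). Qed.

Lemma HJ_antipode_conj h : antipode HJ h = vbar *' antipode H0 h *' vJ HU iota J.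
Proof. by rewrite linfunE ?ainv_vJ //; lin_tac. Qed.

Lemma H0_antipodeM x y : antipode H0 (x *' y) = antipode H0 y *' antipode H0 x.
Proof.
move: x; apply: Hsp_ext; [lin_tac|lin_tac|] => n1 n2 u.
move: y; apply: Hsp_ext; [lin_tac|lin_tac|] => n3 n4 v.
rewrite H0_mul_unit lfunZ /=.
rewrite !tmapE; try lin_tac.
by rewrite !end_antipode H0_mul_unit hopf_antipodeM // eq_sym.
Qed.

Lemma HJ_antipodeM x y : antipode HJ (x *' y) = antipode HJ y *' antipode HJ x.
Proof.
rewrite !HJ_antipode_conj H0_antipodeM !(amulA hH0).
rewrite -(amulA hH0 _ (vJ _ _ _) vbar) vJK (amul1r hH0).
by rewrite -!(amulA hH0).
Qed.

(** Conjugation by v is injective, and so is S because the antipode of U is. *)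
Lemma HJ_antipode_inj : injective (antipode HJ).
Proof.
pose R : 'End(Hsp T U) := tmap (antipode (end_whopf k T)) (S^-1)%VF.
have S_inj : injective S := hopf_antipode_inj hU.
have RK h : antipode H0 (R h) = h.
  move: h; apply: Hsp_ext; [lin_tac|lin_tac|] => n1 n2 u.
  rewrite tmapE; try lin_tac.
  rewrite [antipode H0 _]tmapE; try lin_tac.
  by rewrite !end_antipode lker0_lfunVK //; apply/lker0P.
have KR h : R (antipode H0 h) = h.
  move: h; apply: Hsp_ext; [lin_tac|lin_tac|] => n1 n2 u.
  rewrite [antipode H0 _]tmapE; try lin_tac.
  rewrite tmapE; try lin_tac.
  by rewrite !end_antipode lker0_lfunK //; apply/lker0P.
move=> x y; rewrite !HJ_antipode_conj => xy.
apply: (can_inj KR).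
have cancel_v z : vJ HU iota J *' (vbar *' z *' vJ HU iota J) *' vbar = z.
  by rewrite !(amulA hH0) vJK (amul1l hH0) -(amulA hH0) vJK (amul1r hH0).
by rewrite -(cancel_v (antipode H0 x)) xy cancel_v.
Qed.

Lemma HJ_antipodeE n1 n2 u : antipode HJ (Eu n1 n2 u) =
  \sum_m \sum_m' Eu (n2 + m) (n1 - m') (Kbar n2 ** P (- m) ** S u ** κ (n1 - m') ** P m').
Proof.
rewrite HJ_antipode_conj [antipode H0 _]tmapE; try lin_tac.
rewrite end_antipode vbar_mul mul_suml; apply: eq_bigr => m _.
by rewrite mul_vJ.
Qed.

Lemma HJ_antipode_minid n m : antipode HJ (Eu n n (P m)) = Eu (n + m) (n + m) (P (- m)).
Proof.
rewrite HJ_antipodeE.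
transitivity (\sum_r \sum_r' ((r == m)%:R * (r' == - m)%:R) *:
   Eu (n + r) (n - r') (Kbar n ** κ (n - r') ** P r')).
  apply: eq_bigr => r _; apply: eq_bigr => r' _.
  rewrite (antipode_minid hA) -(mA _ (P (- r))) (minidM hA) eqr_opp mulZr !mulZl tensZr
    minid_mulSJ_minid tensZr scalerA.
  by case: (eqVneq r m) => [->|]; rewrite ?mul0r ?scale0r // eq_sym.
rewrite sum_eq_l2 opprK -{3}[n](addrK m) (Kbar_mulSJ hU hA hJ) //.
Qed.

Lemma HJ_antipode_unit n : antipode HJ (Eu n n e) = \sum_m Eu (n + m) (n + m) (P (- m)).
Proof.
rewrite -(sum_minid hA) tens_sumr lfun_sum; apply: eq_bigr => m _.
exact: HJ_antipode_minid.
Qed.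

Lemma sum_minidN : \sum_m P (- m) = e.
Proof. by rewrite -(sum_minid hA) [RHS](reindex_inj (@oppr_inj _)). Qed.

Lemma sum_lin_minidN (f : U -> Hsp T U) : lin f -> \sum_m f (P (- m)) = f e.
Proof. by move=> fl; rewrite -(lin_bigsum fl) sum_minidN. Qed.

(** In the product of the legs E_(n1+m,n2+m') a and S_J(E_(n1,n2) P_m b P_m') the
    matrix units match only for one weight, and summing over m' removes a
    projection; what is left is ε(u) Kbar(n1) κ(n1+m) P_(-m), where [Kbar_mulSJ]
    applies. *)
Lemma HJ_target n1 n2 u : \tsum_(a, b <- comul HJ (Eu n1 n2 u)) (a *' antipode HJ b) =
  ε u *: \sum_m Eu (n1 + m) (n1 + m) (P (- m)).
Proof.
rewrite sw_HJ_unit; last by lin_tac.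
rewrite scaler_sumr; apply: eq_bigr => m _.
pose f q := \tsum_(a, b <- W n1 n2 u)
  Eu (n1 + m) (n1 + m) (a ** Kbar n2 ** q ** S b ** κ (n1 + m) ** P (- m)).
transitivity (\sum_m' f (P (- m'))).
  apply: eq_bigr => m' _; apply: eq_tsum => a b; rewrite HJ_antipodeE mul_sumr.
  pose Q (r r' : T) := Eu (n1 + m) (n1 - r') (a ** Kbar n2 ** P (- m') ** S b ** κ (n1 - r') **
    P r').
  transitivity (Q m' (- m)); last by rewrite /Q opprK.
  rewrite -(sum_eq_l2 Q).
  apply: eq_bigr => r _; rewrite mul_sumr; apply: eq_bigr => r' _.
  rewrite H0_mul_unit (inj_eq (addrI n2)) !hopf_antipodeM // !(antipode_minid hA) !mA
    minid_mulSJ_minid.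
  rewrite tensZr scalerA (eq_sym r) (eq_sym r').
  have [<-|_] := eqVneq m' r; last first.
    by rewrite (mul0r (- m == r')%:R); exact: (etrans (scale0r _) (esym (scale0r _))).
  by rewrite -(mA _ (P (- m')) (P (- m'))) (minidM hA) eqxx scale1r.
rewrite sum_lin_minidN; last by rewrite /f; lin_tac.
rewrite /f -(tsum_lin _ _ (g := fun s => Eu (n1 + m) (n1 + m) (s ** κ (n1 + m) ** P (- m))));
  last by lin_tac.
under eq_tsum => a b do rewrite m1r.
rewrite (dcomul_Kbar hU hJ) !mulZl tensZr; congr (_ *: (_ ⊗ _)).
by rewrite -{1}[n1](addrK m) (Kbar_mulSJ hU hA hJ).
Qed.

(** Summing over m contracts S(a) κ(n1) b to ε(u) κ(n2); then only the weight
    r = -m' survives and [Kbar_mulSJ] leaves P_m', which sums to 1. *)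
Lemma HJ_source n1 n2 u : \tsum_(a, b <- comul HJ (Eu n1 n2 u)) (antipode HJ a *' b) =
  ε u *: Eu n2 n2 e.
Proof.
rewrite sw_HJ_unit; last by lin_tac.
pose f m' q := \sum_r \tsum_(a, b <- W n1 n2 u)
  Eu (n2 + m' + r) n2 (Kbar (n2 + m') ** P (- r) ** S a ** κ n1 ** q ** b ** P m').
transitivity (\sum_m \sum_m' f m' (P m)).
  apply: eq_bigr => m _; apply: eq_bigr => m' _; rewrite /f -tsum_sum; apply: eq_tsum => a b.
  rewrite HJ_antipodeE mul_suml; apply: eq_bigr => r _; rewrite mul_suml.
  pose Q r' := Eu (n2 + m' + r) n2 (Kbar (n2 + m') ** P (- r) ** S a ** κ (n1 + m - r') ** P r'
    ** P m ** b ** P m').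
  transitivity (Q m); last by rewrite /Q addrK -(mA _ (P m) (P m)) (minidM hA) eqxx scale1r.
  rewrite -(sum_eq_l Q); apply: eq_bigr => r' _.
  by rewrite H0_mul_unit !mA subr_eq (inj_eq (addrI n1)) eq_sym.
rewrite exchange_big /=.
transitivity (\sum_m' f m' e).
  apply: eq_bigr => m' _.
  have fl : lin (f m') by rewrite /f; lin_tac.
  by rewrite -(lin_bigsum fl) (sum_minid hA).
transitivity (\sum_m' ε u *: Eu n2 n2 (P m')).
  apply: eq_bigr => m' _.
  transitivity (\sum_r (- r == m')%:R *: (ε u *: Eu (n2 + m' + r) n2 (Kbar (n2 + m') ** κ n2 **
    P m'))).
    apply: eq_bigr => r _.
    transitivity (\tsum_(a, b <- W n1 n2 u) Eu (n2 + m' + r) n2 (Kbar (n2 + m') ** P (- r) ** (S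
      a ** κ n1 ** b) ** P m')).
      by apply: eq_tsum => a b; rewrite m1r !mA.
    rewrite -(tsum_lin _ _ (g := fun s => Eu _ n2 (Kbar (n2 + m') ** P (- r) ** s ** P m')));
      last by lin_tac.
    by rewrite (dcomul_mulSJ hU hJ) mulZr mulZl tensZr minid_mulSJ_minid tensZr !scalerA mulrC.
  under eq_bigr => r _ do rewrite eqr_oppLR.
  by rewrite sum_eq_l addrK (Kbar_mulSJ hU hA hJ).
by rewrite -scaler_sumr -tens_sumr (sum_minid hA).
Qed.

Local Notation SV := (antipode HJ)^-1%VF.

Lemma HJ_antipodeK h : SV (antipode HJ h) = h.
Proof. by apply: lker0_lfunK; apply/lker0P/HJ_antipode_inj. Qed.

Lemma HJ_antipodeVK h : antipode HJ (SV h) = h.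
Proof. by apply: lker0_lfunVK; apply/lker0P/HJ_antipode_inj. Qed.

Lemma sw_HJ_one (X : lmodType k) (F : Hsp T U -> Hsp T U -> X) : bilin F ->
  tsum (comul HJ (aone HJ)) F = \sum_n \sum_m F (Eu (n + m) (n + m) e) (Eu n n (P m)).
Proof.
move=> Fl; rewrite HJ_comul1 // (lin_bigsum (f := fun s => tsum s F)); last by lin_tac.
apply: eq_bigr => n _; rewrite (lin_bigsum (f := fun s => tsum s F)); last by lin_tac.
by apply: eq_bigr => m _; rewrite tsum_pure.
Qed.

(** Apply the antipode of H_J, which reverses products: the claim becomes
    [HJ_target] for an element on which the antipode is known. The same argument
    proves [HJ_skew_source] and [HJ_skew_antipode]. *)
Lemma HJ_skew_target h : \tsum_(a, b <- comul HJ h) (b *' SV a) =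
  \tsum_(a, b <- comul HJ (aone HJ)) (counit HJ (b *' h) *: a).
Proof.
apply: HJ_antipode_inj; rewrite lfun_tsum.
transitivity (\tsum_(a, b <- comul HJ h) (a *' antipode HJ b)).
  by apply: eq_tsum => a b; rewrite HJ_antipodeM HJ_antipodeVK.
move: h; apply: Hsp_ext; [lin_tac|lin_tac|] => n1 n2 u.
rewrite HJ_target sw_HJ_one; last by lin_tac.
pose Q n m := ε u *: Eu (n + m) (n + m) e.
transitivity (antipode HJ (Q n1 0)).
  by rewrite /Q lfunZ addr0 HJ_antipode_unit.
congr (antipode HJ _); rewrite -(sum_eq_l2 Q).
apply: eq_bigr => n _; apply: eq_bigr => m _.
rewrite H0_mul_unit lfunZ HJ_counit_unit hopf_counitM // (counit_minid hA) /Q !scalerA.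
by congr (_ *: _); rewrite -mulrA.
Qed.

Lemma HJ_skew_source h : \tsum_(a, b <- comul HJ h) (SV b *' a) =
  \tsum_(a, b <- comul HJ (aone HJ)) (counit HJ (h *' a) *: b).
Proof.
apply: HJ_antipode_inj; rewrite lfun_tsum.
transitivity (\tsum_(a, b <- comul HJ h) (antipode HJ a *' b)).
  by apply: eq_tsum => a b; rewrite HJ_antipodeM HJ_antipodeVK.
move: h; apply: Hsp_ext; [lin_tac|lin_tac|] => n1 n2 u.
rewrite HJ_source sw_HJ_one; last by lin_tac.
transitivity (antipode HJ (\sum_m (ε u *: Eu (n2 - m) (n2 - m) (P m)))).
  rewrite lfun_sum -sum_minidN tens_sumr scaler_sumr; apply: eq_bigr => m _.
  by rewrite lfunZ HJ_antipode_minid subrK.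
congr (antipode HJ _); rewrite exchange_big; apply: eq_bigr => m _ /=.
rewrite -(sum_eq_l (fun n => ε u *: Eu n n (P m))); apply: eq_bigr => n _.
by rewrite H0_mul_unit lfunZ HJ_counit_unit m1r scalerA (eq_sym n) subr_eq.
Qed.

Lemma HJ_skew_antipode h :
  \tsum_(a, b <- comul HJ h) \tsum_(c, d <- comul HJ b) (SV d *' c *' SV a) = SV h.
Proof.
apply: HJ_antipode_inj; rewrite lfun_tsum HJ_antipodeVK.
transitivity (\tsum_(a, b <- comul HJ h) (a *' \tsum_(c, d <- comul HJ b) (antipode HJ c *' d))).
  apply: eq_tsum => a b; rewrite lfun_tsum (tsum_lin _ _ (g := fun s => a *' s)); last by lin_tac.
  by apply: eq_tsum => c d; rewrite !HJ_antipodeM !HJ_antipodeVK.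
move: h; apply: Hsp_ext; [lin_tac|lin_tac|] => n1 n2 u.
rewrite sw_HJ_unit; last by lin_tac.
pose Q (m m' : T) := \tsum_(a, b <- W n1 n2 u) (Eu (n1 + m) (n2 + m') a *' (ε b *: Eu n2 n2 e)).
transitivity (Q 0 0).
  rewrite -(sum_eq_l2 Q); apply: eq_bigr => m _; apply: eq_bigr => m' _.
  rewrite -tsumZ; apply: eq_tsum => a b.
  by rewrite HJ_source counit_minid2 -scalerA mulZr.
rewrite /Q !addr0 -[u in RHS](dcomul_counitr hU hJ n1 n2).
rewrite (tsum_lin _ _ (g := fun s => Eu n1 n2 s)); last by lin_tac.
by apply: eq_tsum => a b; rewrite mulZr H0_mul_unit eqxx scale1r m1r tensZr.
Qed.

(** * The opposite dual of H_J *)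

Local Notation U' := 'Hom(U, k^o).
Local Notation D := (Dsp T U).
Local Notation pm := (pairing_map T U).
Local Notation B := (op_whopf (dual_whopf HJ)).

Lemma op_dual_mulE phi psi h : (phi *[B] psi) h = \tsum_(a, b <- comul HJ h) (psi a * phi b :
    k^o).
Proof. by rewrite op_mulE dual_mulE. Qed.

Lemma op_dual_antipodeE phi h : antipode B phi h = phi (SV h).
Proof.
have dE psi g : antipode (dual_whopf HJ) psi g = psi (antipode HJ g).
  rewrite linfunE; first by rewrite comp_lfunE.
  by move=> a x y; apply/lfunP => v; rewrite add_lfunE scale_lfunE !comp_lfunE add_lfunE
    scale_lfunE.
have -> : antipode B phi = (phi \o SV)%VF; last by rewrite comp_lfunE.
have {1}<- : antipode (dual_whopf HJ) (phi \o SV)%VF = phi.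
  by apply/lfunP => g; rewrite dE comp_lfunE HJ_antipodeK.
apply: lker0_lfunK; apply/lker0P => x y xy; apply/lfunP => g.
by rewrite -[g]HJ_antipodeVK -!dE xy.
Qed.

(** The opposite dual of H_J transported to D along the pairing. The coproduct is
    given in the form that the relations of D_J ask for; that it is the transpose
    of the product of H is [dualJ_comul]. *)
Definition dualJ : whopf_data D := WHopfData
  (Algebra (tlin (fun x y => unpair (pm x *[B] pm y))) (unpair (aone B)))
  (tens_coalg (map2_coalg k T) (dual_coalg HU))
  (linfun (fun x => unpair (antipode B (pm x)))).

Let ul := @unpair_lin k T U.

Lemma dualJ_mul x y : pm (x *[dualJ] y) = pm x *[B] pm y.
Proof. by rewrite [x *[dualJ] y]tlin_pure ?unpairK //; lin_tac. Qed.

Lemma dualJ_one : pm (aone dualJ) = aone B.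
Proof. exact: unpairK. Qed.

Lemma dualJ_antipode x : pm (antipode dualJ x) = antipode B (pm x).
Proof. by rewrite [antipode dualJ x]linfunE ?unpairK //; lin_tac. Qed.

Lemma dualJ_mulE x y h : pm (x *[dualJ] y) h = \tsum_(a, b <- comul HJ h) (pm y a * pm x b : k^o).
Proof. by rewrite dualJ_mul op_dual_mulE. Qed.

Lemma map2_comul f : comul (map2_coalg k T) f =
  \sum_l \sum_m ((l.2 == m.1)%:R * f (l.1, m.2)) *: (delta k l ⊗ delta k m).
Proof.
rewrite linfunE //; do 2!apply: lin_sum => ?; apply: lin_scalel; apply: lin_mulr.
exact: lin_ffunx.
Qed.

Lemma map2_counit f : counit (map2_coalg k T) f = \sum_l f (l, l).
Proof. by rewrite linfunE //; apply: lin_sum => l; apply: lin_ffunx. Qed.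

Lemma sum_pair_eq (F : T * T -> k^o) p : \sum_l (p == l)%:R * F l = F p.
Proof. exact: (sum_eq_r F). Qed.

Lemma dualJ_comul x h g : ev2 pm h g (comul dualJ x) = pm x (h *[H0] g).
Proof.
have el := @ev2_lin k (Hsp T U) D pm.
move: h; apply: Hsp_ext; [rewrite /ev2; lin_tac|lin_tac|] => n1 n2 u.
move: g; apply: Hsp_ext; [rewrite /ev2; lin_tac|lin_tac|] => n3 n4 v.
rewrite H0_mul_unit lfunZ.
move: x; apply: tens_ext; [lin_tac|lin_tac|] => f y.
pose Z : tens D D := \tsum_(f1, f2 <- comul (map2_coalg k T) f)
  \tsum_(y1, y2 <- comul (dual_coalg HU) y) ((f1 ⊗ y1 : D) ⊗ (f2 ⊗ y2 : D)).
have -> : comul dualJ (f ⊗ y) = Z by apply: tlin_pure; lin_tac.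
rewrite (tsum_lin _ _ (el _ _)).
have fl l : lin (fun f : {ffun T * T -> k^o} => f l : k^o) by exact: lin_ffunx.
transitivity (\tsum_(f1, f2 <- comul (map2_coalg k T) f) (f1 (n1, n2) * f2 (n3, n4) * y (u ** v)
  : k^o)).
  apply: eq_tsum => f1 f2; rewrite (tsum_lin _ _ (el _ _)).
  rewrite -ev2_dual /ev2 (tsum_lin _ _ (g := fun s : k^o => _ * s : k^o)); last by lin_tac.
  apply: eq_tsum => y1 y2; rewrite tsum_pure; last by lin_tac.
  by rewrite !pairing_pure !lfunE /= mulrACA.
have b12 : bilin (fun f1 f2 : {ffun T * T -> k^o} => f1 (n1, n2) * f2 (n3, n4) * y (u ** v) :
  k^o).
  by split=> z; apply: lin_mull; [apply: lin_mull|apply: lin_mulr]; apply: fl.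
rewrite map2_comul (lin_bigsum (f := fun s => tsum s _)); last by lin_tac.
rewrite pairing_pure -[RHS]/(_ * _) mulrA.
pose G (l m : T * T) : k^o := (l.2 == m.1)%:R * f (l.1, m.2) * y (u ** v).
transitivity (G (n1, n2) (n3, n4)); last by [].
rewrite -(sum_pair_eq (fun l => G l (n3, n4))); apply: eq_bigr => l _.
rewrite (lin_bigsum (f := fun s => tsum s _)); last by lin_tac.
rewrite -(sum_pair_eq (G l)) mulr_sumr; apply: eq_bigr => m _.
rewrite (linZ (f := fun s => tsum s _)) ?tsum_pure //; last by lin_tac.
rewrite !deltaE /G [LHS]mulrC -!mulrA; congr (_ * (_ * _)).
by rewrite mulrC -mulrA.
Qed.

Lemma dualJ_counit x : counit dualJ x = pm x (aone HJ).
Proof.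
move: x; apply: tens_ext; [lin_tac|lin_tac|] => f x.
rewrite tlin_pure; last by lin_tac.
rewrite map2_counit HJ_one lfun_sum [counit _ x]linfunE; last by lin_tac.
rewrite mulr_suml; apply: eq_bigr => l _.
by rewrite pairing_pure.
Qed.

Lemma dualJ_weak_hopf : weak_hopf dualJ.
Proof.
apply: (skew_dual_weak_hopf (H := HJ) (P := pm) (T := SV)).
- exact: pairing_map_inj.
- exact: HJ_weak_bialgebra.
- exact: dualJ_mulE.
- by move=> h; rewrite dualJ_one.
- exact: dualJ_comul.
- exact: dualJ_counit.
- by move=> x h; rewrite dualJ_antipode op_dual_antipodeE.
- exact: HJ_skew_target.
- exact: HJ_skew_source.
- exact: HJ_skew_antipode.
Qed.

Lemma dualJ_mul_unit f x g y n1 n2 u :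
  pm ((f ⊗ x : D) *[dualJ] (g ⊗ y)) (Eu n1 n2 u) =
  \sum_m \sum_m' \tsum_(a, b <- W n1 n2 u)
    (g (n1 + m, n2 + m') * y a * (f (n1, n2) * x (P m ** b ** P m')) : k^o).
Proof.
rewrite dualJ_mulE sw_HJ_unit; last by lin_tac.
do 2!(apply: eq_bigr => ? _); apply: eq_tsum => a b.
by rewrite !pairing_pure.
Qed.

Lemma dualJ_mul_dual_fun f x g n1 n2 u :
  pm ((f ⊗ x : D) *[dualJ] (g ⊗ ε)) (Eu n1 n2 u) =
  \sum_m \sum_m' (g (n1 + m, n2 + m') * (f (n1, n2) * x (P m ** u ** P m'))).
Proof.
rewrite dualJ_mul_unit; apply: eq_bigr => m _; apply: eq_bigr => m' _.
rewrite -[u in RHS](dcomul_counitl hU hJ n1 n2).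
rewrite (tsum_lin _ _ (g := fun s => g (n1 + m, n2 + m') * (f (n1, n2) * x (P m ** s ** P m')) :
  k^o)); last by lin_tac.
by apply: eq_tsum => a b; rewrite mulZr mulZl lfunZ -mulrA (mulrCA (f (n1, n2))).
Qed.

Lemma dualJ_mul_fun f g y : (f ⊗ ε : D) *[dualJ] (g ⊗ y) = [ffun l => f l * g l] ⊗ y.
Proof.
apply: D_ext => n1 n2 u; rewrite dualJ_mul_unit pairing_pure ffunE.
pose Q (m m' : T) : k^o := f (n1, n2) * (g (n1 + m, n2 + m') * y u).
transitivity (Q 0 0); last by rewrite /Q !addr0 mulrA.
rewrite -(sum_eq_l2 Q); apply: eq_bigr => m _; apply: eq_bigr => m' _.
rewrite /Q -[u in RHS](dcomul_counitr hU hJ n1 n2).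
rewrite (tsum_lin _ _ (g := fun s => (_ * _) *: (f (n1, n2) * (g (n1 + m, n2 + m') * y s) :
  k^o))); last by lin_tac.
apply: eq_tsum => a b; rewrite counit_minid2 lfunZ.
have aux (p q r s t : k) : p * q * (r * (s * t)) = s * (r * (p * (t * q))) by rewrite mulrACA;
  ring.
exact: aux.
Qed.

Lemma counit_mulSJ l : ε (κ l) = 1.
Proof.
rewrite lfun_tsum -(hopf_counit1 hU) -(twist_counitl hJ l) lfun_tsum.
by apply: eq_tsum => a b; rewrite (hopf_counitM hU) (hopf_counit_antipode hU) lfunZ.
Qed.

Lemma counit_Kbar l : ε (Kbar l) = 1.
Proof.
rewrite lfun_tsum -(hopf_counit1 hU) -(Jinv_counitl hU hJ l) lfun_tsum.
by apply: eq_tsum => a b; rewrite (hopf_counitM hU) (hopf_counit_antipode hU) lfunZ.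
Qed.

Lemma dualJ_antipode_adj x h : pm (antipode dualJ x) (antipode HJ h) = pm x h.
Proof.
by rewrite dualJ_antipode op_dual_antipodeE HJ_antipodeK.
Qed.

(** The inverse of the antipode is the transpose of the antipode of H_J, whose
    values on matrix units are known; so the antipode is computed by checking the
    inverse. *)
Lemma dualJ_antipode_eq x y : (forall n1 n2 u, pm x (Eu n1 n2 u) =
    pm y (antipode HJ (Eu n1 n2 u))) ->
  antipode dualJ x = y.
Proof.
move=> xy; apply: pairing_map_inj; apply/lfunP => h.
rewrite -[h]HJ_antipodeVK dualJ_antipode_adj; move: {h}(SV h).
by apply: Hsp_ext; [lin_tac|lin_tac|].
Qed.

Lemma dualJ_antipode_inj : injective (antipode dualJ).
Proof.
move=> x y xy; apply: pairing_map_inj; apply/lfunP => h.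
by rewrite -(dualJ_antipode_adj x) xy dualJ_antipode_adj.
Qed.

Lemma dualJ_antipode_bij : bijective (antipode dualJ).
Proof.
have kS : lker (antipode dualJ) == 0%VS by apply/lker0P/dualJ_antipode_inj.
by exists (antipode dualJ)^-1%VF; [exact: lker0_lfunK|exact: lker0_lfunVK].
Qed.

Lemma KJE l : KJ HU iota J l = \sum_m κ (l - m) ** P m.
Proof. by []. Qed.

Lemma dualJ_is_DJ : is_DJ HU iota J dualJ.
Proof.
have hD := dualJ_weak_hopf.
split.
- by [].
- exact: (amulA (wb_alg (wh_wb hD))).
- by move=> f g; rewrite /of_fun dualJ_mul_fun.
- move=> f x; rewrite /of_fun /of_dual dualJ_mul_fun; congr (_ ⊗ _).
  by apply/ffunP => l; rewrite !ffunE mulr1.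
- move=> a1 a2 x f xa; rewrite /of_fun /of_dual dualJ_mul_fun.
  apply: D_ext => n1 n2 u; rewrite dualJ_mul_dual_fun pairing_pure !ffunE mulr1 /=.
  rewrite -(sum_eq_l2 (fun m m' => f (n1 + m, n2 + m') * x u : k^o) a1 a2).
  apply: eq_bigr => m _; apply: eq_bigr => m' _; rewrite mul1r.
  rewrite [x (P m ** u ** P m')]xa minid_proj lfunZ (eq_sym a1).
  have [->|_] := eqVneq m a1; last by rewrite !mul0r [X in _ * X = _]scale0r mulr0 scale0r.
  have [->|_] := eqVneq m' a2; last by rewrite mulr0 [X in _ * X = _]scale0r mulr0 scale0r.
  by rewrite mul1r !scale1r -xa.
- move=> x y n1 n2 u; rewrite -pairing_mapE dualJ_mul_unit.
  transitivity (\tsum_(a, b <- W n1 n2 u) (y a * x b : k^o)); last by [].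
  under eq_bigr => m _ do rewrite -tsum_sum.
  rewrite -tsum_sum; apply: eq_tsum => a b.
  rewrite -(sum_minid2 (f := fun s => y a * x s : k^o)); last by lin_tac.
  by do 2!(apply: eq_bigr => ? _); rewrite !ffunE !mul1r.
- apply: D_ext => n1 n2 u; rewrite dualJ_one pairing_pure ffunE mul1r.
  exact: HJ_counit_unit.
- exact: dualJ_antipode_bij.
- exact: (antipodeM hD).
- move=> f; apply: dualJ_antipode_eq => n1 n2 u; rewrite HJ_antipodeE lfun_sum.
  rewrite pairing_pure.
  pose Q m m' : k^o := f (n1 - m', n2 + m) * ε u.
  transitivity (Q 0 0); first by rewrite /Q subr0 addr0.
  rewrite -(sum_eq_l2 Q); apply: eq_bigr => m _; rewrite lfun_sum; apply: eq_bigr => m' _.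
  rewrite pairing_pure ffunE /= !(hopf_counitM hU) !(counit_minid hA) counit_mulSJ counit_Kbar.
  rewrite (hopf_counit_antipode hU) mul1r mulr1 oppr_eq0 /Q.
  have aux (p q r s : k) : p * q * (r * s) = r * (p * s * q) by ring.
  exact: aux.
- move=> x n1 n2 u; rewrite -pairing_mapE -dualJ_antipode_adj.
  rewrite lker0_lfunVK; last by apply/lker0P/dualJ_antipode_inj.
  rewrite HJ_antipodeE lfun_sum.
  transitivity (\sum_m x (Kbar n2 ** P (- m) ** S u ** KJ HU iota J n1)).
    apply: eq_bigr => m _; rewrite lfun_sum KJE mul_sumr lfun_sum; apply: eq_bigr => m' _.
    by rewrite pairing_pure ffunE mul1r !mA.
  rewrite -(lin_bigsum (f := fun s => x (Kbar n2 ** s ** S u ** KJ HU iota J n1)));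
    last by lin_tac.
  by rewrite sum_minidN m1r.
Qed.

Lemma dualJ_morphism : is_morphism dualJ B pm.
Proof.
split.
- exact: dualJ_mul.
- exact: dualJ_one.
- move=> x; apply: (@ev2_sep k (Hsp T U) 'Hom(Hsp T U, k^o) (\1%VF : 'End('Hom(Hsp T U, k^o)))).
    by move=> f g; rewrite !lfunE.
  move=> h g; rewrite [LHS]ev2_dual -[LHS](dualJ_comul x h g).
  rewrite /ev2 tsum_tmap; try lin_tac.
  by apply: eq_tsum => a b; rewrite !lfunE.
- move=> x; rewrite [LHS]linfunE ?dualJ_counit //; lin_tac.
- exact: dualJ_antipode.
Qed.

(** * Uniqueness of D_J *)

Section Uniqueness.
Variables D1 D2 : whopf_data D.
Hypotheses (h1 : is_DJ HU iota J D1) (h2 : is_DJ HU iota J D2).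

Lemma DJ_fun_mul f g x (G : whopf_data D) : is_DJ HU iota J G ->
  of_fun HU f *[G] (g ⊗ x : D) = [ffun l => f l * g l] ⊗ x.
Proof.
move=> hG; rewrite -(DJ_mul_fun_dual hG) (DJ_mulA hG) (DJ_mul_fun hG).
by rewrite (DJ_mul_fun_dual hG).
Qed.

(** The homogeneous components for the bigrading of the dual of U. *)
Definition bihom_part (a b : T) (x : U') : U' := linfun (fun u : U => x (P a ** u ** P b)).

Lemma bihom_partE a b x u : bihom_part a b x u = x (P a ** u ** P b).
Proof. by rewrite linfunE //; lin_tac. Qed.

Lemma bihom_part_bidegree a b x : bidegree HU iota a b (bihom_part a b x).
Proof.
by move=> u; rewrite !bihom_partE minid_proj !eqxx mulr1 scale1r.
Qed.

Lemma sum_bihom_part x : x = \sum_a \sum_b bihom_part a b x.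
Proof.
apply/lfunP => u; rewrite sum_lfunE -(sum_minid2 (f := fun s => x s)); last by lin_tac.
by apply: eq_bigr => a _; rewrite sum_lfunE; apply: eq_bigr => b _; rewrite bihom_partE.
Qed.

(** Associativity reduces the product (f x) (g y) to x g, x y and products with a
    function on the left. The relation for x g applies to each homogeneous
    component of x. *)
Lemma DJ_mul_uniq x y : x *[D1] y = x *[D2] y.
Proof.
have mul_fun f z : of_fun HU f *[D1] z = of_fun HU f *[D2] z.
  move: z; apply: tens_ext; [lin_tac|lin_tac|] => g z.
  by rewrite !DJ_fun_mul.
have mul_dual z w : of_dual T z *[D1] of_dual T w = of_dual T z *[D2] of_dual T w.
  by apply: D_ext => n1 n2 u; rewrite !pairing_mapE (DJ_mul_dual h1) (DJ_mul_dual h2).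
have mul_dual_fun z g : of_dual T z *[D1] of_fun HU g = of_dual T z *[D2] of_fun HU g.
  rewrite [z]sum_bihom_part /of_dual !tens_sumr !mul_suml; apply: eq_bigr => a _.
  rewrite !tens_sumr !mul_suml; apply: eq_bigr => b _.
  rewrite -!/(of_dual T _).
  rewrite (DJ_mul_dual_fun h1 _ (bihom_part_bidegree a b z)) (DJ_mul_dual_fun h2 _
    (bihom_part_bidegree a b z)).
  exact: mul_fun.
have fun_dual f z w : (of_fun HU f *[D1] of_dual T z) *[D1] of_dual T w =
  (of_fun HU f *[D2] of_dual T z) *[D2] of_dual T w.
  by rewrite -(DJ_mulA h1) -(DJ_mulA h2) mul_dual mul_fun.
have any_dual z w : z *[D1] of_dual T w = z *[D2] of_dual T w.
  move: z; apply: tens_ext; [lin_tac|lin_tac|] => f z.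
  by rewrite -{1}(DJ_mul_fun_dual h1) -(DJ_mul_fun_dual h2) fun_dual.
move: x; apply: tens_ext; [lin_tac|lin_tac|] => f x.
move: y; apply: tens_ext; [lin_tac|lin_tac|] => g y.
rewrite -{1}(DJ_mul_fun_dual h1 f x) -{1}(DJ_mul_fun_dual h1 g y).
rewrite -(DJ_mul_fun_dual h2 f x) -(DJ_mul_fun_dual h2 g y).
rewrite !(DJ_mulA h1) !(DJ_mulA h2) -(DJ_mulA h1 (of_fun HU f)) -(DJ_mulA h2 (of_fun HU f)).
by rewrite any_dual mul_dual_fun mul_fun.
Qed.

Section AntipodeInverse.
Variable G : whopf_data D.
Hypothesis hG : is_DJ HU iota J G.
Local Notation GV := ((antipode G)^-1)%VF.

Let kS : lker (antipode G) == 0%VS.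
Proof. by apply/lker0P/bij_inj/(DJ_antipode_bij hG). Qed.

Lemma DJ_antipodeK y : GV (antipode G y) = y.
Proof. exact: lker0_lfunK. Qed.

Lemma DJ_antipodeVK y : antipode G (GV y) = y.
Proof. exact: lker0_lfunVK. Qed.

Lemma DJ_antipodeV_mul a b : GV (a *[G] b) = GV b *[G] GV a.
Proof.
rewrite -[GV b *[G] GV a]DJ_antipodeK (DJ_antipodeM hG).
by rewrite !DJ_antipodeVK.
Qed.

Lemma DJ_antipodeV_fun f : GV (of_fun HU f) = of_fun HU [ffun l => f (l.2, l.1)].
Proof.
rewrite -[RHS]DJ_antipodeK (DJ_antipode_fun hG); congr (GV (of_fun HU _)).
by apply/ffunP => -[a b]; rewrite !ffunE.
Qed.

End AntipodeInverse.

(** The antipode is compared through its inverse, which reverses products and is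
    prescribed on functions and on the dual of U. *)
Lemma DJ_uniq : D1 = D2.
Proof.
have EA : walg D1 = walg D2.
  have := DJ_mul_uniq; have := DJ_one h1; have := DJ_one h2.
  case: (D1) => -[m1 e1] c1 S1; case: (D2) => -[m2 e2] c2 S2 /= <- <- mm.
  congr (Algebra _ _); apply/lfunP; apply: tens_ext; [lin_tac|lin_tac|] => x y.
  exact: mm.
have EC : wcoalg D1 = wcoalg D2 by rewrite (DJ_coalg h1) (DJ_coalg h2).
have ES : antipode D1 = antipode D2.
  have SV12 y : ((antipode D1)^-1)%VF y = ((antipode D2)^-1)%VF y.
    move: y; apply: tens_ext; [lin_tac|lin_tac|] => f x.
    rewrite -{1}(DJ_mul_fun_dual h1) -(DJ_mul_fun_dual h2).
    rewrite (DJ_antipodeV_mul h1) (DJ_antipodeV_mul h2) DJ_mul_uniq.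
    rewrite (DJ_antipodeV_fun h1) (DJ_antipodeV_fun h2); congr (_ *[D2] _).
    by apply: D_ext => n1 n2 u; rewrite !pairing_mapE (DJ_antipode_dual h1) (DJ_antipode_dual h2).
  apply/lfunP => y.
  by rewrite -[RHS](DJ_antipodeVK h1) SV12 (DJ_antipodeK h2).
case: (D1) (D2) EA EC ES => [a1 c1 s1] [a2 c2 s2] /=.
by move=> -> -> ->.
Qed.

End Uniqueness.

End TwistedWeakHopf.

Theorem theorem4p3p1 (k : closedFieldType) (T : finZmodType) (U : vectType k)
    (HU : whopf_data U) (iota : 'Hom({ffun T -> k^o}, U)) (J : T -> tens U U)
    (hU : hopf HU) (hA : hopf_embedding HU iota)
    (hJ : dynamical_twist HU iota J) :
  (exists D : whopf_data (Dsp T U), is_DJ HU iota J D) /\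
  (forall D : whopf_data (Dsp T U), is_DJ HU iota J D ->
     [/\ weak_hopf D,
         bijective (pairing_map T U) &
         is_morphism D (op_whopf (dual_whopf (HJ HU iota J))) (pairing_map T U)]).
Proof.
have [_ hi] := hA.
have hD0 := dualJ_is_DJ hU hi hJ.
split=> [|D hD]; first by exists (dualJ HU iota J).
rewrite (DJ_uniq hU hi hD hD0); split.
- exact: (dualJ_weak_hopf hU hi hJ).
- exact: pairing_map_bij.
- exact: dualJ_morphism.
Qed.
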